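(* Given $1<p<\infty$, there is a bounded domain $\Omega\subset\mathbb R^3$, homeomorphic to the (open) unit ball of $\mathbb R^3$ via a locally bi-Lipschitz homeomorphism, such that $W^{1,q}(\Omega)$ is not dense in $W^{1,p}(\Omega)$ for any $q>p$.
   Context: For a domain $\Omega\subset\mathbb R^n$ and $1\le p\le\infty$, $W^{1,p}(\Omega)$ is the Sobolev space of all $u\in L^p(\Omega)$ whose weak first partial derivatives $D_1u,\dots,D_nu$ belong to $L^p(\Omega)$, with the norm given by $\|u\|_{W^{1,p}(\Omega)}^p=\int_\Omega |u|^p+|\nabla u|^p\,dx$ for $p<\infty$, and $\|u\|_{W^{1,\infty}(\Omega)}=\operatorname{ess\,sup}_\Omega|u|+\sum_{i}\operatorname{ess\,sup}_\Omega|D_iu|$. For bounded $\Omega$ and $q>p$ one has $W^{1,q}(\Omega)\subset W^{1,p}(\Omega)$; density is with respect to the norm of $W^{1,p}(\Omega)$. A map $f:\Omega\to\Omega'$ is locally bi-Lipschitz if for every compact set $K\subset\Omega$ there exists $L=L(K)$ such that $\frac1L|x-y|\le|f(x)-f(y)|\le L|x-y|$ for all $x,y\in K$. *)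

(* Defs.v *)
From HB Require Import structures.
From mathcomp Require Import all_boot all_order all_algebra.
From mathcomp Require Import all_classical all_reals all_analysis.
From mathcomp Require Import measurable_realfun.

Set Implicit Arguments.
Unset Strict Implicit.
Unset Printing Implicit Defensive.

Import Order.TTheory GRing.Theory Num.Theory.
Import numFieldNormedType.Exports.

Local Open Scope classical_set_scope.
Local Open Scope ring_scope.

(* The product type carries both the product topology and the product (= Borel)
   sigma-algebra.  Its library norm `|x| is the sup norm; the Euclidean norm is
   enorm below. *)
Notation R3 R := (R * R * R)%type.

Definition coord3 {R : realType} (i : 'I_3) (x : R3 R) : R :=
  [tuple x.1.1; x.1.2; x.2]`_i.

Definition basis3 {R : realType} (i : 'I_3) : R3 R :=
  ((i == 0 :> nat)%:R, (i == 1%N :> nat)%:R, (i == 2%N :> nat)%:R).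

Definition enorm {R : realType} (x : R3 R) : R :=
  Num.sqrt (\sum_(i < 3) coord3 i x ^+ 2).

Definition unit_ball {R : realType} : set (R3 R) := [set x | enorm x < 1].

Definition domain {R : realType} (Omega : set (R3 R)) : Prop :=
  [/\ Omega !=set0, open Omega & connected Omega].

Definition homeomorphism_between {R : realType} (A B : set (R3 R))
    (f : R3 R -> R3 R) : Prop :=
  exists g : R3 R -> R3 R,
    [/\ {homo f : x / A x >-> B x}, {homo g : y / B y >-> A y},
        (forall x, A x -> g (f x) = x) & (forall y, B y -> f (g y) = y)] /\
    {within A, continuous f} /\ {within B, continuous g}.

(* 0 < L rules out L = 0, for which L^-1 = 0. *)
Definition locally_bilipschitz {R : realType} (Omega : set (R3 R))
    (f : R3 R -> R3 R) : Prop :=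
  forall K : set (R3 R), K `<=` Omega -> compact K ->
  exists L : R, 0 < L /\ forall x y, K x -> K y ->
    L^-1 * enorm (x - y) <= enorm (f x - f y) <= L * enorm (x - y).

Local Notation leb R := (@lebesgue_measure R).
Notation leb3 R := ((leb R \x leb R) \x leb R)%E.

(* L^p(Omega), 0 < p <= +oo: functions are defined on all of R^3 but only their
   values on Omega matter, u \_ Omega being the extension by 0. *)
Definition Lp_on {R : realType} (Omega : set (R3 R)) (p : \bar R) :
    set (R3 R -> R) :=
  [set u | u \_ Omega \in Lfun (leb3 R) p].

Definition locally_integrable_on {R : realType} (Omega : set (R3 R))
    (u : R3 R -> R) : Prop :=
  forall K : set (R3 R), K `<=` Omega -> compact K ->
    (leb3 R).-integrable K (EFin \o u).

Definition iter_partial {R : realType} (s : seq 'I_3) (phi : R3 R -> R) :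
    R3 R -> R :=
  foldr (fun i f => 'D_(basis3 i) f) phi s.

Definition smooth {R : realType} (phi : R3 R -> R) : Prop :=
  forall s : seq 'I_3, continuous (iter_partial s phi) /\
    forall i x, derivable (iter_partial s phi) x (basis3 i).

Definition test_function {R : realType} (Omega : set (R3 R))
    (phi : R3 R -> R) : Prop :=
  [/\ smooth phi, compact (closure [set x | phi x != 0]) &
      closure [set x | phi x != 0] `<=` Omega].

Definition is_weak_partial {R : realType} (Omega : set (R3 R)) (i : 'I_3)
    (u v : R3 R -> R) : Prop :=
  [/\ locally_integrable_on Omega u, locally_integrable_on Omega v &
      forall phi, test_function Omega phi ->
        (\int[leb3 R]_(x in Omega) (u x * 'D_(basis3 i) phi x)%:E =
         - \int[leb3 R]_(x in Omega) (v x * phi x)%:E)%E].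

Definition sobolev {R : realType} (Omega : set (R3 R)) (p : \bar R) :
    set (R3 R -> R) :=
  [set u | Lp_on Omega p u /\
    forall i, exists v, is_weak_partial Omega i u v /\ Lp_on Omega p v].

(* The weak partial derivative, as a total function of u: it is unique up to
   null subsets of Omega, and we choose a representative. *)
Definition weak_partial {R : realType} (Omega : set (R3 R)) (i : 'I_3)
    (u : R3 R -> R) : R3 R -> R :=
  xget (cst 0) [set v | is_weak_partial Omega i u v].

Definition weak_grad {R : realType} (Omega : set (R3 R)) (u : R3 R -> R)
    (x : R3 R) : R3 R :=
  (weak_partial Omega (inord 0) u x, weak_partial Omega (inord 1) u x,
   weak_partial Omega (inord 2) u x).

Definition sobolev_norm {R : realType} (Omega : set (R3 R)) (p : R)
    (u : R3 R -> R) : \bar R :=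
  ((\int[leb3 R]_(x in Omega)
      (`|u x| `^ p + enorm (weak_grad Omega u x) `^ p)%:E) `^ p^-1)%E.

Definition sobolev_dense {R : realType} (Omega : set (R3 R)) (q : \bar R)
    (p : R) : Prop :=
  forall u, sobolev Omega p%:E u -> forall eps : R, 0 < eps ->
    exists2 w, sobolev Omega q w &
      (sobolev_norm Omega p (u \- w)%R < eps%:E)%E.

(* Main.v *)
Require Import Defs.
From HB Require Import structures.
From mathcomp Require Import all_boot all_order all_algebra.
From mathcomp Require Import all_classical all_reals all_analysis.
From mathcomp Require Import measurable_realfun ess_sup_inf ring lra.
Import Order.TTheory GRing.Theory Num.Theory.
Import numFieldNormedType.Exports.
Local Open Scope classical_set_scope.
Local Open Scope ring_scope.
Set Implicit Arguments.
Unset Strict Implicit.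
Unset Printing Implicit Defensive.

(** Let Q be a rectangle in the plane and let D be any open subset of Q. The upper
    half of a box over Q, together with the vertical cylinder below D, is the
    region above the graph of a function on Q. Stretching the vertical fibres, by
    an amount governed by the distance to the complement of D, maps it onto a box
    and then onto a ball, in a locally bi-Lipschitz way (cellar_homeomorphism,
    cellar_locally_bilipschitz). So D may be as complicated as needed: it is a
    maze, made of two rooms separated by a wall that is pierced by channels. The
    channels sit in the gaps of a fat Cantor set; those of generation k have
    length of order 2^-k and total width of order 2^(-k(p-1)) / k^2.

    The function u takes the values 0 in the lower room and 1 in the upper one,
    with the transition made inside the channels, and is cut off before the floor
    of the upper half box is reached. The widths are summable against the energy
    2^(k(p-1)) of such a transition, hence u is in W^{1,p} (u_sobolev).

    For r > p the channels are too narrow to be noticed by W^{1,r}. To see this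
    consider, for each k, a unit flux that runs from the lower to the upper room
    through the channels of generation k (flux_divergence). In the rooms it can be
    spread, at distance 2^-k from the wall, so as to be bounded uniformly in k
    (phi1_bound, phi2_bound, rho_bound): every zone of generation k, of size
    comparable to 2^-k because the Cantor set is fat, contains one channel, which
    collects the flux 2^-k of that zone. In the channels, phi3 is of the order of
    the inverse of their width. Testing u against the flux detects its jump
    (pair_u_phi3). If w is close to u in W^{1,p}, the parts of the flux in the rooms
    and its sources see almost no difference between u and w; hence the integral
    of phi3 against the derivative of w is bounded below, uniformly in k. If
    moreover w is in W^{1,q} with q > p, its derivative lies in some L^r with
    p < r < oo, and Hoelder's inequality, here in the form of young_pointwise,
    makes that integral small for large k because 2^(-k(r-p)) k^2 tends to 0: a
    contradiction (not_dense). *)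

(** * Smooth functions of one variable *)

Section smooth1.
Context {R : realType}.
Implicit Types f g : R -> R.

(** Differentiability is demanded before the derivative is used, since the total
    derivative says nothing about a function that is not differentiable. *)
Fixpoint Cn (n : nat) (f : R -> R) : Prop :=
  if n is m.+1 then (forall x : R, derivable f x 1) /\ Cn m (derive1 f)
  else continuous f.

Definition smooth1 (f : R -> R) := forall n, Cn n f.

Lemma derivable1_continuous f : (forall x : R, derivable f x 1) -> continuous f.
Proof. by move=> df x; apply/differentiable_continuous/derivable1_diffP. Qed.

Lemma Cn_continuous n f : Cn n f -> continuous f.
Proof. by case: n => // n [df _]; exact: derivable1_continuous. Qed.

Lemma CnW n f : Cn n.+1 f -> Cn n f.
Proof.
elim: n f => [|n IH] f; first exact: Cn_continuous.
by case=> df cf; split=> //; exact: IH.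
Qed.

Lemma Cn_is_derive n f g :
  (forall x : R, is_derive x 1 f (g x)) -> Cn n g -> Cn n.+1 f.
Proof.
move=> fg cg; split; first by move=> x; have [] := fg x.
rewrite (_ : (derive1 f) = g)//; apply/funext => x.
by rewrite derive1E; have [] := fg x.
Qed.

Lemma is_derive1P f (x : R) : derivable f x 1 -> is_derive x 1 f ((derive1 f) x).
Proof. by move=> df; rewrite derive1E; exact: derivableP. Qed.

Lemma Cn_cst n (c : R) : Cn n (fun=> c).
Proof.
elim: n c => [|n IH] c; first exact: cst_continuous.
by apply: (Cn_is_derive (g := fun=> 0)) (IH 0) => x; exact: is_derive_cst.
Qed.

Lemma CnD n f g : Cn n f -> Cn n g -> Cn n (fun x => f x + g x).
Proof.
elim: n f g => [|n IH] f g /=.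
  by move=> cf cg x; apply: continuousD; [exact: cf|exact: cg].
move=> [df cf] [dg cg].
apply: (Cn_is_derive (g := fun x => (derive1 f) x + (derive1 g) x)) (IH _ _ cf cg) => x.
by apply: is_deriveD; exact: is_derive1P.
Qed.

Lemma CnM n f g : Cn n f -> Cn n g -> Cn n (fun x => f x * g x).
Proof.
elim: n f g => [|n IH] f g.
  by move=> cf cg x; apply: continuousM; [exact: cf|exact: cg].
move=> cf cg.
apply: (Cn_is_derive (g := fun x => f x * (derive1 g) x + g x * (derive1 f) x)).
  by move=> x; apply: is_deriveM; apply: is_derive1P; [case: cf|case: cg].
case: (cf) => _ cf'; case: (cg) => _ cg'.
by apply: CnD; apply: IH => //; exact: CnW.
Qed.

Lemma CnZ n (c : R) f : Cn n f -> Cn n (fun x => c * f x).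
Proof. by move=> cf; apply: CnM => //; exact: Cn_cst. Qed.

Lemma is_derive_affine f (a b x df : R) : is_derive (a * x + b) 1 f df ->
  is_derive x 1 (fun t => f (a * t + b)) (df * a).
Proof.
move=> fd.
have h : is_derive x 1 (fun t : R => a * t + b) a.
  have h1 : is_derive x 1 (fun t : R => a * t) a.
    by rewrite -[X in is_derive _ _ _ X]mulr1; apply: (is_deriveZ (f := id)).
  rewrite -[X in is_derive _ _ _ X]addr0.
  exact: (is_deriveD h1 (is_derive_cst b x 1)).
exact: (is_derive1_comp (f := f) (g := fun t : R => a * t + b)).
Qed.

Lemma Cn_affine n f (a b : R) : Cn n f -> Cn n (fun x => f (a * x + b)).
Proof.
elim: n f => [|n IH] f.
  move=> cf x; apply: (continuous_comp (f := fun t : R => a * t + b)).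
    by apply: continuousD; [apply: continuousM; [exact: cst_continuous|exact: id]|exact: cst_continuous].
  exact: cf.
move=> [df cf].
apply: (Cn_is_derive (g := fun x => a * (derive1 f) (a * x + b))).
  by move=> x; rewrite mulrC; apply/is_derive_affine/is_derive1P.
by apply: CnZ; exact: IH.
Qed.

Lemma CnV n f : (forall x, f x != 0) -> Cn n f -> Cn n (fun x => (f x)^-1).
Proof.
move=> f0; elim: n => [|n IH].
  by move=> cf x; apply: continuousV; [exact: f0|exact: cf].
move=> cf.
apply: (Cn_is_derive (g := fun x => (-1 * ((f x)^-1 * (f x)^-1)) * (derive1 f) x)).
  move=> x; have := is_deriveV (f0 x) (is_derive1P (cf.1 x)).
  by rewrite -exprVn expr2 mulN1r.
by apply: CnM; [apply: CnZ; apply: CnM; apply: IH; exact: CnW|case: cf].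
Qed.

Lemma smooth1_derive f : smooth1 f -> smooth1 (derive1 f).
Proof. by move=> sf n; case: (sf n.+1). Qed.

Lemma smooth1_derivable f : smooth1 f -> forall x : R, derivable f x 1.
Proof. by move=> sf; case: (sf 1%N). Qed.

Lemma smooth1_continuous f : smooth1 f -> continuous f.
Proof. by move=> sf; exact: (sf 0%N). Qed.

Lemma smooth1_is_derive f : smooth1 f -> forall x : R, is_derive x 1 f ((derive1 f) x).
Proof. by move=> sf x; apply/is_derive1P/smooth1_derivable. Qed.

(** The functions t^-m exp(-1/t), extended by 0 to t <= 0: up to linear
    combinations this family is stable under differentiation, which is why all
    of them are smooth. *)
Definition flat (m : nat) (t : R) : R :=
  if 0 < t then (t^-1) ^+ m * expR (- t^-1) else 0.

(** From exp (t / k) >= t / k, raised to the power k. *)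
Lemma pow_expRN_bounded (k : nat) : exists C : R, forall t : R, 0 <= t ->
  t ^+ k * expR (- t) <= C.
Proof.
case: k => [|k].
  exists 1 => t t0; rewrite expr0 mul1r -expR0 ler_expR; lra.
exists (k.+1%:R ^+ k.+1) => t t0.
rewrite expRN ler_pdivrMr ?expR_gt0//.
have -> : expR t = (expR (t / k.+1%:R)) ^+ k.+1.
  by rewrite -expRM_natl mulrC -mulrA mulVf ?mulr1.
rewrite -exprMn; apply: lerXn2r; rewrite ?nnegrE//.
rewrite mulrC -ler_pdivrMr//.
by apply: le_trans (expR_ge1Dx _); rewrite lerDr.
Qed.

(** Gives continuity at 0, and differentiability there too, as the difference
    quotient of flat m at 0 is flat m.+1. *)
Lemma flat_linear_bound m : exists C : R, forall t : R, `|flat m t| <= C * `|t|.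
Proof.
have [C hC] := pow_expRN_bounded m.+1.
have C0 : 0 <= C by apply: le_trans (hC 0 _); rewrite // mulr_ge0 ?exprn_ge0 ?expR_ge0.
exists C => t; rewrite /flat; case: ifPn => t0; last by rewrite normr0 mulr_ge0.
have it0 : 0 <= t^-1 by rewrite invr_ge0 ltW.
rewrite ger0_norm ?mulr_ge0 ?exprn_ge0 ?expR_ge0// gtr0_norm//.
rewrite -ler_pdivrMr//; have := hC _ it0.
by rewrite exprS [_ / t]mulrC mulrA.
Qed.

Lemma flat_is_derive m (t : R) :
  is_derive t 1 (flat m) (flat m.+2 t - m%:R * flat m.+1 t).
Proof.
have [t0|t0|->] := ltgtP t 0.
- rewrite /flat ltNge (ltW t0)/= mulr0 subr0.
  apply: (@near_eq_is_derive _ _ _ (fun=> 0)) (is_derive_cst 0 t 1).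
  near=> s; have s0 : s < 0 by near: s; exact: lt_nbhsl.
  by rewrite /flat ltNge (ltW s0).
- have h1 : is_derive t 1 (fun s : R => s^-1) (- (t^-1 * t^-1)).
    have := is_deriveV (lt0r_neq0 t0) (is_derive_id t 1).
    by rewrite -exprVn expr2 /GRing.scale /= mulr1.
  have h2 : is_derive t 1 (fun s => expR (- s^-1)) (expR (- t^-1) * (t^-1 * t^-1)).
    have h := is_deriveN h1; rewrite opprK in h.
    exact: (is_derive1_comp (f := expR) (g := fun s => - s^-1)).
  have h3 : is_derive t 1 (fun s : R => (s^-1) ^+ m)
      (m%:R * (t^-1) ^+ m.-1 * (- (t^-1 * t^-1))).
    have h := is_deriveX m h1; apply: is_derive_eq; last by [].
    by apply: near_eq_is_derive h; near=> s; rewrite exprfctE.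
  have h := is_deriveM h3 h2.
  rewrite /flat t0.
  apply: (@near_eq_is_derive _ _ _ (fun s : R => s^-1 ^+ m * expR (- s^-1))).
    near=> s; have s0 : 0 < s by near: s; exact: lt_nbhsr.
    by rewrite /flat s0.
  apply: is_derive_eq h _; rewrite /GRing.scale/=.
  by case: m {h3} => [|m]; rewrite /= ?expr0 !exprS; ring.
- rewrite {2 3}/flat ltxx mulr0 subr0.
  have [C hC] := flat_linear_bound m.+1.
  have C0 : 0 <= C by have := hC 1; rewrite normr1 mulr1; apply: le_trans.
  have key : (h^-1 *: (flat m (h *: 1 + 0) - flat m 0)) @[h --> 0^'] --> (0 : R).
    rewrite {2}/flat ltxx; apply/cvgr0Pnorm_le => e e0.
    near=> h; rewrite subr0 addr0 /GRing.scale/= mulr1.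
    have h0 : h != 0 by near: h; exact: nbhs_dnbhs_neq.
    have -> : h^-1 * flat m h = flat m.+1 h.
      by rewrite /flat; case: ifP => _; rewrite ?mulr0// exprS mulrA.
    apply: le_trans (hC h) _.
    have he : `|h| < e / (C + 1).
      near: h; apply: dnbhs0_lt; rewrite divr_gt0//; lra.
    have C1 : 0 < C + 1 by lra.
    move: he; rewrite ltr_pdivlMr// => /ltW; apply: le_trans.
    by rewrite mulrC ler_wpM2l//; lra.
  split; first by apply/cvg_ex; exists 0.
  exact/cvg_lim.
Unshelve. all: by end_near. Qed.

Lemma flat_smooth m : smooth1 (flat m).
Proof.
move=> n; elim: n m => [|n IH] m.
  by apply: derivable1_continuous => x; have [] := flat_is_derive m x.
apply: (Cn_is_derive (flat_is_derive m)).
have -> : (fun t => flat m.+2 t - m%:R * flat m.+1 t)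
        = (fun t => flat m.+2 t + (- m%:R) * flat m.+1 t).
  by apply/funext => t; rewrite mulNr.
by apply: CnD => //; exact: CnZ.
Qed.

Lemma flat_ge0 m t : 0 <= flat m t.
Proof.
rewrite /flat; case: ifP => // t0.
by rewrite mulr_ge0 ?expR_ge0// exprn_ge0// invr_ge0 ltW.
Qed.

Lemma flat0_gt0 t : (0 < flat 0 t) = (0 < t).
Proof. by rewrite /flat; case: ifP => h; rewrite ?ltxx// expr0 mul1r expR_gt0. Qed.

Lemma flat_le0 m t : t <= 0 -> flat m t = 0.
Proof. by rewrite /flat ltNge => ->. Qed.

(** A smooth step: 0 up to 1/4 and 1 from 3/4 on, so that it is locally constant
    in neighbourhoods of 0 and 1. *)
Definition stp (t : R) : R :=
  flat 0 (t - 4^-1) * (flat 0 (t - 4^-1) + flat 0 (3 / 4 - t))^-1.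

Let stp_den_gt0 t : 0 < flat 0 (t - 4^-1) + flat 0 (3 / 4 - t).
Proof.
have [h|h] := ltP (4^-1) t.
  by apply: ltr_pwDl; rewrite ?flat_ge0// flat0_gt0 subr_gt0.
by apply: ltr_pwDr; rewrite ?flat_ge0// flat0_gt0; lra.
Qed.

Lemma stp_smooth : smooth1 stp.
Proof.
move=> n.
have h1 : Cn n (fun t => flat 0 (t - 4^-1)).
  have := Cn_affine 1 (- 4^-1) (flat_smooth 0 n).
  by rewrite (_ : (fun x => _) = fun t => flat 0 (t - 4^-1))//; apply/funext => t; rewrite mul1r.
have h2 : Cn n (fun t => flat 0 (3 / 4 - t)).
  have := Cn_affine (-1) (3 / 4) (flat_smooth 0 n).
  by rewrite (_ : (fun x => _) = fun t => flat 0 (3 / 4 - t))//; apply/funext => t; rewrite mulN1r addrC.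
apply: CnM => //; apply: CnV; first by move=> t; rewrite gt_eqF.
exact: CnD.
Qed.

Lemma stp0 t : t <= 4^-1 -> stp t = 0.
Proof. by move=> h; rewrite /stp flat_le0 ?mul0r// subr_le0. Qed.

Lemma stp1 t : 3 / 4 <= t -> stp t = 1.
Proof.
move=> h; have := stp_den_gt0 t; rewrite /stp.
by rewrite [flat 0 (3 / 4 - t)]flat_le0 ?subr_le0// addr0 => /lt0r_neq0 h0; rewrite divff.
Qed.

Lemma stp_ge0 t : 0 <= stp t.
Proof. by rewrite /stp mulr_ge0 ?flat_ge0// invr_ge0 ltW. Qed.

Lemma stp_le1 t : stp t <= 1.
Proof. by rewrite /stp ler_pdivrMr// mul1r lerDl flat_ge0. Qed.

Lemma derive1_near_cst f (c x : R) : (\forall y \near x, f y = c) -> (derive1 f) x = 0.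
Proof.
by move=> h; rewrite derive1E (near_eq_derive (g := cst c))// derive_cst.
Qed.

Lemma derive1_stp0 t : t < 4^-1 -> (derive1 stp) t = 0.
Proof.
move=> h; apply: (@derive1_near_cst _ 0); near=> y; rewrite stp0// ltW//.
by near: y; exact: lt_nbhsl.
Unshelve. all: by end_near. Qed.

Lemma derive1_stp1 t : 3 / 4 < t -> (derive1 stp) t = 0.
Proof.
move=> h; apply: (@derive1_near_cst _ 1); near=> y; rewrite stp1// ltW//.
by near: y; exact: lt_nbhsr.
Unshelve. all: by end_near. Qed.

(** This constant controls all the fields built from stp below. *)
Lemma derive1_stp_bounded : exists2 K : R, 1 <= K & forall t, `|(derive1 stp) t| <= K.
Proof.
have cS : continuous (derive1 stp) by apply/smooth1_continuous/smooth1_derive/stp_smooth.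
have cN : {within `[0, 1], continuous (fun t => `|(derive1 stp) t|)}.
  apply: continuous_subspaceT => t.
  by apply: continuous_comp; [exact: cS|exact: norm_continuous].
have [c _ hc] := EVT_max ler01 cN.
exists (`|(derive1 stp) c| + 1); first by rewrite lerDr.
move=> t; have [t0|t0] := ltP t 0.
  by rewrite derive1_stp0 ?normr0 ?addr_ge0//; lra.
have [t1|t1] := ltP 1 t; first by rewrite derive1_stp1 ?normr0 ?addr_ge0//; lra.
by apply: le_trans (hc t _) _; rewrite ?in_itv/= ?t0// lerDl.
Qed.

End smooth1.

(** * Measurability in space, and integration on a line *)

Notation leb R := (@lebesgue_measure R).

(** Space with the product sigma-algebra on which Lebesgue measure lives, as opposed
    to the one inferred by default for R3 R. *)
Notation T3 R := (measurableTypeR R * measurableTypeR R * measurableTypeR R)%type.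

Section measure3.
Context {R : realType}.
Implicit Types (x y : R3 R).

Definition box3 (c : R3 R) (r : R) : set (R3 R) :=
  [set x | [/\ `|c.1.1 - x.1.1| < r, `|c.1.2 - x.1.2| < r & `|c.2 - x.2| < r]].

Lemma nbhs_box3 (A : set (R3 R)) x : open A -> A x ->
  exists2 e : R, 0 < e & box3 x e `<=` A.
Proof.
move=> oA Ax.
have /nbhs_ballP[e /= e0 eA] : nbhs x A by exact: open_nbhs_nbhs.
by exists e => // y [h1 h2 h3]; apply: eA.
Qed.

Lemma rat_near (a r : R) : 0 < r -> exists q : rat, `|ratr q - a| < r.
Proof.
move=> r0; have /rat_in_itvoo[q] : a - r < a + r by lra.
rewrite in_itv/= => /andP[h1 h2]; exists q.
by rewrite ltr_norml; apply/andP; split; lra.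
Qed.

Lemma measurable_box3 (c : R3 R) r : measurable (box3 c r : set (T3 R)).
Proof.
have ballm (a : R) : measurable ([set t | `|a - t| < r] : set (measurableTypeR R)).
  have := @ball_open _ R a r; rewrite -ball_normE; exact: open_measurable.
have := measurableX (measurableX (ballm c.1.1) (ballm c.1.2)) (ballm c.2).
congr (measurable _).
by apply/seteqP; split => [x [[? ?] ?]|x [? ? ?]].
Qed.

(** The sigma-algebra is the product one: an open set is a countable union of
    boxes with rational centres and sizes 1/n. *)
Lemma open_measurable3 (A : set (R3 R)) : open A -> measurable (A : set (T3 R)).
Proof.
move=> oA.
pose c (q : rat * rat * rat) : R3 R := (ratr q.1.1, ratr q.1.2, ratr q.2).
pose B (qn : rat * rat * rat * nat) : set (R3 R) :=
  if `[< box3 (c qn.1) qn.2.+1%:R^-1 `<=` A >] then box3 (c qn.1) qn.2.+1%:R^-1 else set0.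
have -> : A = \bigcup_(qn in setT) B qn.
  apply/seteqP; split => [x Ax|x [qn _]]; last first.
    by rewrite /B; case: asboolP => // h; exact: h.
  have [e e0 eA] := nbhs_box3 oA Ax.
  have [n hn] : exists n : nat, n.+1%:R^-1 < e / 2.
    have : 0 < e / 2 by rewrite divr_gt0.
    by move=> /ltr_add_invr [n]; rewrite add0r => h; exists n; apply: le_lt_trans h; rewrite lexx.
  have n0 : 0 < n.+1%:R^-1 :> R by rewrite invr_gt0.
  have [q1 h1] := rat_near x.1.1 n0.
  have [q2 h2] := rat_near x.1.2 n0.
  have [q3 h3] := rat_near x.2 n0.
  exists ((q1, q2, q3), n) => //=; rewrite /B /=.
  case: asboolP => [_|[]]; first by split.
  move=> y; rewrite /c /=; move: (n.+1%:R^-1) hn h1 h2 h3 => r hn h1 h2 h3.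
  move=> [/= g1 g2 g3]; apply: eA.
  have tri (q s t : R) : `|q - s| < r -> `|q - t| < r -> `|s - t| < e.
    move=> a b; apply: le_lt_trans (ler_distD q s t) _.
    by rewrite distrC; lra.
  by split; [exact: tri h1 g1|exact: tri h2 g2|exact: tri h3 g3].
apply: countable_bigcupT_measurable => [|qn]; first exact: countableP.
rewrite /B; case: asboolP => // _.
exact: measurable_box3.
Qed.

Lemma closed_measurable3 (A : set (R3 R)) : closed A -> measurable (A : set (T3 R)).
Proof. by move/closed_openC/open_measurable3/measurableC; rewrite setCK. Qed.

Lemma compact_closed3 (A : set (R3 R)) : compact A -> closed A.
Proof. by apply: compact_closed; exact: norm_hausdorff. Qed.

Lemma compact_measurable3 (A : set (R3 R)) : compact A -> measurable (A : set (T3 R)).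
Proof. by move/compact_closed3/closed_measurable3. Qed.

(** Continuity at the points of an open set only: this is how functions on a
    domain, extended arbitrarily outside it, become measurable on it. *)
Lemma open_continuous_measurable_fun3 (A : set (R3 R)) (f : R3 R -> R) :
  open A -> (forall x, A x -> {for x, continuous f}) ->
  measurable_fun (A : set (T3 R)) (f : T3 R -> R).
Proof.
move=> oA cf; apply: (measurability _ (RGenOpens.measurableE R)).
move=> _ [_ [a [b ->] <-]]; apply: open_measurable3.
rewrite openE => x [Ax fx]; apply: filterI; first exact: open_nbhs_nbhs.
by apply: cf => //; apply: open_nbhs_nbhs; split => //; exact: interval_open.
Qed.

Lemma continuous_measurable_fun3 (f : R3 R -> R) :
  continuous f -> measurable_fun setT (f : T3 R -> R).
Proof.
by move=> cf; apply: open_continuous_measurable_fun3; [exact: openT|move=> x _; exact: cf].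
Qed.

End measure3.

Section integration.
Context {R : realType}.

Lemma integrable_bounded_supp d (T : measurableType d)
    (mu : {measure set T -> \bar R}) (A : set T) (f : T -> R) (C : R) :
  measurable A -> (mu A < +oo)%E -> measurable_fun setT f ->
  (forall x, `|f x| <= C) -> (forall x, ~ A x -> f x = 0) ->
  mu.-integrable setT (EFin \o f).
Proof.
move=> mA muA mf fC fA; apply/integrableP; split; first exact/measurable_EFinP.
apply: (@le_lt_trans _ _ (\int[mu]_(x in A) C%:E)%E); last first.
  rewrite integral_cst//; have C0 := le_trans (normr_ge0 _) (fC point).
  by rewrite lte_mul_pinfty.
rewrite [leRHS]integral_mkcond; apply: ge0_le_integral => //.
- by apply: measurableT_comp => //; exact/measurable_EFinP.
- by apply/(measurable_restrictT _ mA).1; exact: measurable_cst.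
- move=> x _ /=; rewrite patchE; case: ifPn => [_|]; first by rewrite lee_fin.
  by rewrite notin_setE => /fA ->; rewrite normr0.
Qed.

(** The derivative vanishes outside [-M, M], so the integral over the line is an
    integral over that segment. *)
Lemma ftc_line (g G : R -> R) (M : R) : 0 < M ->
  (forall x : R, is_derive x 1 G (g x)) -> continuous g ->
  (forall x, M < `|x| -> g x = 0) ->
  (\int[leb R]_x (g x)%:E = (G M - G (- M))%:E)%E.
Proof.
move=> M0 dG cg gM.
have -> : (\int[leb R]_x (g x)%:E = \int[leb R]_(x in `[(- M)%R, M]) (g x)%:E)%E.
  rewrite [RHS]integral_mkcond; apply: eq_integral => x _; rewrite patchE.
  case: ifPn => //; rewrite notin_setE/= in_itv/= => /negP h.
  rewrite gM// ltNge; apply: contra h.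
  by rewrite ler_norml.
rewrite (@continuous_FTC2 _ g G)//; first by lra.
- exact: continuous_subspaceT.
- split; first by move=> x _; have [] := dG x.
  + by apply: cvg_at_right_filter; apply: derivable1_continuous => x; have [] := dG x.
  + by apply: cvg_at_left_filter; apply: derivable1_continuous => x; have [] := dG x.
- by move=> x _; rewrite derive1E; have [] := dG x.
Qed.

End integration.

(** * Fubini's theorem and integrals of partial derivatives *)

Section lines.
Context {R : realType}.
Implicit Types (x : R3 R) (i : 'I_3).

(** The point x with its i-th coordinate set to t: directional derivatives along
    the basis vectors become ordinary derivatives in t. *)
Definition upd (i : 'I_3) (x : R3 R) (t : R) : R3 R :=
  (if i == 0 :> nat then t else x.1.1, if i == 1%N :> nat then t else x.1.2,
   if i == 2%N :> nat then t else x.2).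

Lemma coord3E i x : coord3 i x =
  if i == 0 :> nat then x.1.1 else if i == 1%N :> nat then x.1.2 else x.2.
Proof. by case: i => [[|[|[|//]]] h]. Qed.

Lemma upd_coord3 i x : upd i x (coord3 i x) = x.
Proof. by case: x => [[a b] c]; case: i => [[|[|[|//]]] h]. Qed.

Lemma updD i x (h : R) : h *: basis3 i + x = upd i x (h + coord3 i x).
Proof.
case: x => [[a b] c]; rewrite /upd /basis3 /coord3.
by case: i => [[|[|[|//]]] ?]; congr (_, _, _);
  rewrite /= /GRing.scale/= ?mulr1 ?mulr0 ?add0r.
Qed.

Lemma is_derive_line i x (G : R3 R -> R) (d : R) :
  is_derive x (basis3 i) G d <->
  is_derive (coord3 i x) 1 (fun t => G (upd i x t)) d.
Proof.
have E : (fun h : R => h^-1 *: ((G \o shift x) (h *: basis3 i) - G x)) =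
    (fun h : R => h^-1 *: (((fun t => G (upd i x t)) \o shift (coord3 i x)) (h *: 1)
      - G (upd i x (coord3 i x)))).
  apply/funext => h; rewrite /= updD upd_coord3.
  by rewrite {3}/GRing.scale/= mulr1.
by split=> -[h1 h2]; split; move: h1 h2; rewrite /derivable /derive ?E// -?E.
Qed.

Lemma upd_upd i x (s t : R) : upd i (upd i x s) t = upd i x t.
Proof. by case: i => [[|[|[|//]]] h]. Qed.

Lemma coord3_upd i x (t : R) : coord3 i (upd i x t) = t.
Proof. by case: i => [[|[|[|//]]] h]. Qed.

Lemma is_derive_upd i x (G F : R3 R -> R) (t : R) :
  (forall x, is_derive x (basis3 i) G (F x)) ->
  is_derive t 1 (fun s => G (upd i x s)) (F (upd i x t)).
Proof.
move=> /(_ (upd i x t)) /is_derive_line; rewrite coord3_upd.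
by under eq_fun do rewrite upd_upd.
Qed.

Lemma norm_coord3 x : [/\ `|x.1.1| <= `|x|, `|x.1.2| <= `|x| & `|x.2| <= `|x|].
Proof.
rewrite [`|x|]prod_normE; have : `|x.1| <= Num.max `|x.1| `|x.2| by rewrite le_max lexx.
rewrite [X in X <= _]prod_normE => h; split.
- by apply: le_trans h; rewrite le_max lexx.
- by apply: le_trans h; rewrite le_max lexx orbT.
- by rewrite le_max lexx orbT.
Qed.

Lemma norm_coord3_lt x (r : R) : `|x.1.1| < r -> `|x.1.2| < r -> `|x.2| < r -> `|x| < r.
Proof. by move=> h1 h2 h3; rewrite prod_normE gt_max h3 andbT prod_normE gt_max h1. Qed.

Lemma continuous_upd i x : continuous (upd i x).
Proof.
have -> : upd i x = fun t => (t - coord3 i x) *: basis3 i + x.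
  by apply/funext => t; rewrite updD subrK.
move=> t; apply: cvgD; last exact: cvg_cst.
by apply: cvgZr_tmp; apply: cvgB; [exact: cvg_id|exact: cvg_cst].
Qed.

End lines.

Section fubini3.
Context {R : realType}.
Implicit Types (F : R3 R -> R) (M : R).

Notation mu3 := (leb3 R).
Notation mu2 := (leb R \x leb R)%E.

Lemma measure_sym_itv M : 0 < M -> leb R `[- M, M] = (2 * M)%:E.
Proof.
move=> M0; have MM : - M < M by lra.
by rewrite lebesgue_measure_itv/= lte_fin MM -EFinB; congr EFin; ring.
Qed.

Definition square2 (M : R) : set (R * R) := `[- M, M] `*` `[- M, M].

Definition cube3 (M : R) : set (R3 R) := square2 M `*` `[- M, M].

Lemma measurable_square2 M :
  measurable (square2 M : set (measurableTypeR R * measurableTypeR R)%type).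
Proof. exact: measurableX. Qed.

Lemma measurable_cube3 M : measurable (cube3 M : set (T3 R)).
Proof. by apply: measurableX => //; exact: measurable_square2. Qed.

Lemma measure_cube2 M : 0 < M -> mu2 (square2 M) = ((2 * M) ^+ 2)%:E.
Proof.
move=> M0; transitivity (leb R `[(- M)%R, M] * leb R `[(- M)%R, M])%E.
  exact: product_measure1E.
by rewrite !measure_sym_itv// -EFinM.
Qed.

Lemma measure_cube3 M : 0 < M -> mu3 (cube3 M) = ((2 * M) ^+ 3)%:E.
Proof.
move=> M0; transitivity (mu2 (square2 M) * leb R `[(- M)%R, M])%E.
  by apply: product_measure1E => //; exact: measurable_square2.
by rewrite measure_cube2// measure_sym_itv// -EFinM -exprSr.
Qed.

Lemma notin_cube3 M x : ~ cube3 M x -> M < `|x|.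
Proof.
move=> h; rewrite ltNge; apply/negP => xM; apply: h.
have [h1 h2 h3] := norm_coord3 x.
by split=> /=; [split=> /=|]; rewrite in_itv/= -ler_norml; apply: le_trans xM.
Qed.

Lemma compact_cube3 M : compact (cube3 M).
Proof.
apply: compact_setX; last exact: segment_compact.
by apply: compact_setX; exact: segment_compact.
Qed.

Lemma continuous_supp_bounded F M : continuous F ->
  (forall x, M < `|x| -> F x = 0) -> exists C, forall x, `|F x| <= C.
Proof.
move=> cF FM.
have /compact_bounded [N [_ hN]] : compact (F @` cube3 M).
  by apply: continuous_compact; [exact: continuous_subspaceT|exact: compact_cube3].
exists (`|N| + 1) => x; have [xM|/notin_cube3 xM] := pselect (cube3 M x).
  by apply: (hN (`|N| + 1)); [rewrite (le_lt_trans (ler_norm _))// ltrDl|exists x].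
by rewrite FM// normr0 addr_ge0.
Qed.

Lemma integrable3 F M : 0 < M -> continuous F ->
  (forall x, M < `|x| -> F x = 0) -> mu3.-integrable setT (EFin \o F).
Proof.
move=> M0 cF FM; have [C FC] := continuous_supp_bounded cF FM.
apply: (@integrable_bounded_supp _ _ _ mu3 (cube3 M) F C) => //.
- exact: measurable_cube3.
- by rewrite [X in (X < _)%E]measure_cube3// ltry.
- exact: continuous_measurable_fun3.
- by move=> x /notin_cube3 /FM.
Qed.

Lemma slice_integrable F M (c : R) : 0 < M -> continuous F ->
  (forall x, M < `|x| -> F x = 0) ->
  mu2.-integrable setT (fun ab => (F (ab, c))%:E).
Proof.
move=> M0 cF FM; have [C FC] := continuous_supp_bounded cF FM.
rewrite -[X in integrable _ _ X]/(EFin \o (fun ab => F (ab, c))).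
apply: (@integrable_bounded_supp _ _ _ mu2 (square2 M) (fun ab => F (ab, c)) C) => //.
- exact: measurable_square2.
- by rewrite [X in (X < _)%E]measure_cube2// ltry.
- apply: (measurableT_comp (f := F)); first exact: continuous_measurable_fun3.
  exact: pair2_measurable.
- move=> ab h; apply: FM; apply: notin_cube3.
  by move=> [/= h1 _]; apply: h.
Qed.

(** Plane Lebesgue measure under a name of its own, to which sigma-finiteness can
    be attached for Fubini's theorem. *)
Definition leb2 : set (measurableTypeR R * measurableTypeR R) -> \bar R := mu2.

HB.instance Definition _ := Measure.on leb2.

Lemma leb2_sigma_finite : sigma_finite setT leb2.
Proof.
exists (fun n => square2 n.+1%:R).
  apply/esym/seteqP; split => // -[a b] _.
  pose n := Num.Def.truncn (Num.max `|a| `|b|).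
  have : Num.max `|a| `|b| < n.+1%:R by exact: truncnS_gt.
  rewrite gt_max => /andP[ha hb].
  by exists n => //; split; rewrite /= in_itv/= -ler_norml ltW.
move=> n; split; first exact: measurable_square2.
by rewrite [X in (X < _)%E]measure_cube2// ltry.
Qed.

HB.instance Definition _ := Measure_isSigmaFinite.Build _ _ _ leb2 leb2_sigma_finite.

Lemma integral3_z F M : 0 < M -> continuous F ->
  (forall x, M < `|x| -> F x = 0) ->
  (\int[mu3]_x (F x)%:E = \int[mu2]_ab \int[leb R]_c (F (ab, c))%:E)%E.
Proof.
move=> M0 cF FM.
exact: (esym (@integral12_prod_meas1 _ _ _ _ R leb2 (leb R) (EFin \o F) (integrable3 M0 cF FM))).
Qed.

Lemma integral3_y F M : 0 < M -> continuous F ->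
  (forall x, M < `|x| -> F x = 0) ->
  (\int[mu3]_x (F x)%:E =
   \int[leb R]_c \int[leb R]_a \int[leb R]_b (F ((a, b), c))%:E)%E.
Proof.
move=> M0 cF FM.
transitivity (\int[leb R]_c \int[mu2]_ab (F (ab, c))%:E)%E.
  exact: (esym (@integral21_prod_meas1 _ _ _ _ R leb2 (leb R) (EFin \o F) (integrable3 M0 cF FM))).
apply: eq_integral => c _.
exact: (esym (@integral12_prod_meas1 _ _ _ _ R (leb R) (leb R) (fun ab => (F (ab, c))%:E) (slice_integrable c M0 cF FM))).
Qed.

Lemma integral3_x F M : 0 < M -> continuous F ->
  (forall x, M < `|x| -> F x = 0) ->
  (\int[mu3]_x (F x)%:E =
   \int[leb R]_c \int[leb R]_b \int[leb R]_a (F ((a, b), c))%:E)%E.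
Proof.
move=> M0 cF FM.
transitivity (\int[leb R]_c \int[mu2]_ab (F (ab, c))%:E)%E.
  exact: (esym (@integral21_prod_meas1 _ _ _ _ R leb2 (leb R) (EFin \o F) (integrable3 M0 cF FM))).
apply: eq_integral => c _.
exact: (esym (@integral21_prod_meas1 _ _ _ _ R (leb R) (leb R) (fun ab => (F (ab, c))%:E) (slice_integrable c M0 cF FM))).
Qed.

(** The integral of a directional derivative of a compactly supported function
    vanishes: Fubini's theorem with the differentiated variable innermost. *)
Lemma integral_partial_eq0 (i : 'I_3) (F G : R3 R -> R) M : 0 < M -> continuous F ->
  (forall x, is_derive x (basis3 i) G (F x)) ->
  (forall x, M <= `|x| -> G x = 0) ->
  (forall x, M < `|x| -> F x = 0) ->
  (\int[mu3]_x (F x)%:E = 0)%E.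
Proof.
move=> M0 cF dG GM FM.
have line x : (\int[leb R]_t (F (upd i x t))%:E = 0)%E.
  have Mt t : `|t| <= `|upd i x t|.
    have [h1 h2 h3] := norm_coord3 (upd i x t).
    rewrite -{1}(coord3_upd i x t) coord3E; case: ifP => _ //.
    by case: ifP.
  transitivity (G (upd i x M) - G (upd i x (- M)))%:E; last first.
    by rewrite !GM ?subrr// (le_trans _ (Mt _))// ?normrN ger0_norm// ltW.
  apply: (@ftc_line _ _ (fun t => G (upd i x t)) M) => //.
  - by move=> t; exact: is_derive_upd.
  - by move=> t; apply: continuous_comp; [exact: continuous_upd|exact: cF].
  - by move=> t tM; apply: FM; exact: lt_le_trans tM (Mt t).
case: i dG line => [[|[|[|//]]] hi] dG line.
- rewrite (integral3_x M0)//; apply: integral0_eq => c _; apply: integral0_eq => b _.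
  by have := line ((0, b), c); rewrite /upd/=.
- rewrite (integral3_y M0)//; apply: integral0_eq => c _; apply: integral0_eq => a _.
  by have := line ((a, 0), c); rewrite /upd/=.
- rewrite (integral3_z M0)//; apply: integral0_eq => -[a b] _.
  by have := line ((a, b), 0); rewrite /upd/=.
Qed.

Definition tensor (f g h : R -> R) (x : R3 R) : R := f x.1.1 * g x.1.2 * h x.2.

Lemma continuous_tensor f g h : continuous f -> continuous g -> continuous h ->
  continuous (tensor f g h).
Proof.
move=> cf cg ch x; rewrite /continuous_at /tensor; apply: cvgM; first apply: cvgM.
- apply: (continuous_comp (f := fun x : R3 R => x.1.1)); last exact: cf.
  by apply: (continuous_comp (f := fst) (g := fst)); exact: cvg_fst.
- apply: (continuous_comp (f := fun x : R3 R => x.1.2)); last exact: cg.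
  by apply: (continuous_comp (f := fst) (g := snd)); [exact: cvg_fst|exact: cvg_snd].
- by apply: (continuous_comp (f := snd)); [exact: cvg_snd|exact: ch].
Qed.

Lemma tensor_supp f g h M : (forall t, M < `|t| -> f t = 0) ->
  (forall t, M < `|t| -> g t = 0) -> (forall t, M < `|t| -> h t = 0) ->
  forall x, M < `|x| -> tensor f g h x = 0.
Proof.
move=> fM gM hM x; rewrite prod_normE lt_max prod_normE lt_max /tensor.
by move=> /orP[/orP[/fM|/gM]|/hM] ->; rewrite !(mul0r, mulr0).
Qed.

(** Primitives are part of the data, so that each factor integrates to an explicit
    increment. *)
Lemma integral_tensor (f g h F G H : R -> R) M : 0 < M ->
  continuous f -> continuous g -> continuous h ->
  (forall t : R, is_derive t 1 F (f t)) -> (forall t : R, is_derive t 1 G (g t)) ->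
  (forall t : R, is_derive t 1 H (h t)) ->
  (forall t, M < `|t| -> f t = 0) ->
  (forall t, M < `|t| -> g t = 0) -> (forall t, M < `|t| -> h t = 0) ->
  (\int[mu3]_x (tensor f g h x)%:E =
    ((F M - F (- M)) * (G M - G (- M)) * (H M - H (- M)))%:E)%E.
Proof.
move=> M0 cf cg ch dF dG dH fM gM hM.
rewrite (integral3_x M0) //; last 2 first.
  exact: continuous_tensor.
  exact: tensor_supp.
have scal (k K : R -> R) (c : R) : continuous k -> (forall t : R, is_derive t 1 K (k t)) ->
    (forall t, M < `|t| -> k t = 0) ->
    (\int[leb R]_t (c * k t)%:E = (c * (K M - K (- M)))%:E)%E.
  move=> ck dK kM; transitivity (c * K M - c * K (- M))%:E; last by rewrite mulrBr.
  apply: (@ftc_line _ _ (fun t => c * K t) M) => //.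
  - by move=> t; apply: cvgM; [exact: cvg_cst|exact: ck].
  - by move=> t tM; rewrite kM// mulr0.
transitivity (\int[leb R]_c (((F M - F (- M)) * (G M - G (- M))) * h c)%:E)%E.
  apply: eq_integral => c _.
  transitivity (\int[leb R]_b (((F M - F (- M)) * h c) * g b)%:E)%E.
    apply: eq_integral => b _.
    transitivity (\int[leb R]_a ((g b * h c) * f a)%:E)%E.
      by apply: eq_integral => a _; congr EFin; rewrite /tensor/=; ring.
    by rewrite (scal _ F)//; congr EFin; ring.
  by rewrite (scal _ G)//; congr EFin; ring.
by rewrite (scal _ H)//.
Qed.

End fubini3.

(** * Weak partial derivatives and pairings *)

Section weak.
Context {R : realType}.
Implicit Types (Omega : set (R3 R)) (a phi : R3 R -> R).

Notation mu3 := (leb3 R).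

(** The integral of a nonnegative function is a supremum over the simple functions
    below it, hence monotone in the function and in the domain at once. *)
Lemma le_integral_ge0 d (T : measurableType d) (mu : {measure set T -> \bar R})
    (A B : set T) (f g : T -> \bar R) :
  A `<=` B -> (forall x, A x -> (0 <= f x)%E) -> (forall x, B x -> (0 <= g x)%E) ->
  (forall x, A x -> (f x <= g x)%E) ->
  (\int[mu]_(x in A) f x <= \int[mu]_(x in B) g x)%E.
Proof.
move=> AB f0 g0 fg; rewrite !ge0_integralE//.
apply: le_ereal_sup => _ /= [h hf <-]; exists h => // x.
apply: le_trans (hf x) _; rewrite !patchE; case: ifPn => xA.
  by move: xA; rewrite inE => xA; rewrite mem_set; [exact: fg|exact: AB].
by case: ifPn => //; rewrite inE; exact: g0.
Qed.

(** Compact support inside Omega, stated through a compact set that need not be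
    the support itself; unlike being a test function it asks for no smoothness,
    so it is shared by the derivatives and sums of test functions. *)
Definition supp_in Omega phi := exists K : set (R3 R),
  [/\ compact K, K `<=` Omega & forall x, ~ K x -> phi x = 0].

Lemma test_function_supp_in Omega phi : test_function Omega phi -> supp_in Omega phi.
Proof.
move=> [_ cK KO]; exists (closure [set x | phi x != 0]); split => // x.
by apply: contra_notP => /eqP h; apply: subset_closure.
Qed.

Lemma smooth_continuous phi : smooth phi -> continuous phi.
Proof. by move=> /(_ [::]) []. Qed.

Lemma smooth_derive_continuous phi i : smooth phi -> continuous ('D_(basis3 i) phi).
Proof. by move=> /(_ [:: i]) []. Qed.

Lemma smooth_is_derive phi i x : smooth phi ->
  is_derive x (basis3 i) phi ('D_(basis3 i) phi x).
Proof. by move=> /(_ [::]) [_ /(_ i x)] /derivableP. Qed.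

Lemma derive_supp phi (K : set (R3 R)) v : closed K ->
  (forall x, ~ K x -> phi x = 0) -> forall x, ~ K x -> 'D_v phi x = 0.
Proof.
move=> cK phi0 x Kx.
rewrite (@near_eq_derive _ _ _ _ (cst 0)) ?derive_cst//.
have : nbhs x (~` K) by apply: open_nbhs_nbhs; split => //; exact: closed_openC.
by apply: filterS => y; exact: phi0.
Qed.

Lemma test_function_derive_supp_in Omega phi i :
  test_function Omega phi -> supp_in Omega ('D_(basis3 i) phi).
Proof.
move=> [_ cK KO]; exists (closure [set x | phi x != 0]); split => //.
apply: derive_supp; first exact: closed_closure.
by move=> x; apply: contra_notP => /eqP h; apply: subset_closure.
Qed.

Lemma test_functionP Omega phi : smooth phi -> supp_in Omega phi ->
  test_function Omega phi.
Proof.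
move=> sphi [K [cK KO phi0]].
have sub : closure [set x | phi x != 0] `<=` K.
  rewrite [K in _ `<=` K](closure_id K).1; last exact: compact_closed3.
  by apply: closure_subset => x /= /eqP; apply: contra_notP; exact: phi0.
split => //; last exact: subset_trans sub KO.
by apply: subclosed_compact cK sub; exact: closed_closure.
Qed.

Lemma supp_bounded Omega phi : supp_in Omega phi ->
  exists2 M : R, 0 < M & forall x, M < `|x| -> phi x = 0.
Proof.
move=> [K [/compact_bounded [N [_ hN]] _ phi0]].
exists (`|N| + 1) => [|x xN]; first by rewrite ltr_wpDl.
apply: phi0 => Kx; move: xN; rewrite ltNge; apply/negP/negPn.
by apply: hN => //; rewrite (le_lt_trans (ler_norm _))// ltrDl.
Qed.

(** The extension by 0 is continuous across the boundary of Omega because phi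
    already vanishes near that boundary. *)
Lemma mul_restrict_continuous Omega a phi : open Omega ->
  (forall x, Omega x -> {for x, continuous a}) -> continuous phi ->
  supp_in Omega phi -> continuous ((fun x => a x * phi x) \_ Omega).
Proof.
move=> oO ca cphi [K [cK KO phi0]] x.
have [Ox|Ox] := pselect (Omega x).
  have E : \forall y \near x, a y * phi y = ((fun x => a x * phi x) \_ Omega) y.
    have : nbhs x Omega by exact: open_nbhs_nbhs.
    by apply: filterS => y Oy; rewrite patchE mem_set.
  rewrite /continuous_at -(nbhs_singleton E).
  apply: cvg_trans; first exact: near_eq_cvg E.
  by apply: (cvgM (ca x Ox) (cphi x)).
have E : \forall y \near x, cst 0 y = ((fun x => a x * phi x) \_ Omega) y.
  have : nbhs x (~` K).
    apply: open_nbhs_nbhs; split; last by move=> /KO.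
    by apply: closed_openC; exact: compact_closed3.
  by apply: filterS => y Ky; rewrite patchE phi0// mulr0; case: ifP.
rewrite /continuous_at -(nbhs_singleton E).
by apply: cvg_trans; [exact: near_eq_cvg E|exact: cvg_cst].
Qed.

Lemma locally_integrable_continuous Omega a : open Omega ->
  (forall x, Omega x -> {for x, continuous a}) -> locally_integrable_on Omega a.
Proof.
move=> oO ca K KO cK; have mK := compact_measurable3 cK.
have ma : measurable_fun K a.
  apply: measurable_funS KO _; first exact: open_measurable3.
  exact: open_continuous_measurable_fun3.
have /compact_bounded [N [_ hN]] : compact (a @` K).
  apply: continuous_compact => //; apply: continuous_in_subspaceT => x.
  by rewrite inE => /KO; exact: ca.
have [M [_ KM]] := compact_bounded cK.
apply/integrable_mkcond => //.
rewrite restrict_EFin; have M1 : 0 < `|M| + 1 by rewrite ltr_wpDl.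
apply: (@integrable_bounded_supp _ _ _ mu3 (cube3 (`|M| + 1)) (a \_ K) (`|N| + 1)).
- exact: measurable_cube3.
- by rewrite [X in (X < _)%E]measure_cube3// ltry.
- by apply (@measurable_restrictT _ _ _ _ K a mK); exact: ma.
- move=> x; rewrite patchE; case: ifPn => xK; last by rewrite normr0 addr_ge0.
  apply: (hN (`|N| + 1)); first by rewrite (le_lt_trans (ler_norm _))// ltrDl.
  by exists x => //; move: xK; rewrite inE.
- move=> x cx; rewrite patchE; case: ifPn => //; rewrite inE => xK.
  have := notin_cube3 cx; rewrite ltNge => /negP []; apply: KM => //.
  by rewrite (le_lt_trans (ler_norm _))// ltrDl.
Qed.

(** Real valued, so that the identities defining weak derivatives can be added
    and subtracted freely. *)
Definition pair Omega a phi : R := (\int[mu3]_(x in Omega) (a x * phi x))%R.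

Lemma pair_restrict Omega (K : set (R3 R)) a phi : K `<=` Omega ->
  (forall x, ~ K x -> phi x = 0) ->
  (fun x => a x * phi x) \_ Omega = (fun x => a x * phi x) \_ K.
Proof.
move=> KO phi0; apply/funext => x; rewrite !patchE.
case: ifPn => xO; case: ifPn => xK //.
  by rewrite phi0 ?mulr0//; move: xK; rewrite notin_setE.
by move: xO; rewrite mem_set//; apply: KO; move: xK; rewrite inE.
Qed.

Lemma integrable_mulK (K : set (R3 R)) a phi : compact K ->
  mu3.-integrable K (EFin \o a) -> continuous phi ->
  mu3.-integrable K (EFin \o (fun x => a x * phi x)).
Proof.
move=> cK ia cphi.
have mphi : measurable_fun K phi.
  by apply: measurable_funTS; exact: continuous_measurable_fun3.
have bphi : [bounded phi x | x in K].
  have /compact_bounded [N hN] : compact (phi @` K).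
    by apply: continuous_compact cK; exact: continuous_subspaceT.
  exists N; split; first by case: hN.
  by case: hN => _ hN y Ny x Kx; apply: (hN y Ny); exists x.
have mK := compact_measurable3 cK.
have h := integrableMl mK ia mphi bphi.
have -> : EFin \o (fun x => a x * phi x) = ((EFin \o a) \* (EFin \o phi))%E.
  by apply/funext => x.
exact: h.
Qed.

Lemma pair_integrable Omega a phi : open Omega -> locally_integrable_on Omega a ->
  continuous phi -> supp_in Omega phi ->
  mu3.-integrable Omega (EFin \o (fun x => a x * phi x)).
Proof.
move=> oO ia cphi [K [cK KO phi0]].
apply/integrable_mkcond; first exact: open_measurable3.
rewrite restrict_EFin (pair_restrict _ KO phi0) -restrict_EFin.
have h := integrable_mulK cK (ia K KO cK) cphi.
exact: ((integrable_mkcond (mu := mu3) _ (compact_measurable3 cK)).1 h).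
Qed.

Lemma pairBl Omega a b phi : open Omega -> locally_integrable_on Omega a ->
  locally_integrable_on Omega b -> continuous phi -> supp_in Omega phi ->
  pair Omega (a \- b) phi = pair Omega a phi - pair Omega b phi.
Proof.
move=> oO ia ib cphi sphi; rewrite /pair -RintegralB; last 3 first.
- exact: open_measurable3.
- exact: pair_integrable.
- exact: pair_integrable.
by apply: eq_Rintegral => x _; rewrite /= mulrBl.
Qed.

Lemma pairDr Omega a phi psi : open Omega -> locally_integrable_on Omega a ->
  continuous phi -> supp_in Omega phi -> continuous psi -> supp_in Omega psi ->
  pair Omega a (fun x => phi x + psi x) = pair Omega a phi + pair Omega a psi.
Proof.
move=> oO ia cphi sphi cpsi spsi; rewrite /pair -RintegralD; last 3 first.
- exact: open_measurable3.
- exact: pair_integrable.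
- exact: pair_integrable.
by apply: eq_Rintegral => x _; rewrite /= mulrDr.
Qed.

Lemma integral_pair Omega a phi : open Omega -> locally_integrable_on Omega a ->
  continuous phi -> supp_in Omega phi ->
  (\int[mu3]_(x in Omega) (a x * phi x)%:E = (pair Omega a phi)%:E)%E.
Proof.
move=> oO ia cphi sphi; rewrite /pair /Rintegral fineK//.
by apply: integrable_fin_num; [exact: open_measurable3|exact: pair_integrable].
Qed.

Lemma is_weak_partialP Omega i a b : open Omega ->
  is_weak_partial Omega i a b <->
  [/\ locally_integrable_on Omega a, locally_integrable_on Omega b &
    forall phi, test_function Omega phi ->
      pair Omega a ('D_(basis3 i) phi) = - pair Omega b phi].
Proof.
move=> oO; split=> -[ia ib H]; split=> // phi tphi; have := H _ tphi;
  case: (tphi) => sphi _ _.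
  rewrite !integral_pair//; try exact: test_function_derive_supp_in;
    try exact: test_function_supp_in; try exact: smooth_continuous;
    try exact: smooth_derive_continuous.
  by move=> [].
rewrite !integral_pair//; try exact: test_function_derive_supp_in;
    try exact: test_function_supp_in; try exact: smooth_continuous;
    try exact: smooth_derive_continuous.
by move=> ->.
Qed.

Lemma locally_integrableB Omega a b : locally_integrable_on Omega a ->
  locally_integrable_on Omega b -> locally_integrable_on Omega (a \- b).
Proof.
move=> ia ib K KO cK.
exact: (integrableB (compact_measurable3 cK) (ia K KO cK) (ib K KO cK)).
Qed.

Lemma is_weak_partialB Omega i a b a' b' : open Omega ->
  is_weak_partial Omega i a a' -> is_weak_partial Omega i b b' ->
  is_weak_partial Omega i (a \- b) (a' \- b').
Proof.
move=> oO /(is_weak_partialP _ _ _ oO) [ia ia' Ha] /(is_weak_partialP _ _ _ oO) [ib ib' Hb].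
apply/(is_weak_partialP _ _ _ oO); split; try exact: locally_integrableB.
move=> phi tphi; case: (tphi) => sphi _ _.
rewrite !pairBl//; try exact: test_function_derive_supp_in;
    try exact: test_function_supp_in; try exact: smooth_continuous;
    try exact: smooth_derive_continuous.
by rewrite Ha// Hb// opprB opprK addrC.
Qed.

Lemma is_weak_partial_weak_partial Omega i a b :
  is_weak_partial Omega i a b -> is_weak_partial Omega i a (weak_partial Omega i a).
Proof. by move=> h; apply: (@xgetPex _ (cst 0) [set v | is_weak_partial Omega i a v]); exists b. Qed.

(** The product a * phi, extended by 0, is a compactly supported function on all of
    space with a continuous i-th partial derivative, and the integral of that
    derivative vanishes. *)
Lemma weak_partial_classical Omega i a b : open Omega ->
  (forall x, Omega x -> {for x, continuous a}) ->
  (forall x, Omega x -> {for x, continuous b}) ->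
  (forall x, Omega x -> is_derive x (basis3 i) a (b x)) ->
  is_weak_partial Omega i a b.
Proof.
move=> oO ca cb dab; apply/is_weak_partialP => //.
have ia := locally_integrable_continuous oO ca.
have ib := locally_integrable_continuous oO cb.
split=> // phi tphi; case: (tphi) => sphi _ _.
have cphi := smooth_continuous sphi.
have cdphi := smooth_derive_continuous (i := i) sphi.
have supp := test_function_supp_in tphi.
have dsupp := test_function_derive_supp_in i tphi.
have [M M0 HM] := supp_bounded supp.
have [M' M'0 HM'] := supp_bounded dsupp.
have dphi x := smooth_is_derive i x sphi.
set dphix := 'D_(basis3 i) phi in cdphi dsupp HM' dphi *.
pose G := (fun x => a x * phi x) \_ Omega.
pose F1 := (fun x => a x * dphix x) \_ Omega.
pose F2 := (fun x => b x * phi x) \_ Omega.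
have cF1 : continuous F1 by exact: mul_restrict_continuous.
have cF2 : continuous F2 by exact: mul_restrict_continuous.
have zero (c psi : R3 R -> R) N : (forall x, N < `|x| -> psi x = 0) ->
    forall x, N < `|x| -> ((fun x => c x * psi x) \_ Omega) x = 0.
  by move=> h x xN; rewrite patchE h// mulr0; case: ifP.
have dG x : is_derive x (basis3 i) G (F1 x + F2 x).
  have [Ox|Ox] := pselect (Omega x).
    have E : \forall y \near x, (a \* phi) y = G y.
      have : nbhs x Omega by exact: open_nbhs_nbhs.
      by apply: filterS => y Oy; rewrite /G patchE mem_set.
    apply: near_eq_is_derive E _.
    have := is_deriveM (dab x Ox) (dphi x).
    by rewrite /F1 /F2 !patchE mem_set// /GRing.scale/= [phi x * _]mulrC.
  case: supp => K [cK KO phi0].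
  have E : \forall y \near x, cst 0 y = G y.
    have : nbhs x (~` K).
      apply: open_nbhs_nbhs; split; last by move=> /KO.
      by apply: closed_openC; exact: compact_closed3.
    by apply: filterS => y Ky; rewrite /G patchE phi0// mulr0; case: ifP.
  apply: near_eq_is_derive E _; rewrite /F1 /F2 !patchE memNset// addr0.
  exact: is_derive_cst.
have cF12 : continuous (fun x => F1 x + F2 x).
  by move=> x; apply: continuousD; [exact: cF1|exact: cF2].
pose N := M + M' + 1.
have N0 : 0 < N by rewrite /N; lra.
have z1 := zero a dphix M' HM'; have z2 := zero b phi M HM.
have zG := zero a phi M HM.
have MN : M < N by rewrite /N; lra.
have MN' : M' < N by rewrite /N; lra.
have I0 : (\int[mu3]_x (F1 x + F2 x)%:E = 0)%E.
  apply: (integral_partial_eq0 N0 cF12 dG) => x xN.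
    by apply: zG; exact: lt_le_trans xN.
  by rewrite /F1 /F2 z1 ?z2 ?addr0//; apply: lt_trans xN.
apply/eqP; rewrite -addr_eq0; apply/eqP.
have := I0; rewrite -[X in (X = _)%E](_ : (pair Omega a dphix + pair Omega b phi)%:E = _).
  by case.
have i1 : mu3.-integrable setT (EFin \o F1).
  exact: (integrable3 M'0 cF1 z1).
have i2 : mu3.-integrable setT (EFin \o F2).
  exact: (integrable3 M0 cF2 z2).
have -> : pair Omega a dphix = (\int[mu3]_x F1 x)%R by exact: Rintegral_mkcond.
have -> : pair Omega b phi = (\int[mu3]_x F2 x)%R by exact: Rintegral_mkcond.
rewrite -RintegralD// /Rintegral fineK//.
by apply: integrable_fin_num => //; exact: (integrableD measurableT i1 i2).
Qed.

(** The weight delta is free: choosing it afterwards recovers, up to a constant,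
    what Hoelder's inequality would give. *)
Lemma young_pointwise (r t delta : R) : 1 < r -> 0 <= t -> 0 < delta ->
  t <= delta `^ (1 - r) * t `^ r + delta.
Proof.
move=> r1 t0 d0; have [td|td] := leP t delta.
  by apply: le_trans td _; rewrite lerDr mulr_ge0// powR_ge0.
have tp : 0 < t := lt_trans d0 td.
suff h : t <= delta `^ (1 - r) * t `^ r by apply: le_trans h _; rewrite lerDl ltW.
have -> : delta `^ (1 - r) = (delta `^ (r - 1))^-1 by rewrite -powRN opprB.
rewrite mulrC ler_pdivlMr ?powR_gt0//.
have -> : t `^ r = t * t `^ (r - 1).
  rewrite -{2}[t]powRr1 ?(ltW tp)// -powRD; last by apply/implyP => _; exact: lt0r_neq0.
  by congr (_ `^ _); ring.
rewrite ler_pM2l// ge0_ler_powR// ?nnegrE ?ltW//; lra.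
Qed.

(** Young's inequality integrated over E, the part of space where phi lives. A
    small measure m of E is exploited by a large delta. *)
Lemma pair_bound Omega a phi (E : set (R3 R)) (F : R3 R -> R) (r N C m delta : R) :
  open Omega -> locally_integrable_on Omega a -> continuous phi ->
  supp_in Omega phi -> 1 < r -> 0 < delta -> 0 <= C ->
  measurable E -> (mu3 E <= m%:E)%E -> (forall x, ~ E x -> phi x = 0) ->
  (forall x, `|phi x| <= C) ->
  (forall x, Omega x -> `|a x| `^ r <= F x) ->
  (\int[mu3]_(x in Omega) (F x)%:E <= N%:E)%E ->
  `|pair Omega a phi| <= C * (delta `^ (1 - r) * N + delta * m).
Proof.
move=> oO ia cphi [K [cK KO phi0]] r1 d0 C0 mE muE phiE phiC aF FN.
have mK := compact_measurable3 cK.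
pose KE := K `&` E.
have mKE : measurable KE by exact: measurableI.
have KEO : KE `<=` Omega by move=> x [/KO].
have iaKE : mu3.-integrable KE (EFin \o a).
  by apply: (integrableS mK mKE _ (ia K KO cK)); exact: subIsetl.
have phiKE x : ~ KE x -> phi x = 0.
  move=> h; have [Kx|/phi0//] := pselect (K x).
  by apply: phiE => Ex; apply: h.
have -> : pair Omega a phi = (\int[mu3]_(x in KE) (a x * phi x))%R.
  by rewrite /pair Rintegral_mkcond (pair_restrict _ KEO phiKE) -Rintegral_mkcond.
have iKE : mu3.-integrable KE (EFin \o (fun x => a x * phi x)).
  apply: (integrableS mK mKE); first exact: subIsetl.
  by apply: integrable_mulK => //; exact: ia.
rewrite -lee_fin EFin_normr_Rintegral//.
have miKE : measurable_fun KE (EFin \o (fun x => a x * phi x)) by case/integrableP: iKE.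
apply: le_trans (le_abse_integral mu3 mKE miKE) _.
pose c1 := delta `^ (1 - r).
have ma : measurable_fun KE a by apply/measurable_EFinP; case/integrableP: iaKE.
have mar : measurable_fun KE (fun x => `|a x| `^ r).
  by apply: (measurableT_comp (f := fun t => t `^ r)) => //; exact: measurableT_comp.
apply: (@le_trans _ _ (\int[mu3]_(x in KE) ((C * c1)%:E * (`|a x| `^ r)%:E + (C * delta)%:E))%E).
  apply: le_integral_ge0 => // x KEx; rewrite ?abse_ge0//.
    by rewrite -EFinM -EFinD lee_fin addr_ge0// !mulr_ge0// ?powR_ge0// ltW.
  rewrite -EFinM -EFinD /= lee_fin normrM mulrC.
  apply: (@le_trans _ _ (C * `|a x|)); first by rewrite ler_wpM2r.
  by rewrite -mulrA -mulrDr ler_wpM2l// young_pointwise.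
have mC : measurable_fun KE (fun x => ((C * c1)%:E * (`|a x| `^ r)%:E)%E).
  by apply: measurable_funeM; exact/measurable_EFinP.
have C10 : (0 <= (C * c1)%:E)%E by rewrite lee_fin mulr_ge0// powR_ge0.
have C20 : (0 <= (C * delta)%:E)%E by rewrite lee_fin mulr_ge0// ltW.
have ar0 x : (0 <= (`|a x| `^ r)%:E)%E by rewrite lee_fin powR_ge0.
have C1a x : (0 <= (C * c1)%:E * (`|a x| `^ r)%:E)%E by exact: mule_ge0.
have marE : measurable_fun KE (fun x => (`|a x| `^ r)%:E) by exact/measurable_EFinP.
rewrite (ge0_integralD mu3 mKE (fun x _ => C1a x) mC (fun=> fun=> C20))//.
have -> : (\int[mu3]_(x in KE) ((C * c1)%:E * (`|a x| `^ r)%:E)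
    = (C * c1)%:E * \int[mu3]_(x in KE) (`|a x| `^ r)%:E)%E by apply: ge0_integralZl.
rewrite integral_cst// mulrDr EFinD; apply: leeD.
  rewrite [C * (_ * N)]mulrA [X in (_ <= X)%E]EFinM; apply: lee_wpmul2l => //.
  apply: le_trans FN; apply: le_integral_ge0 => // x Ox.
    by rewrite lee_fin (le_trans _ (aF x Ox))// powR_ge0.
  by rewrite lee_fin; apply: aF; apply: KEO.
rewrite [C * (_ * m)]mulrA [X in (_ <= X)%E]EFinM; apply: lee_pmul => //.
apply: le_trans muE; apply: le_measure; rewrite ?inE//.
exact: subIsetr.
Qed.

End weak.

(** * Smooth tensor products *)

Section smooth_tensor.
Context {R : realType}.
Implicit Types f g h : R -> R.

Definition dtensor (i : 'I_3) f g h : R3 R -> R :=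
  tensor (if i == 0 :> nat then derive1 f else f)
    (if i == 1%N :> nat then derive1 g else g)
    (if i == 2%N :> nat then derive1 h else h).

Lemma is_derive_tensor (i : 'I_3) f g h x :
  (forall t : R, derivable f t 1) -> (forall t : R, derivable g t 1) ->
  (forall t : R, derivable h t 1) ->
  is_derive x (basis3 i) (tensor f g h) (dtensor i f g h x).
Proof.
move=> df dg dh; apply/is_derive_line.
case: x => [[a b] c]; case: i => [[|[|[|//]]] ?]; rewrite coord3E /dtensor /tensor /upd /=.
- have -> : (fun t => f t * g b * h c) = (fun t => g b * h c * f t).
    by apply/funext => t; rewrite -mulrA mulrC.
  rewrite (_ : _ * _ * _ = g b * h c * derive1 f a); last by rewrite -mulrA mulrC.
  exact: (is_deriveZ (g b * h c) (is_derive1P (df a))).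
- have -> : (fun t => f a * g t * h c) = (fun t => f a * h c * g t).
    by apply/funext => t; rewrite mulrAC.
  rewrite (_ : _ * _ * _ = f a * h c * derive1 g b); last by rewrite mulrAC.
  exact: (is_deriveZ (f a * h c) (is_derive1P (dg b))).
- exact: (is_deriveZ (f a * g b) (is_derive1P (dh c))).
Qed.

Lemma derive_tensorE (i : 'I_3) f g h x :
  smooth1 f -> smooth1 g -> smooth1 h ->
  'D_(basis3 i) (tensor f g h) x = dtensor i f g h x.
Proof.
move=> sf sg sh.
by have [] := is_derive_tensor i x (smooth1_derivable sf) (smooth1_derivable sg)
  (smooth1_derivable sh).
Qed.

Lemma derive_tensor (i : 'I_3) f g h :
  smooth1 f -> smooth1 g -> smooth1 h ->
  'D_(basis3 i) (tensor f g h) = dtensor i f g h.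
Proof. by move=> sf sg sh; apply/funext => x; exact: derive_tensorE. Qed.

(** Partial derivatives of a tensor product are again tensor products. *)
Lemma smooth_tensor f g h : smooth1 f -> smooth1 g -> smooth1 h ->
  smooth (tensor f g h).
Proof.
move=> sf sg sh s.
have [f' [g' [h' [-> sf' sg' sh']]]] : exists f' g' h',
    [/\ iter_partial s (tensor f g h) = tensor f' g' h', smooth1 f', smooth1 g' & smooth1 h'].
  elim: s => [|i s [f' [g' [h' [e sf' sg' sh']]]]]; first by exists f, g, h.
  rewrite /= e derive_tensor//.
  have sd (b : bool) k : smooth1 k -> smooth1 (if b then derive1 k else k).
    by case: b => //; exact: smooth1_derive.
  by do 3 eexists; split; [reflexivity|exact: sd|exact: sd|exact: sd].
split; first by apply: continuous_tensor; exact: smooth1_continuous.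
move=> i x.
by have [] := is_derive_tensor i x (smooth1_derivable sf') (smooth1_derivable sg')
  (smooth1_derivable sh').
Qed.

End smooth_tensor.

(** * Straightening vertical fibres, and distance to a planar set *)

Section fiber.
Context {R : realType}.
Implicit Types d z t : R.

(** Vertical fibres of the domain are the interval ]0, 1[ where d = 0 and ]-1, 1[
    where d > 0; d will be the distance to the complement of the planar set. The
    map fibz d sends ]0, 1[ increasingly onto the fibre: it is the
    identity for d = 0 and tends to 2 t - 1 for large d, and the factor d / (d + t)
    interpolates between the two, degenerating only as t tends to 0. Solving for
    t leads to a quadratic equation whose positive root is fibt. *)
Definition fibt d z : R := (z - 2 * d + Num.sqrt (z ^+ 2 + 4 * d ^+ 2 + 4 * d)) / 2.
Definition fibz d t : R := t - (1 - t) * d / (d + t).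

Let sqd d z : 0 <= d ->
  Num.sqrt (z ^+ 2 + 4 * d ^+ 2 + 4 * d) ^+ 2 = z ^+ 2 + 4 * d ^+ 2 + 4 * d.
Proof.
by move=> d0; rewrite sqr_sqrtr// !addr_ge0// ?sqr_ge0// mulr_ge0// ?sqr_ge0.
Qed.

Lemma fibt_rel d z : 0 <= d ->
  fibt d z ^+ 2 + (2 * d - z) * fibt d z = d * (1 + z).
Proof.
move=> d0; have := sqd z d0; rewrite /fibt; set s := Num.sqrt _ => h.
have -> : ((z - 2 * d + s) / 2) ^+ 2 + (2 * d - z) * ((z - 2 * d + s) / 2)
  = (s ^+ 2 - (z - 2 * d) ^+ 2) / 4 by field.
by rewrite h; field.
Qed.

Lemma fibt_ge d z : 0 <= d -> -1 < z -> 0 <= fibt d z + 2 * d - z.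
Proof.
move=> d0 z1; have := sqd z d0; rewrite /fibt; set s := Num.sqrt _ => h.
have s0 : 0 <= s by exact: sqrtr_ge0.
have dz : 0 <= d * (1 + z) by rewrite mulr_ge0//; lra.
suff : z - 2 * d <= s by lra.
have [|z2] := leP (z - 2 * d) 0; first by move=> ?; lra.
rewrite -(@ler_pXn2r _ 2%N) ?nnegrE//; last exact: ltW.
rewrite h; lra.
Qed.

Lemma fibt_bounds d z : 0 <= d -> -1 < z -> z < 1 -> 0 < z \/ 0 < d ->
  0 < fibt d z /\ fibt d z < 1.
Proof.
move=> d0 z1 z1' zd; have := sqd z d0; rewrite /fibt; set s := Num.sqrt _ => h.
have s0 : 0 <= s by exact: sqrtr_ge0.
split.
  suff : 2 * d - z < s by lra.
  have [h1|h1] := ltP (2 * d - z) 0; first by lra.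
  rewrite -(@ltr_pXn2r _ 2%N) ?nnegrE// h.
  have dp : 0 < d by case: zd => // ?; lra.
  have : 0 < d * (1 + z) by rewrite mulr_gt0//; lra.
  lra.
suff : s < 2 + 2 * d - z by lra.
rewrite -(@ltr_pXn2r _ 2%N) ?nnegrE//; last by lra.
have : 0 < (1 + d) * (1 - z) by rewrite mulr_gt0//; lra.
rewrite h; lra.
Qed.

Lemma fibz_rel d t : 0 <= d -> 0 < t -> fibz d t * (d + t) = t ^+ 2 + 2 * d * t - d.
Proof.
move=> d0 t0; have dt : d + t != 0 by rewrite gt_eqF// ltr_wpDl.
by rewrite /fibz; field.
Qed.

Lemma fibtK d z : 0 <= d -> -1 < z -> z < 1 -> 0 < z \/ 0 < d -> fibz d (fibt d z) = z.
Proof.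
move=> d0 z1 z1' zd; have [t0 _] := fibt_bounds d0 z1 z1' zd.
have dt : d + fibt d z != 0 by rewrite gt_eqF// ltr_wpDl.
apply: (mulIf dt); rewrite fibz_rel//; have := fibt_rel z d0; lra.
Qed.

Lemma fibz_bounds d t : 0 <= d -> 0 < t -> t < 1 ->
  [/\ -1 < fibz d t, fibz d t < 1, fibz d t <= t & 0 < fibz d t \/ 0 < d].
Proof.
move=> d0 t0 t1; have dt : 0 < d + t by rewrite ltr_wpDl.
have h := fibz_rel d0 t0.
have dt0 : 0 <= d * t by rewrite mulr_ge0// ltW.
have tt : 0 < t * t by rewrite mulr_gt0.
split.
- rewrite -(ltr_pM2r dt) h; nra.
- rewrite -(ltr_pM2r dt) h; nra.
- rewrite -(ler_pM2r dt) h; nra.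
- move: d0; rewrite le_eqVlt => /predU1P[e|]; last by right.
  by left; rewrite /fibz -e mulr0 mul0r subr0.
Qed.

Lemma fibzK d t : 0 <= d -> 0 < t -> t < 1 -> fibt d (fibz d t) = t.
Proof.
move=> d0 t0 t1; have [z1 z1' zt _] := fibz_bounds d0 t0 t1.
have h := fibz_rel d0 t0; rewrite /fibt; move: (fibz d t) h z1 z1' zt => z h z1 z1' zt.
have -> : z ^+ 2 + 4 * d ^+ 2 + 4 * d = (2 * t + 2 * d - z) ^+ 2.
  have -> : (2 * t + 2 * d - z) ^+ 2 = z ^+ 2 + 4 * d ^+ 2 + 4 * (t ^+ 2 + 2 * d * t) - 4 * (z * (d + t)) by ring.
  by rewrite h; ring.
rewrite sqrtr_sqr ger0_norm; [by field|lra].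
Qed.

(** Both fibre maps satisfy the same quadratic equation; subtracting it at two
    points yields both Lipschitz bounds, with a constant governed by the
    distance of t to 0 only. *)
Lemma fib_lip d z d' z' (t0 : R) : 0 < t0 ->
  0 <= d -> -1 < z -> z < 1 -> 0 <= d' -> -1 < z' -> z' < 1 -> d <= 2 -> d' <= 2 ->
  0 < z \/ 0 < d -> 0 < z' \/ 0 < d' ->
  t0 <= fibt d z -> t0 <= fibt d' z' ->
  `|fibt d z - fibt d' z'| <= 10 / t0 * (`|d - d'| + `|z - z'|) /\
  `|z - z'| <= 10 / t0 * (`|d - d'| + `|fibt d z - fibt d' z'|).
Proof.
move=> t00 d0 z1 z1' d0' z2 z2' dB dB' zd zd'.
have [t1 t2] := fibt_bounds d0 z1 z1' zd.
have [t1' t2'] := fibt_bounds d0' z2 z2' zd'.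
have r1 := fibt_rel z d0; have r2 := fibt_rel z' d0'.
have g := fibt_ge d0 z1.
move: (fibt d z) (fibt d' z') t1 t2 t1' t2' r1 r2 g => t t' t1 t2 t1' t2' r1 r2 g tt0 tt0'.
have e1 : (t - t') * (t + t' + 2 * d - z) =
  (z - z') * t' - 2 * (d - d') * t' + (d - d') * (1 + z) + d' * (z - z').
  by move: r1 r2; rewrite !expr2; nra.
have e2 : (z - z') * (d + t) = (t - t') * (t + t' + 2 * d) + 2 * t' * (d - d') - (d - d')
   - z' * ((d - d') + (t - t')).
  by move: r1 r2; rewrite !expr2; nra.
have aux (x y k : R) : t0 <= k -> x * k = y -> `|x| <= t0^-1 * `|y|.
  move=> tk <-; rewrite normrM [t0^-1 * _]mulrC ler_pdivlMr// ler_wpM2l//.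
  by apply: le_trans tk _; exact: ler_norm.
have mb (x k B : R) : - B <= k -> k <= B -> `|x * k| <= B * `|x|.
  by move=> k1 k2; rewrite normrM mulrC ler_wpM2r// ler_norml k1 k2.
have assoc X : 10 / t0 * X = t0^-1 * (10 * X) by rewrite mulrA [10 / _]mulrC.
have it0 : 0 <= t0^-1 by rewrite invr_ge0 ltW.
split.
- apply: le_trans (aux _ _ _ _ e1) _; first by lra.
  rewrite assoc ler_wpM2l//.
  apply: (@le_trans _ _ (`|(z - z') * (t' + d')| + `|(d - d') * (1 + z - 2 * t')|)).
    by apply: le_trans (ler_normD _ _); rewrite le_eqVlt; apply/orP; left; apply/eqP; congr `|_|; ring.
  have h1 := mb (z - z') (t' + d') 3; have h2 := mb (d - d') (1 + z - 2 * t') 3.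
  have n1 := normr_ge0 (z - z'); have n2 := normr_ge0 (d - d').
  apply: le_trans (lerD (h1 _ _) (h2 _ _)) _; lra.
- apply: le_trans (aux _ _ _ _ e2) _; first by lra.
  rewrite assoc ler_wpM2l//.
  apply: (@le_trans _ _ (`|(t - t') * (t + t' + 2 * d - z')| + `|(d - d') * (2 * t' - 1 - z')|)).
    by apply: le_trans (ler_normD _ _); rewrite le_eqVlt; apply/orP; left; apply/eqP; congr `|_|; ring.
  have h1 := mb (t - t') (t + t' + 2 * d - z') 10; have h2 := mb (d - d') (2 * t' - 1 - z') 10.
  have n1 := normr_ge0 (t - t'); have n2 := normr_ge0 (d - d').
  apply: le_trans (lerD (h1 _ _) (h2 _ _)) _; lra.
Qed.

Lemma continuous_fibz d t : 0 <= d -> 0 < t ->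
  {for (d, t), continuous (fun x : R * R => fibz x.1 x.2)}.
Proof.
move=> d0 t0; have dt : d + t != 0 by rewrite gt_eqF// ltr_wpDl.
have cf : x.1 @[x --> (d, t)] --> d by exact: cvg_fst.
have cs : x.2 @[x --> (d, t)] --> t by exact: cvg_snd.
apply: cvgB => //; apply: cvgM; last by apply: cvgV => //; exact: cvgD.
by apply: cvgM => //; apply: cvgB => //; exact: cvg_cst.
Qed.

Lemma continuous_fibt : continuous (fun x : R * R => fibt x.1 x.2).
Proof.
move=> [d t].
have cf : x.1 @[x --> (d, t)] --> d by exact: cvg_fst.
have cs : x.2 @[x --> (d, t)] --> t by exact: cvg_snd.
have cM (k : R) (f : R * R -> R) l : f x @[x --> (d, t)] --> l ->
    (k * f x) @[x --> (d, t)] --> k * l.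
  by move=> fl; apply: cvgM => //; exact: cvg_cst.
apply: cvgM; last exact: cvg_cst.
apply: cvgD; first by apply: cvgB => //; exact: cM.
have h : (x.2 ^+ 2 + 4 * x.1 ^+ 2 + 4 * x.1) @[x --> (d, t)] -->
    t ^+ 2 + 4 * d ^+ 2 + 4 * d.
  by apply: cvgD; [apply: cvgD; [apply: cvgM|apply: cM; apply: cvgM]|apply: cM].
rewrite /=.
have hh := (cvg_comp _ _ h (@sqrt_continuous R _)).
exact: hh.
Qed.

End fiber.

Section distance.
Context {R : realType}.
Implicit Types (A : set (R * R)) (x y : R * R).

Definition dist A x : R := inf [set `|x - y| | y in A].

Lemma dist_has_lbound A x : has_lbound [set `|x - y| | y in A].
Proof. by exists 0 => _ [y _ <-]. Qed.

Lemma dist_ge0 A x : 0 <= dist A x.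
Proof.
have [->|/set0P[a Aa]] := eqVneq A set0; first by rewrite /dist image_set0 inf0.
by apply: lb_le_inf; [exists `|x - a|, a|move=> _ [y _ <-]].
Qed.

Lemma dist_le A x a : A a -> dist A x <= `|x - a|.
Proof. by move=> Aa; apply: ge_inf; [exact: dist_has_lbound|exists a]. Qed.

Lemma dist_lip A x y : A !=set0 -> dist A x - dist A y <= `|x - y|.
Proof.
move=> [a Aa]; rewrite lerBlDr -lerBlDl.
apply: lb_le_inf; first by exists `|y - a|, a.
move=> _ [b Ab <-]; rewrite lerBlDl; apply: le_trans (dist_le x Ab) _.
by rewrite (le_trans _ (ler_normD _ _))// addrA subrK.
Qed.

Lemma dist_lip_norm A x y : A !=set0 -> `|dist A x - dist A y| <= `|x - y|.
Proof.
by move=> A0; rewrite ler_norml lerNl opprB dist_lip// distrC dist_lip.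
Qed.

Lemma dist_gt0 A x : A !=set0 -> closed A -> (0 < dist A x) <-> ~ A x.
Proof.
move=> A0 cA; split.
  by move=> d0 Ax; have := dist_le x Ax; rewrite subrr normr0 leNgt d0.
move=> nAx.
have /nbhs_ballP[e /= e0 eA] : nbhs x (~` A).
  by apply: open_nbhs_nbhs; split => //; exact: closed_openC.
apply: lt_le_trans e0 _; apply: lb_le_inf.
  by case: A0 => a Aa; exists `|x - a|, a.
move=> _ [y Ay <-]; rewrite leNgt; apply/negP => xy.
by apply: (eA y) => //; rewrite -ball_normE.
Qed.

Lemma continuous_dist A : A !=set0 -> continuous (dist A).
Proof.
move=> A0 x; apply/cvgrPdist_lt => e e0; near=> y.
apply: le_lt_trans (dist_lip_norm x y A0) _.
by near: y; exact: cvgr_dist_lt.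
Unshelve. all: by end_near. Qed.

End distance.

(** * Cellars are locally bi-Lipschitz balls *)

Section radial.
Context {R : realType}.
Implicit Types (x y : R3 R) (p q : R3 R -> R).

Definition is_norm p := [/\ forall x y, p (x + y) <= p x + p y,
  forall (k : R) x, p (k *: x) = `|k| * p x, forall x, 0 <= p x &
  forall x, p x = 0 -> x = 0].

(** The rescaling of each ray that maps the balls of p onto those of q. *)
Definition radial p q x : R3 R := (p x / q x) *: x.

Lemma is_norm0 p : is_norm p -> p 0 = 0.
Proof. by case=> _ h _ _; rewrite -(scale0r (0 : R3 R)) h normr0 mul0r. Qed.

Lemma is_norm_sub p x y : is_norm p -> `|p x - p y| <= p (x - y).
Proof.
move=> [tri hom _ _].
have sym a b : p (a - b) = p (b - a).
  by rewrite -opprB -scaleN1r hom normrN normr1 mul1r.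
have h a b : p a - p b <= p (a - b).
  by rewrite lerBlDr; have := tri (a - b) b; rewrite subrK.
by rewrite ler_norml lerNl opprB h sym h.
Qed.

Lemma radial0 p q : radial p q 0 = 0.
Proof. by rewrite /radial scaler0. Qed.

Lemma radial_norm p q x : is_norm p -> is_norm q -> q (radial p q x) = p x.
Proof.
move=> np nq; have [q0|q0] := eqVneq (q x) 0.
  case: (nq) => _ _ _ /(_ _ q0) ->; by rewrite radial0 !is_norm0.
case: nq np => _ hom pos _ [_ _ pos' _].
by rewrite hom ger0_norm ?divr_ge0// mulfVK.
Qed.

Lemma radialK p q x : is_norm p -> is_norm q -> radial q p (radial p q x) = x.
Proof.
move=> np nq; have [->|x0] := eqVneq x 0; first by rewrite !radial0.
have q0 : q x != 0 by apply: contraNneq x0; case: nq => _ _ _ /[apply] ->.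
have p0 : p x != 0 by apply: contraNneq x0; case: np => _ _ _ /[apply] ->.
rewrite {1}/radial radial_norm//.
have -> : p (radial p q x) = p x / q x * p x.
  case: np nq => _ hom pos _ [_ _ pos' _].
  by rewrite hom ger0_norm// divr_ge0.
rewrite /radial scalerA.
suff -> : p x / (p x / q x * p x) * (p x / q x) = 1 by rewrite scale1r.
by field; rewrite p0 q0.
Qed.

(** Split the difference into (p x / q x) (x - y), plus y times the variation of
    the ratio p / q; the latter costs two more Lipschitz constants. *)
Lemma radial_lip p q (c : R) x y : is_norm p -> is_norm q ->
  (forall x, p x <= c * q x) -> q (radial p q x - radial p q y) <= 3 * c * q (x - y).
Proof.
move=> np nq pc; case: (np) => _ _ ppos pdef; case: (nq) => qtri qhom qpos qdef.
have pcq := pc (x - y); have p0 := ppos (x - y).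
have three : c * q (x - y) <= 3 * c * q (x - y) by rewrite -mulrA; lra.
have qN z : q (- z) = q z by rewrite -scaleN1r qhom normrN normr1 mul1r.
have [xE|x0] := eqVneq x 0.
  move: three; rewrite xE radial0 !sub0r !qN radial_norm//.
  by apply: le_trans; exact: pc.
have q0 : 0 < q x.
  by rewrite lt_neqAle qpos andbT eq_sym; apply: contraNneq x0 => /qdef ->.
have [yE|y0] := eqVneq y 0.
  by move: three; rewrite yE radial0 !subr0 radial_norm//; apply: le_trans; exact: pc.
have qy0 : 0 < q y.
  by rewrite lt_neqAle qpos andbT eq_sym; apply: contraNneq y0 => /qdef ->.
have -> : radial p q x - radial p q y =
    (p x / q x) *: (x - y) + (p x / q x - p y / q y) *: y.
  by rewrite /radial scalerBl scalerBr addrA subrK.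
apply: le_trans (qtri _ _) _; rewrite !qhom.
rewrite ger0_norm ?divr_ge0//.
have pq : p x / q x <= c by rewrite ler_pdivrMr.
have h1 : p x / q x * q (x - y) <= c * q (x - y) by rewrite ler_wpM2r.
have h2 : `|p x / q x - p y / q y| * q y <= c * q (x - y) + p (x - y).
  have -> : p x / q x - p y / q y = (p x / q x * (q y - q x) + (p x - p y)) / q y.
    by field; rewrite !gt_eqF.
  rewrite normrM normfV [`|q y|]gtr0_norm// mulfVK ?gt_eqF//.
  apply: le_trans (ler_normD _ _) _; apply: lerD; last exact: is_norm_sub.
  rewrite normrM ger0_norm ?divr_ge0//; apply: ler_pM => //; first by rewrite divr_ge0.
  by rewrite distrC; exact: is_norm_sub.
rewrite -mulrA; lra.
Qed.

Lemma enormE x : enorm x = Num.sqrt (x.1.1 ^+ 2 + x.1.2 ^+ 2 + x.2 ^+ 2).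
Proof.
by rewrite /enorm !big_ord_recr big_ord0 /= add0r /coord3.
Qed.

Lemma sqr_enorm x : enorm x ^+ 2 = x.1.1 ^+ 2 + x.1.2 ^+ 2 + x.2 ^+ 2.
Proof. by rewrite enormE sqr_sqrtr// !addr_ge0// sqr_ge0. Qed.

Lemma enorm_ge0 x : 0 <= enorm x.
Proof. exact: sqrtr_ge0. Qed.

Let le_sqr (a b : R) : 0 <= b -> a ^+ 2 <= b ^+ 2 -> a <= b.
Proof.
move=> b0 ab; rewrite leNgt; apply/negP => ba.
by move: ab; rewrite leNgt => /negP; apply; rewrite !expr2; nra.
Qed.

Lemma enorm_is_norm : is_norm (@enorm R).
Proof.
split.
- move=> x y; have x0 := enorm_ge0 x; have y0 := enorm_ge0 y.
  have xy0 := enorm_ge0 (x + y).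
  apply: le_sqr; first exact: addr_ge0.
  rewrite sqr_enorm [leRHS]sqrrD !sqr_enorm.
  have cs : x.1.1 * y.1.1 + x.1.2 * y.1.2 + x.2 * y.2 <= enorm x * enorm y.
    have [h|h] := leP (x.1.1 * y.1.1 + x.1.2 * y.1.2 + x.2 * y.2) 0.
      by apply: le_trans h _; rewrite mulr_ge0.
    apply: le_sqr; first exact: mulr_ge0.
    rewrite exprMn !sqr_enorm -subr_ge0.
    rewrite (_ : _ - _ = (x.1.1 * y.1.2 - x.1.2 * y.1.1) ^+ 2 + (x.1.1 * y.2 - x.2 * y.1.1) ^+ 2
      + (x.1.2 * y.2 - x.2 * y.1.2) ^+ 2); last by ring.
    by rewrite !addr_ge0// sqr_ge0.
  have -> : (x + y).1.1 = x.1.1 + y.1.1 by [].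
  have -> : (x + y).1.2 = x.1.2 + y.1.2 by [].
  have -> : (x + y).2 = x.2 + y.2 by [].
  by move: (enorm x * enorm y) cs => m cs; lra.
- move=> k x; rewrite !enormE -sqrtr_sqr -sqrtrM ?sqr_ge0//; congr Num.sqrt.
  by rewrite /= /GRing.scale/=; ring.
- exact: enorm_ge0.
- move=> x h; have := sqr_enorm x; rewrite h expr0n/= => /esym/eqP.
  rewrite !paddr_eq0 ?addr_ge0 ?sqr_ge0// !sqrf_eq0 => /andP[/andP[/eqP a /eqP b] /eqP c].
  by move: x a b c {h} => [[x1 x2] x3] /= -> -> ->.
Qed.

Lemma sup_is_norm : is_norm (fun x : R3 R => `|x|).
Proof.
split; [exact: ler_normD|exact: normrZ|exact: normr_ge0|].
by move=> x /normr0_eq0.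
Qed.

Lemma sup_le_enorm x : `|x| <= enorm x.
Proof.
have e0 := enorm_ge0 x.
have h (t : R) : t ^+ 2 <= enorm x ^+ 2 -> `|t| <= enorm x.
  by move=> ht; apply: le_sqr => //; rewrite real_normK ?num_real.
have [a b c] : [/\ 0 <= x.1.1 ^+ 2, 0 <= x.1.2 ^+ 2 & 0 <= x.2 ^+ 2] by rewrite !sqr_ge0.
rewrite prod_normE ge_max prod_normE ge_max.
by rewrite !h// sqr_enorm; lra.
Qed.

Lemma enorm_le_sup x : enorm x <= 2 * `|x|.
Proof.
apply: le_sqr; first by rewrite mulr_ge0.
rewrite sqr_enorm exprMn.
have h (t : R) : `|t| <= `|x| -> t ^+ 2 <= `|x| ^+ 2.
  by move=> ht; rewrite -[t ^+ 2]real_normK ?num_real// ler_pXn2r ?nnegrE.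
have [a b c] := norm_coord3 x.
have := h _ a; have := h _ b; have := h _ c; have := sqr_ge0 `|x|; lra.
Qed.

Lemma lipschitz_continuous (f : R3 R -> R3 R) (L : R) :
  (forall x y, `|f x - f y| <= L * `|x - y|) -> continuous f.
Proof.
move=> fL x; apply/cvgrPdist_lt => e e0; near=> y.
apply: le_lt_trans (fL x y) _.
have L1 : 0 < `|L| + 1 by rewrite ltr_wpDl.
apply: (@le_lt_trans _ _ ((`|L| + 1) * `|x - y|)).
  by rewrite ler_wpM2r// (le_trans (ler_norm _))// lerDl.
rewrite mulrC -ltr_pdivlMr//.
by near: y; apply: cvgr_dist_lt => //; rewrite divr_gt0.
Unshelve. all: by end_near. Qed.

Definition cube_to_ball : R3 R -> R3 R := radial (fun x => `|x|) enorm.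
Definition ball_to_cube : R3 R -> R3 R := radial enorm (fun x => `|x|).

Lemma cube_to_ballK : cancel cube_to_ball ball_to_cube.
Proof. by move=> x; exact: (radialK x sup_is_norm enorm_is_norm). Qed.

Lemma ball_to_cubeK : cancel ball_to_cube cube_to_ball.
Proof. by move=> x; exact: (radialK x enorm_is_norm sup_is_norm). Qed.

Lemma enorm_cube_to_ball x : enorm (cube_to_ball x) = `|x|.
Proof. exact: (radial_norm x sup_is_norm enorm_is_norm). Qed.

Lemma norm_ball_to_cube x : `|ball_to_cube x| = enorm x.
Proof. exact: (radial_norm x enorm_is_norm sup_is_norm). Qed.

Lemma cube_to_ball_lip x y :
  enorm (cube_to_ball x - cube_to_ball y) <= 3 * enorm (x - y).
Proof.
have := @radial_lip _ _ 1 x y sup_is_norm enorm_is_norm; rewrite mulr1; apply.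
by move=> z; rewrite mul1r sup_le_enorm.
Qed.

Lemma ball_to_cube_lip x y : `|ball_to_cube x - ball_to_cube y| <= 6 * `|x - y|.
Proof.
have := @radial_lip _ _ 2 x y enorm_is_norm sup_is_norm.
rewrite (_ : 3 * 2 = 6); first by apply; exact: enorm_le_sup.
by rewrite -natrM.
Qed.

Lemma continuous_cube_to_ball : continuous cube_to_ball.
Proof.
apply: (@lipschitz_continuous _ 6) => x y.
apply: le_trans (sup_le_enorm _) _; apply: le_trans (cube_to_ball_lip x y) _.
have := enorm_le_sup (x - y); lra.
Qed.

Lemma continuous_ball_to_cube : continuous ball_to_cube.
Proof. exact: lipschitz_continuous ball_to_cube_lip. Qed.

End radial.

Section cellar.
Context {R : realType}.
Variable D : set (R * R).

(** The region above the graph of a function with values in {-1, 0}: whatever the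
    topology of D, every vertical fibre is an interval, and this is why cellars
    are balls. *)
Definition cellar : set (R3 R) :=
  [set x | [/\ `|x.1.1| < 2^-1, `|x.1.2| < 1, `|x.2| < 1 & 0 < x.2 \/ D x.1]].

Hypothesis oD : open D.
Hypothesis DQ : forall a, D a -> `|a.1| < 2^-1 /\ `|a.2| < 1.

Let dD := dist (~` D).

Let D_ne : (~` D) !=set0.
Proof.
by exists (1, 0) => /DQ [/=]; rewrite normr1 => h _; move: h; rewrite invf_gt1//; lra.
Qed.

Let dD_ge0 a : 0 <= dD a. Proof. exact: dist_ge0. Qed.

Let dD_gt0 a : 0 < dD a <-> D a.
Proof.
split=> h; first by apply: contrapT; apply/(dist_gt0 _ D_ne); [exact: open_closedC|].
by apply/(dist_gt0 _ D_ne); [exact: open_closedC|move=> h'; exact: h' h].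
Qed.

Let dD_le2 a : `|a.1| < 2^-1 -> `|a.2| < 1 -> dD a <= 2.
Proof.
move=> a1 a2; apply: le_trans (dist_le a (a := (1, 0)) _) _.
  by move=> /DQ [/=]; rewrite normr1 => h _; move: h; rewrite invf_gt1//; lra.
rewrite prod_normE ge_max /= subr0; apply/andP; split; last by lra.
by apply: le_trans (ler_normB _ _) _; rewrite normr1; lra.
Qed.

Definition cellar_to_cube (x : R3 R) : R3 R :=
  (2 * x.1.1, x.1.2, 2 * fibt (dD x.1) x.2 - 1).

Definition cube_to_cellar (y : R3 R) : R3 R :=
  (2^-1 * y.1.1, y.1.2, fibz (dD (2^-1 * y.1.1, y.1.2)) ((y.2 + 1) / 2)).

Let cellarP x : cellar x -> [/\ `|x.1.1| < 2^-1, `|x.1.2| < 1, -1 < x.2, x.2 < 1 &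
  0 < x.2 \/ 0 < dD x.1].
Proof.
by move=> [h1 h2]; rewrite ltr_norml => /andP[h3 h4] [h|/dD_gt0 h]; split => //; [left|right].
Qed.

Lemma cellar_to_cubeP x : cellar x -> `|cellar_to_cube x| < 1.
Proof.
move=> /cellarP [h1 h2 h3 h4 h5].
have [t0 t1] := fibt_bounds (dD_ge0 x.1) h3 h4 h5.
apply: norm_coord3_lt => //=; last by rewrite ltr_norml; apply/andP; split; lra.
by move: h1; rewrite !ltr_norml => /andP[? ?]; apply/andP; split; lra.
Qed.

Lemma cube_to_cellarP y : `|y| < 1 -> cellar (cube_to_cellar y).
Proof.
move=> yN; have [a b c] := norm_coord3 y.
have {}a : `|y.1.1| < 1 by lra. have {}b : `|y.1.2| < 1 by lra.
have {}c : `|y.2| < 1 by lra.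
have [c1 c2] : -1 < y.2 /\ y.2 < 1 by apply/andP; rewrite -ltr_norml.
have t0 : 0 < (y.2 + 1) / 2 by lra.
have t1 : (y.2 + 1) / 2 < 1 by lra.
have [z1 z2 _ z3] := fibz_bounds (dD_ge0 (2^-1 * y.1.1, y.1.2)) t0 t1.
split => //=.
- by rewrite normrM gtr0_norm ?invr_gt0//; lra.
- by rewrite ltr_norml z1 z2.
- by case: z3 => [|/dD_gt0]; [left|right].
Qed.

Lemma cellar_to_cubeK x : cellar x -> cube_to_cellar (cellar_to_cube x) = x.
Proof.
move=> /cellarP [h1 h2 h3 h4 h5]; rewrite /cube_to_cellar /cellar_to_cube /=.
rewrite mulKf// subrK mulrC mulKf//.
case: x h1 h2 h3 h4 h5 => [[a b] c] /= h1 h2 h3 h4 h5.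
by rewrite fibtK.
Qed.

Lemma cube_to_cellarK y : `|y| < 1 -> cellar_to_cube (cube_to_cellar y) = y.
Proof.
move=> yN; have [_ _ c] := norm_coord3 y.
have {}c : `|y.2| < 1 by lra.
have [c1 c2] : -1 < y.2 /\ y.2 < 1 by apply/andP; rewrite -ltr_norml.
rewrite /cube_to_cellar /cellar_to_cube /= fibzK//; [|lra|lra].
rewrite mulVKf// mulrC mulfVK// addrK.
by case: y {yN c c1 c2} => [[? ?] ?].
Qed.

Lemma continuous_cellar_to_cube : continuous cellar_to_cube.
Proof.
move=> x.
have f1 : y.1 @[y --> x] --> x.1 by exact: cvg_fst.
have f11 : y.1.1 @[y --> x] --> x.1.1 by apply: (cvg_comp _ _ f1); exact: cvg_fst.
have f12 : y.1.2 @[y --> x] --> x.1.2 by apply: (cvg_comp _ _ f1); exact: cvg_snd.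
have f2 : y.2 @[y --> x] --> x.2 by exact: cvg_snd.
have fd : (dD y.1) @[y --> x] --> dD x.1.
  by apply: (cvg_comp _ _ f1); exact: continuous_dist.
have ft := cvg_comp _ _ (cvg_pair fd f2) (@continuous_fibt R (dD x.1, x.2)).
have g1 : (2 * y.1.1) @[y --> x] --> 2 * x.1.1 by apply: cvgM => //; exact: cvg_cst.
have g2 : (2 * fibt (dD y.1) y.2 - 1) @[y --> x] --> 2 * fibt (dD x.1) x.2 - 1.
  by apply: cvgB; [apply: cvgM; [exact: cvg_cst|exact: ft]|exact: cvg_cst].
exact: (cvg_pair (cvg_pair g1 f12) g2).
Qed.

Lemma continuous_cube_to_cellar y : `|y| < 1 -> {for y, continuous cube_to_cellar}.
Proof.
move=> yN; have [_ _ c] := norm_coord3 y.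
have {}c : `|y.2| < 1 by lra.
have [c1 c2] : -1 < y.2 /\ y.2 < 1 by apply/andP; rewrite -ltr_norml.
have f1 : x.1 @[x --> y] --> y.1 by exact: cvg_fst.
have f11 : x.1.1 @[x --> y] --> y.1.1 by apply: (cvg_comp _ _ f1); exact: cvg_fst.
have f12 : x.1.2 @[x --> y] --> y.1.2 by apply: (cvg_comp _ _ f1); exact: cvg_snd.
have f2 : x.2 @[x --> y] --> y.2 by exact: cvg_snd.
have g1 : (2^-1 * x.1.1) @[x --> y] --> 2^-1 * y.1.1.
  by apply: cvgM => //; exact: cvg_cst.
have g2 : ((x.2 + 1) / 2) @[x --> y] --> (y.2 + 1) / 2.
  by apply: cvgM; [apply: cvgD => //|]; exact: cvg_cst.
have g3 : (2^-1 * x.1.1, x.1.2) @[x --> y] --> (2^-1 * y.1.1, y.1.2).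
  exact: (cvg_pair g1 f12).
have fd : (dD (2^-1 * x.1.1, x.1.2)) @[x --> y] --> dD (2^-1 * y.1.1, y.1.2).
  by apply: (cvg_comp _ _ g3); exact: continuous_dist.
have t0 : 0 < (y.2 + 1) / 2 by lra.
have g4 : fibz (dD (2^-1 * x.1.1, x.1.2)) ((x.2 + 1) / 2) @[x --> y] -->
    fibz (dD (2^-1 * y.1.1, y.1.2)) ((y.2 + 1) / 2).
  exact: (cvg_comp _ _ (cvg_pair fd g2) (continuous_fibz (dD_ge0 _) t0)).
exact: (cvg_pair g3 g4).
Qed.

Let lip_coord (a N T : R) : 1 < T -> 0 <= a -> a <= N ->
  a <= 40 * T * N /\ 2 * a <= 40 * T * N.
Proof.
move=> T1 a0 aN; have NT : N <= T * N by rewrite ler_peMl ?(le_trans a0)// ltW.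
by rewrite -mulrA; split; lra.
Qed.

Let lip_fibre (a A B N T : R) : 1 < T -> A <= N -> B <= N ->
  a <= 10 * T * (A + B) -> 2 * a <= 40 * T * N.
Proof.
move=> T1 AN BN; have : T * (A + B) <= T * (N + N) by rewrite ler_wpM2l ?lerD//; lra.
by rewrite -!mulrA mulrDr; lra.
Qed.

Let le_double (a b : R) : 0 <= a -> 2 * a <= b -> a <= b.
Proof. by move=> ? ?; lra. Qed.

Lemma cellar_to_cube_bilip (K : set (R3 R)) : K `<=` cellar -> compact K ->
  exists2 L : R, 0 < L & forall x y, K x -> K y ->
    `|cellar_to_cube x - cellar_to_cube y| <= L * `|x - y| /\
    `|x - y| <= L * `|cellar_to_cube x - cellar_to_cube y|.
Proof.
move=> KO cK; have [->|/set0P K0] := eqVneq K set0; first by exists 1.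
have cF : continuous (fun x : R3 R => fibt (dD x.1) x.2).
  move=> x; have f1 : y.1 @[y --> x] --> x.1 by exact: cvg_fst.
  have f2 : y.2 @[y --> x] --> x.2 by exact: cvg_snd.
  have fd : (dD y.1) @[y --> x] --> dD x.1.
    by apply: (cvg_comp _ _ f1); exact: continuous_dist.
  exact: (cvg_comp _ _ (cvg_pair fd f2) (@continuous_fibt R (dD x.1, x.2))).
(* By compactness fibt stays away from 0 on K, as the Lipschitz bounds need. *)
have [m [Km mmin]] := compact_EVT_min K0 cK (continuous_subspaceT cF).
move: Km; rewrite inE => /KO /cellarP [m1 m2 m3 m4 m5].
have [t0 t1] := fibt_bounds (dD_ge0 m.1) m3 m4 m5.
move: (fibt (dD m.1) m.2) t0 t1 mmin => t t0 t1 mmin.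
have it0 : 1 < t^-1 by rewrite invf_gt1.
exists (40 / t); first by rewrite divr_gt0.
move=> x y Kx Ky.
have mx := mmin x (mem_set Kx); have my := mmin y (mem_set Ky).
have /cellarP [x1 x2 x3 x4 x5] := KO _ Kx.
have /cellarP [y1 y2 y3 y4 y5] := KO _ Ky.
have [l1 l2] := fib_lip t0 (dD_ge0 x.1) x3 x4 (dD_ge0 y.1) y3 y4
  (dD_le2 x1 x2) (dD_le2 y1 y2) x5 y5 mx my.
have dl := dist_lip_norm x.1 y.1 D_ne.
rewrite -/dD in dl.
have e (a b : R3 R) : `|a - b| = Num.max (Num.max `|a.1.1 - b.1.1| `|a.1.2 - b.1.2|) `|a.2 - b.2|.
  by rewrite prod_normE [X in Num.max X _]prod_normE.
have e2 (a b : R * R) : `|a - b| = Num.max `|a.1 - b.1| `|a.2 - b.2| by rewrite prod_normE.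
have scal : `|2 * x.1.1 - 2 * y.1.1| = 2 * `|x.1.1 - y.1.1|.
  by rewrite -mulrBr normrM gtr0_norm.
rewrite /cellar_to_cube; move: l1 l2.
move: (fibt (dD x.1) x.2) (fibt (dD y.1) y.2) => s s' l1 l2.
move: dl l1 l2; move: (dD x.1) (dD y.1) => d d' dl l1 l2.
have scal2 : `|2 * s - 1 - (2 * s' - 1)| = 2 * `|s - s'|.
  by rewrite (_ : _ - _ = 2 * (s - s')); [rewrite normrM gtr0_norm|ring].
have n1 := normr_ge0 (x - y).
have [a1 a2 a3] : [/\ `|x.1.1 - y.1.1| <= `|x - y|, `|x.1.2 - y.1.2| <= `|x - y| &
    `|x.2 - y.2| <= `|x - y|] by exact: norm_coord3 (x - y).
have a4 : `|x.1 - y.1| <= `|x - y|.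
  by rewrite [`|x - y|]prod_normE le_max lexx.
move: (t^-1) it0 l1 l2 => T it0 l1 l2.
split.
- have dN := le_trans dl a4.
  rewrite e /= scal scal2 !ge_max; apply/andP; split; last exact: lip_fibre dN a3 l1.
  by apply/andP; split; [case: (lip_coord it0 (normr_ge0 _) a1)|case: (lip_coord it0 (normr_ge0 _) a2)].
- pose W : R3 R := (2 * x.1.1, x.1.2, 2 * s - 1) - (2 * y.1.1, y.1.2, 2 * s' - 1).
  rewrite -[X in _ * `|X|]/W; set Z := `|W|.
  have [b1 b2 b3] : [/\ `|2 * x.1.1 - 2 * y.1.1| <= Z, `|x.1.2 - y.1.2| <= Z &
    `|2 * s - 1 - (2 * s' - 1)| <= Z] by exact: norm_coord3 W.
  rewrite scal in b1; rewrite scal2 in b3.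
  have Z0 : 0 <= Z by exact: normr_ge0.
  have c1 := le_double (normr_ge0 _) b1; have c3 := le_double (normr_ge0 _) b3.
  have dZ : `|d - d'| <= Z by apply: le_trans dl _; rewrite e2 ge_max c1 b2.
  rewrite e !ge_max; apply/andP; split; last first.
    exact: le_double (normr_ge0 _) (lip_fibre it0 dZ c3 l2).
  by apply/andP; split; [case: (lip_coord it0 (normr_ge0 _) c1)|case: (lip_coord it0 (normr_ge0 _) b2)].
Qed.

Lemma open_cellar : open cellar.
Proof.
have cn (i : R3 R -> R) (k : R) : continuous i -> open [set x | `|i x| < k].
  move=> ci; rewrite (_ : mkset _ = i @^-1` [set t | `|0 - t| < k]).
    apply: open_comp; first by move=> x _; exact: ci.
    have := @ball_open _ R 0 k; rewrite -ball_normE; exact.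
  by apply/seteqP; split => x /=; rewrite sub0r normrN.
have c1 : continuous (fun x : R3 R => x.1) by move=> x; exact: cvg_fst.
have c11 : continuous (fun x : R3 R => x.1.1).
  by move=> x; apply: (cvg_comp _ _ (c1 x)); exact: cvg_fst.
have c12 : continuous (fun x : R3 R => x.1.2).
  by move=> x; apply: (cvg_comp _ _ (c1 x)); exact: cvg_snd.
have c2 : continuous (fun x : R3 R => x.2) by move=> x; exact: cvg_snd.
rewrite (_ : cellar = [set x | `|x.1.1| < 2^-1] `&` [set x | `|x.1.2| < 1] `&`
    [set x | `|x.2| < 1] `&` ([set x | 0 < x.2] `|` (fun x : R3 R => x.1) @^-1` D)).
  apply: openI; first by apply: openI; [apply: openI|]; exact: cn.
  apply: openU; last by apply: open_comp => // x _; exact: c1.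
  by apply: (open_comp (f := fun x : R3 R => x.2) (D := [set t | 0 < t])) => [x _|]; [exact: c2|exact: open_gt].
by apply/seteqP; split => [x [? ? ? ?]|x [[[? ?] ?] ?]].
Qed.

Lemma bounded_cellar : bounded_set cellar.
Proof.
exists 1; split => // M M1 x [h1 h2 h3 _]; apply: ltW; apply: norm_coord3_lt.
- by apply: lt_trans h1 _; lra.
- exact: lt_trans M1.
- exact: lt_trans M1.
Qed.

Definition cellar_to_ball := cube_to_ball \o cellar_to_cube.
Definition ball_to_cellar := cube_to_cellar \o ball_to_cube.

Let ball_to_cubeP (y : R3 R) : unit_ball y -> `|ball_to_cube y| < 1.
Proof. by move=> h; rewrite norm_ball_to_cube. Qed.

Let ball_to_cellarP (y : R3 R) : unit_ball y -> cellar (ball_to_cellar y).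
Proof. by move=> /ball_to_cubeP /cube_to_cellarP. Qed.

Let continuous_ball_to_cellar : {within unit_ball, continuous ball_to_cellar}.
Proof.
apply: continuous_in_subspaceT => y; rewrite inE => /ball_to_cubeP By.
by apply: continuous_comp; [exact: continuous_ball_to_cube|exact: continuous_cube_to_cellar].
Qed.

Let cellar_to_ballK x : cellar x -> ball_to_cellar (cellar_to_ball x) = x.
Proof.
move=> Ox; rewrite /ball_to_cellar /cellar_to_ball /=.
by rewrite cube_to_ballK cellar_to_cubeK.
Qed.

Lemma cellar_homeomorphism : homeomorphism_between cellar unit_ball cellar_to_ball.
Proof.
exists ball_to_cellar; split; first split => //.
- move=> x /cellar_to_cubeP; rewrite /unit_ball/=.
  by rewrite enorm_cube_to_ball.
- move=> y By; rewrite /ball_to_cellar /cellar_to_ball /= cube_to_cellarK ?ball_to_cubeP//.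
  exact: ball_to_cubeK.
split; last exact: continuous_ball_to_cellar.
apply: continuous_subspaceT => x; apply: continuous_comp.
  exact: continuous_cellar_to_cube.
exact: continuous_cube_to_ball.
Qed.

Lemma cellar_locally_bilipschitz : locally_bilipschitz cellar cellar_to_ball.
Proof.
move=> K KO cK; have [L L0 HL] := cellar_to_cube_bilip KO cK.
exists (12 * L); split => [|x y Kx Ky]; first by rewrite mulr_gt0.
have [h1 h2] := HL _ _ Kx Ky.
have g1 := cube_to_ball_lip (cellar_to_cube x) (cellar_to_cube y).
have := ball_to_cube_lip (cellar_to_ball x) (cellar_to_ball y).
rewrite /cellar_to_ball /= !cube_to_ballK => g2.
have e1 := enorm_le_sup (cellar_to_cube x - cellar_to_cube y).
have e2 := sup_le_enorm (cube_to_ball (cellar_to_cube x) - cube_to_ball (cellar_to_cube y)).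
have e3 := enorm_le_sup (x - y); have e4 := sup_le_enorm (x - y).
have e5 := normr_ge0 (x - y).
move: (cellar_to_cube x) (cellar_to_cube y) g1 g2 h1 h2 e1 e2 => X Y g1 g2 h1 h2 e1 e2.
move: (enorm (x - y)) `|x - y| (enorm (X - Y)) `|X - Y|
  (enorm (cube_to_ball X - cube_to_ball Y)) `|cube_to_ball X - cube_to_ball Y|
  g1 g2 h1 h2 e1 e2 e3 e4 e5 => a b c d e f g1 g2 h1 h2 e1 e2 e3 e4 e5.
apply/andP; split; last by nra.
by rewrite mulrC ler_pdivrMr ?mulr_gt0//; nra.
Qed.

(** A union of segments issued from the origin. *)
Lemma connected_unit_ball : connected (@unit_ball R).
Proof.
have -> : @unit_ball R = \bigcup_(x in unit_ball) ((fun t : R => t *: x) @` `[0, 1]).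
  apply/seteqP; split => [x Bx|x [y By [t]]].
    by exists x => //; exists 1; rewrite ?scale1r//= in_itv/= ler01 lexx.
  rewrite /= in_itv/= => /andP[t0 t1] <-; move: By; rewrite /unit_ball/=.
  have [_ hom _ _] := @enorm_is_norm R; rewrite hom; rewrite ger0_norm// => yB.
  by apply: le_lt_trans yB; rewrite ler_piMl// enorm_ge0.
apply: bigcup_connected.
  by exists 0 => x Bx; exists 0; rewrite ?scale0r//= in_itv/= ler01 lexx.
move=> x Bx; apply: connected_continuous_connected; first exact: segment_connected.
by apply: continuous_subspaceT => t; exact: scalel_continuous.
Qed.

Lemma cellar_domain : domain cellar.
Proof.
split; [|exact: open_cellar|].
  have h : 0 < (2^-1 : R) by lra.
  have h1 : (2^-1 : R) < 1 by lra.
  by exists (0, 0, 2^-1); split; rewrite /= ?normr0 ?(gtr0_norm h)//; left.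
rewrite (_ : cellar = ball_to_cellar @` unit_ball).
  by apply: connected_continuous_connected connected_unit_ball _.
apply/seteqP; split => [x Ox|_ [y By <-]]; last exact: ball_to_cellarP.
exists (cellar_to_ball x); last exact: cellar_to_ballK.
by rewrite /unit_ball/= enorm_cube_to_ball; exact: cellar_to_cubeP.
Qed.

End cellar.

(** * A fat Cantor set and its gaps *)

Section cantor.
Context {R : realType}.
Variable p : R.
Hypothesis p1 : 1 < p.
Implicit Types (k j : nat) (f : R -> R).

(** A zone of generation 0 is the whole interval ]-1/2, 1/2[; a gap is removed from
    the middle of each zone of generation k, and the two remaining halves are the
    zones of generation k + 1. The 2^k gaps of generation k have total length
    width k; halving kap, whose sum is 1, leaves a Cantor set of positive measure,
    and the power p - 1 is the critical one: with channels of length comparable to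
    dyad k, the sum of width k * (dyad k)^(1 - p) converges, while
    (dyad k)^(r - 1) / width k tends to 0 as soon as r > p. *)
Definition dyad k : R := 2^-1 ^+ k.
Definition kap k : R := k.+1%:R^-1 - k.+2%:R^-1.
Definition width k : R := 2^-1 * kap k * dyad k `^ (p - 1).
Definition zone_mass k : R := 1 - \sum_(j < k) width j.
Definition zone_size k : R := dyad k * zone_mass k.
Definition gap_size k : R := dyad k * width k.
Definition shift k : R := (zone_size k - zone_size k.+1) / 2.
Definition thick k : R := dyad k / 4.

Lemma dyad_gt0 k : 0 < dyad k.
Proof. by rewrite exprn_gt0. Qed.

Lemma dyad_le1 k : dyad k <= 1.
Proof. by rewrite exprn_ile1//; lra. Qed.

Lemma dyadS k : dyad k.+1 = dyad k / 2.
Proof. by rewrite /dyad exprSr. Qed.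

Lemma dyad_nincr k j : (k <= j)%N -> dyad j <= dyad k.
Proof.
by move=> kj; rewrite /dyad ler_wiXn2l//; lra.
Qed.

Lemma kap_gt0 k : 0 < kap k.
Proof. by rewrite subr_gt0 ltf_pV2 ?posrE// ltr_nat. Qed.

Lemma sum_kap k : \sum_(j < k) kap j = 1 - k.+1%:R^-1.
Proof.
elim: k => [|k IH]; first by rewrite big_ord0 invr1 subrr.
by rewrite big_ord_recr /= IH /kap addrA subrK.
Qed.

Lemma width_gt0 k : 0 < width k.
Proof. by rewrite !mulr_gt0 ?kap_gt0 ?powR_gt0 ?dyad_gt0. Qed.

Lemma width_le k : width k <= kap k / 2.
Proof.
have : dyad k `^ (p - 1) <= 1.
  apply: (@le_trans _ _ (1 `^ (p - 1))); last by rewrite powR1.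
  apply: ge0_ler_powR; rewrite ?nnegrE ?ler01 ?subr_ge0 ?(ltW p1)//.
    exact/ltW/dyad_gt0.
  exact: dyad_le1.
by rewrite /width; have := kap_gt0 k; nra.
Qed.

Lemma zone_massS k : zone_mass k.+1 = zone_mass k - width k.
Proof. by rewrite /zone_mass big_ord_recr /= opprD addrA. Qed.

(** Positive measure of the Cantor set: the zones of generation k are comparable
    in size to dyad k. *)
Lemma zone_mass_ge k : 2^-1 <= zone_mass k.
Proof.
have : \sum_(j < k) width j <= \sum_(j < k) (kap j / 2).
  by apply: ler_sum => j _; exact: width_le.
rewrite -mulr_suml sum_kap /zone_mass => h.
have h1 : 0 < k.+1%:R^-1 :> R by rewrite invr_gt0.
by move: (\sum_(j < k) _) (k.+1%:R^-1) h h1 => x y h h1; lra.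
Qed.

Lemma zone_mass_le k : zone_mass k <= 1.
Proof.
by rewrite /zone_mass gerBl sumr_ge0// => j _; rewrite ltW// width_gt0.
Qed.

Lemma gap_sizeE k : gap_size k = zone_size k - 2 * zone_size k.+1.
Proof. by rewrite /gap_size /zone_size zone_massS dyadS; field. Qed.

Lemma gap_sizeM k : gap_size k = dyad k * width k.
Proof. by []. Qed.

Lemma gap_size_gt0 k : 0 < gap_size k.
Proof. by rewrite mulr_gt0 ?dyad_gt0 ?width_gt0. Qed.

Lemma zone_size_gt0 k : 0 < zone_size k.
Proof. by rewrite mulr_gt0 ?dyad_gt0//; apply: lt_le_trans (zone_mass_ge k); lra. Qed.

Lemma zone_size_le k : zone_size k <= dyad k.
Proof. by rewrite /zone_size ler_piMr ?zone_mass_le// ltW// dyad_gt0. Qed.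

Lemma zone_size_ge k : dyad k / 2 <= zone_size k.
Proof. by rewrite /zone_size ler_wpM2l ?zone_mass_ge// ltW// dyad_gt0. Qed.

Lemma zone_size0 : zone_size 0 = 1.
Proof. by rewrite /zone_size /dyad expr0 mul1r /zone_mass big_ord0 subr0. Qed.

Lemma thick_gt0 k : 0 < thick k.
Proof. by rewrite divr_gt0 ?dyad_gt0. Qed.

Lemma thick_le k : thick k <= 4^-1.
Proof. by rewrite /thick; have := dyad_le1 k; lra. Qed.

Lemma thick_nincr k j : (k <= j)%N -> thick j <= thick k.
Proof. by move=> kj; rewrite /thick ler_pM2r ?dyad_nincr. Qed.

(** Up to sign, fold k x is the offset of x from the centre of the zone of
    generation k nearest to it: folding the line at these centres identifies
    all the zones. *)
Fixpoint fold k (x : R) : R :=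
  if k is j.+1 then `|fold j x| - shift j else x.

Definition zone k : set R := [set x | `|fold k x| < zone_size k / 2].
Definition gap k : set R := [set x | `|fold k x| < gap_size k / 2].

Lemma zoneE k x : zone k x = (`|fold k x| < zone_size k / 2) :> Prop.
Proof. by []. Qed.

Lemma gapE k x : gap k x = (`|fold k x| < gap_size k / 2) :> Prop.
Proof. by []. Qed.

Lemma continuous_fold k : continuous (fold k).
Proof.
elim: k => [|k IH] x /=; first exact: cvg_id.
apply: cvgB; last exact: cvg_cst.
by apply: cvg_norm; exact: IH.
Qed.

Let open_abs_lt (g : R -> R) (c : R) : continuous g -> open [set x | `|g x| < c].
Proof.
move=> cg; rewrite (_ : mkset _ = g @^-1` [set t | `|0 - t| < c]).
  apply: open_comp; first by move=> x _; exact: cg.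
  by have := @ball_open _ R 0 c; rewrite -ball_normE.
by apply/seteqP; split => x /=; rewrite sub0r normrN.
Qed.

Lemma open_zone k : open (zone k).
Proof. exact/open_abs_lt/continuous_fold. Qed.

Lemma open_gap k : open (gap k).
Proof. exact/open_abs_lt/continuous_fold. Qed.

Lemma zoneS k x : zone k.+1 x -> gap_size k / 2 < `|fold k x| /\ zone k x.
Proof.
rewrite /zone /= ltr_norml /shift; have := gap_sizeE k; have := zone_size_gt0 k.+1.
by move=> h1 h2 /andP[h3 h4]; split; lra.
Qed.

Lemma gap_zone k : gap k `<=` zone k.
Proof.
move=> x; rewrite /gap /zone /= => h; apply: lt_trans h _.
by have := gap_sizeE k; have := zone_size_gt0 k.+1; lra.
Qed.

Lemma zone_nincr k j : (k <= j)%N -> zone j `<=` zone k.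
Proof.
elim: j => [|j IH]; first by rewrite leqn0 => /eqP ->.
rewrite leq_eqVlt => /predU1P[->//|]; rewrite ltnS => /IH kj x /zoneS [_].
exact: kj.
Qed.

Lemma zone_gap_disjoint k j x : (j < k)%N -> zone k x -> ~ gap j x.
Proof.
move=> jk /(zone_nincr jk) /zoneS [h _]; rewrite /gap /= => h'.
by move: (lt_trans h h'); rewrite ltxx.
Qed.

Lemma gap_inj k j x : gap k x -> gap j x -> k = j.
Proof.
move=> gk gj; have [kj|jk|//] := ltngtP k j.
  by have := zone_gap_disjoint kj (gap_zone gj).
by have := zone_gap_disjoint jk (gap_zone gk).
Qed.

Lemma zone_bound k x : zone k x -> `|x| < 2^-1.
Proof. by move=> /(zone_nincr (leq0n k)); rewrite /zone/= zone_size0 mul1r. Qed.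

Lemma measurable_fold_preimage k (A : set R) : open A ->
  measurable ([set x | A (fold k x)] : set (measurableTypeR R)).
Proof.
move=> oA; apply: open_measurable; apply: open_comp oA => x _.
exact: continuous_fold.
Qed.

(** fold k is 2^k to one and piecewise of slope 1 or -1. *)
Lemma measure_fold k (a b : R) : a <= b ->
  (leb R [set x | (a < fold k x < b)%R] <= (2 ^+ k * (b - a))%:E)%E.
Proof.
have mI j (c d : R) : measurable ([set x | (c < fold j x < d)%R] : set (measurableTypeR R)).
  have -> : [set x | c < fold j x < d] = [set x | `]c, d[%classic (fold j x)].
    by apply/seteqP; split => x /=; rewrite in_itv.
  by apply: measurable_fold_preimage; exact: interval_open.
elim: k a b => [|k IH] a b ab.
  have -> : [set x | a < fold 0 x < b] = `]a, b[%classic.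
    by apply/seteqP; split => x /=; rewrite in_itv.
  rewrite lebesgue_measure_itv/= lte_fin expr0 mul1r; case: ifP => _ //.
  by rewrite lee_fin subr_ge0.
apply: (@le_trans _ _ (leb R ([set x | (a + shift k < fold k x < b + shift k)%R] `|`
    [set x | (- (b + shift k) < fold k x < - (a + shift k))%R]))).
  apply: le_measure; rewrite ?inE; [exact: mI|apply: measurableU; exact: mI|].
  move=> x /= /andP[h1 h2]; have [h|h] := leP 0 (fold k x).
    by left; rewrite ger0_norm// in h1 h2; apply/andP; split; lra.
  by right; rewrite ltr0_norm// in h1 h2; apply/andP; split; lra.
apply: le_trans (measureU2 _ (mI _ _ _) (mI _ _ _)) _.
apply: (@le_trans _ _ ((2 ^+ k * (b - a))%:E + (2 ^+ k * (b - a))%:E)%E).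
  apply: leeD.
    by apply: le_trans (IH _ _ _) _; [lra|rewrite lee_fin (_ : _ - _ = b - a)//; ring].
  by apply: le_trans (IH _ _ _) _; [lra|rewrite lee_fin (_ : _ - _ = b - a)//; ring].
by rewrite -EFinD lee_fin exprS; lra.
Qed.

Lemma measurable_gap k : measurable (gap k : set (measurableTypeR R)).
Proof. by apply: open_measurable; exact: open_gap. Qed.

Lemma measure_gap k : (leb R (gap k) <= (width k)%:E)%E.
Proof.
have g0 := gap_size_gt0 k.
have -> : gap k = [set x | - (gap_size k / 2) < fold k x < gap_size k / 2].
  by apply/seteqP; split => x; rewrite /gap /= ltr_norml.
apply: le_trans (measure_fold _ _) _; first by lra.
rewrite lee_fin (_ : _ - _ = gap_size k); last by field.
by rewrite /gap_size /dyad mulrA -exprMn divff// expr1n mul1r.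
Qed.

(** Superposition of the translates of f to the centres of the 2^k zones of
    generation k. *)
Fixpoint spread k f : R -> R :=
  if k is j.+1 then spread j (fun t => f (t - shift j) + f (t + shift j)) else f.

Let Cn_shift n f (c : R) : Cn n f -> Cn n (fun t => f (t + c)).
Proof.
move=> cf; have := Cn_affine 1 c cf.
by rewrite (_ : (fun x => f (1 * x + c)) = fun t => f (t + c))//; apply/funext => t; rewrite mul1r.
Qed.

Lemma spread_smooth k f : smooth1 f -> smooth1 (spread k f).
Proof.
elim: k f => [|k IH] f sf //=; apply: IH => n.
by apply: CnD; exact: Cn_shift.
Qed.

Lemma is_derive_shift1 f (c t : R) : smooth1 f ->
  is_derive t 1 (fun t => f (t + c)) (derive1 f (t + c)).
Proof.
move=> sf; have h : is_derive (1 * t + c) 1 f (derive1 f (1 * t + c)).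
  exact: smooth1_is_derive.
have := is_derive_affine h; rewrite mulr1 mul1r.
by under eq_fun do rewrite mul1r.
Qed.

Lemma derive1_spread k f : smooth1 f -> derive1 (spread k f) = spread k (derive1 f).
Proof.
elim: k f => [|k IH] f sf //=; rewrite IH; last first.
  by move=> n; apply: CnD; exact: Cn_shift.
congr (spread k _); apply/funext => t; rewrite derive1E.
by have [] := is_deriveD (is_derive_shift1 (- shift k) t sf) (is_derive_shift1 (shift k) t sf).
Qed.

Lemma spreadB k f (g : R -> R) :
  spread k (fun t => f t - g t) = (fun t => spread k f t - spread k g t).
Proof.
elim: k f g => [|k IH] f g //=; rewrite -IH; congr (spread k _).
by apply/funext => t; ring.
Qed.

(** The translates do not overlap when f is supported in a zone; fold k brings each
    of them back to f, up to reflection. *)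
Lemma spread_supp k f x : (forall t, f t != 0 -> `|t| < zone_size k / 2) ->
  spread k f x != 0 -> exists2 t, f t != 0 & `|t| = `|fold k x|.
Proof.
elim: k f => [|k IH] f fz /=; first by move=> h; exists x.
have zk := zone_size_gt0 k.+1; have gk := gap_size_gt0 k; have gE := gap_sizeE k.
have sE : shift k = (zone_size k.+1 + gap_size k) / 2 by rewrite /shift; lra.
move=> /IH [t ht|t].
  have [h|h] := eqVneq (f (t - shift k)) 0.
    rewrite h add0r in ht; have := fz _ ht; rewrite !ltr_norml => /andP[? ?].
    by apply/andP; split; lra.
  have := fz _ h; rewrite !ltr_norml => /andP[? ?].
  by apply/andP; split; lra.
move=> ht tx; have [h|h] := eqVneq (f (t - shift k)) 0.
  rewrite h add0r in ht; have := fz _ ht; rewrite ltr_norml => /andP[h1 h2].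
  exists (t + shift k) => //.
  have t0 : t < 0 by lra.
  by rewrite -tx (ltr0_norm t0) -normrN opprD.
exists (t - shift k) => //; have := fz _ h; rewrite ltr_norml => /andP[h1 h2].
have t0 : 0 < t by lra.
by rewrite -tx (gtr0_norm t0).
Qed.

Lemma spread_bound k f (M : R) : (forall t, f t != 0 -> `|t| < zone_size k / 2) ->
  (forall t, `|f t| <= M) -> forall x, `|spread k f x| <= M.
Proof.
elim: k f => [|k IH] f fz fM //=.
have zk := zone_size_gt0 k.+1; have gk := gap_size_gt0 k; have gE := gap_sizeE k.
have sE : shift k = (zone_size k.+1 + gap_size k) / 2 by rewrite /shift; lra.
apply: IH => t.
  move=> ht; have [h|h] := eqVneq (f (t - shift k)) 0.
    rewrite h add0r in ht; have := fz _ ht; rewrite !ltr_norml => /andP[? ?].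
    by apply/andP; split; lra.
  have := fz _ h; rewrite !ltr_norml => /andP[? ?].
  by apply/andP; split; lra.
have [h|h] := eqVneq (f (t - shift k)) 0; first by rewrite h add0r.
have [h'|h'] := eqVneq (f (t + shift k)) 0; first by rewrite h' addr0.
by have := fz _ h; have := fz _ h'; rewrite !ltr_norml => /andP[? ?] /andP[? ?]; lra.
Qed.

(** To the right of all the centres, every one of the 2^k translates has reached
    the constant value c. *)
Lemma spread_right k f (c a : R) : (forall t, a <= t -> f t = c) ->
  forall t, a + (1 - zone_size k) / 2 <= t -> spread k f t = 2 ^+ k * c.
Proof.
elim: k f c a => [|k IH] f c a fa t /=.
  by rewrite zone_size0 subrr mul0r addr0 expr0 mul1r; exact: fa.
move=> ht; rewrite (IH _ (2 * c) (a + shift k)).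
- by rewrite exprSr mulrA.
- move=> s hs; rewrite !fa ?mulr2n ?mulrDl ?mul1r//.
  + have := zone_size_gt0 k.+1; have := gap_size_gt0 k; have := gap_sizeE k.
    rewrite /shift in hs *; lra.
  + lra.
- by rewrite /shift; lra.
Qed.

Lemma spread_left k f (c a : R) : (forall t, t <= a -> f t = c) ->
  forall t, t <= a - (1 - zone_size k) / 2 -> spread k f t = 2 ^+ k * c.
Proof.
elim: k f c a => [|k IH] f c a fa t /=.
  by rewrite zone_size0 subrr mul0r subr0 expr0 mul1r; exact: fa.
move=> ht; rewrite (IH _ (2 * c) (a - shift k)).
- by rewrite exprSr mulrA.
- move=> s hs; rewrite !fa ?mulr2n ?mulrDl ?mul1r//.
  + lra.
  + have := zone_size_gt0 k.+1; have := gap_size_gt0 k; have := gap_sizeE k.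
    rewrite /shift in hs *; lra.
- by rewrite /shift; lra.
Qed.

End cantor.

(** * Lebesgue spaces on bounded open sets *)

Section Lp_facts.
Context {R : realType}.
Implicit Types (Omega : set (R3 R)) (f : R3 R -> R) (r : R).

Notation mu3 := (leb3 R).

Lemma integral_pow_restrict Omega f r : 0 < r ->
  (\int[mu3]_x (`|(f \_ Omega) x| `^ r)%:E =
   \int[mu3]_(x in Omega) (`|f x| `^ r)%:E)%E.
Proof.
move=> r0; rewrite [RHS]integral_mkcond; apply: eq_integral => x _.
rewrite !patchE; case: ifP => // _.
by rewrite normr0 powR0 ?gt_eqF.
Qed.

Lemma Lp_on_finP Omega f r : 0 < r -> open Omega ->
  Lp_on Omega r%:E f <-> measurable_fun (Omega : set (T3 R)) (f : T3 R -> R) /\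
   (\int[mu3]_(x in Omega) (`|f x| `^ r)%:E < +oo)%E.
Proof.
move=> r0 oO; have mO := open_measurable3 oO.
have nE : ('N[mu3]_(r%:E) [EFin \o f \_ Omega] =
    (\int[mu3]_(x in Omega) (`|f x| `^ r)%:E) `^ r^-1)%E.
  by rewrite unlock /Lnorm -integral_pow_restrict.
split.
  rewrite /Lp_on /= inE => /andP[]; rewrite !inE /= => mf; rewrite /finite_norm nE => fin.
  split; first by apply/(measurable_restrictT _ mO).
  by apply: (@lty_poweRy _ _ r^-1) => //; rewrite invr_neq0// gt_eqF.
move=> [mf fin]; rewrite /Lp_on /= inE; apply/andP; split; rewrite inE /=.
  by apply/(measurable_restrictT _ mO).
by rewrite /finite_norm nE poweR_lty.
Qed.

Lemma open_measure_cube3 Omega (M : R) : 0 < M -> open Omega -> Omega `<=` cube3 M ->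
  (mu3 Omega <= ((2 * M) ^+ 3)%:E)%E.
Proof.
move=> M0 oO OM; rewrite -(measure_cube3 M0); apply: le_measure; rewrite ?inE//.
  exact: open_measurable3.
exact: measurable_cube3.
Qed.

Lemma integral_pow_bounded Omega f r (M C : R) : 0 < M -> open Omega -> Omega `<=` cube3 M ->
  0 <= r -> (forall x, Omega x -> `|f x| <= C) ->
  (\int[mu3]_(x in Omega) (`|f x| `^ r)%:E <= (C `^ r * (2 * M) ^+ 3)%:E)%E.
Proof.
move=> M0 oO OM r0 fC; have mO := open_measurable3 oO.
apply: (@le_trans _ _ (\int[mu3]_(x in Omega) (C `^ r)%:E)%E).
  apply: le_integral_ge0 => // x Ox; rewrite lee_fin ?powR_ge0//.
  have := fC x Ox => fxC; apply: ge0_ler_powR => //; rewrite nnegrE//.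
  exact: le_trans fxC.
rewrite integral_cst// EFinM; apply: lee_wpmul2l; first by rewrite lee_fin powR_ge0.
exact: open_measure_cube3.
Qed.

(** The case of an infinite exponent is thereby reduced to that of finite ones. *)
Lemma Lp_on_downgrade Omega f (p M : R) (q : \bar R) : 0 < M -> open Omega ->
  Omega `<=` cube3 M -> 1 < p -> (p%:E < q)%E -> Lp_on Omega q f ->
  exists r N : R, [/\ p < r, 0 <= N &
    (\int[mu3]_(x in Omega) (`|f x| `^ r)%:E <= N%:E)%E].
Proof.
move=> M0 oO OM p1; have mO := open_measurable3 oO.
case: q => [r| |//].
  rewrite lte_fin => pr /Lp_on_finP; case=> //; first by lra.
  move=> _ fin; exists r.
  exists (fine (\int[mu3]_(x in Omega) (`|f x| `^ r)%:E)%E).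
  have I0 : (0 <= \int[mu3]_(x in Omega) (`|f x| `^ r)%:E)%E.
    by apply: integral_ge0 => x _; rewrite lee_fin powR_ge0.
  split => //; first exact: fine_ge0.
  by rewrite fineK// ge0_fin_numE.
move=> _; rewrite /Lp_on /= inE => /andP[]; rewrite !inE /= => mf.
rewrite /finite_norm unlock /Lnorm.
case: ifPn => [muT|]; last first.
  rewrite -leNgt => mu0; have : (mu3 (cube3 1) <= 0)%E.
    apply: le_trans mu0; apply: le_measure; rewrite ?inE//.
    exact: measurable_cube3.
  by rewrite [X in (X <= _)%E](measure_cube3 ltr01) lee_fin leNgt exprn_gt0// mulr_gt0.
move=> /ess_supr_bounded [B hB].
(* For q infinite any exponent above p would do. *)
exists (p + 1), (`|B| `^ (p + 1) * (2 * M) ^+ 3); split.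
- by rewrite ltrDl.
- by rewrite mulr_ge0 ?powR_ge0// exprn_ge0// mulr_ge0// ltW.
apply: (@le_trans _ _ (\int[mu3]_(x in Omega) (`|B| `^ (p + 1))%:E)%E).
  have mfO : measurable_fun (Omega : set (T3 R)) (f : T3 R -> R).
    by apply/(measurable_restrictT _ mO).
  have mp : measurable_fun (Omega : set (T3 R)) (fun x : T3 R => (`|f x| `^ (p + 1))%:E).
    apply/measurable_EFinP; apply: (measurableT_comp (f := fun t : R => t `^ (p + 1))) => //.
    exact: measurableT_comp.
  have B0 x : Omega x -> (0 <= (`|B| `^ (p + 1))%:E)%E by rewrite lee_fin powR_ge0.
  have f0 x : Omega x -> (0 <= (`|f x| `^ (p + 1))%:E)%E by rewrite lee_fin powR_ge0.
  apply: (ae_ge0_le_integral mO f0 mp B0) => //.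
  apply: filterS hB => x /= hx Ox; rewrite lee_fin.
  apply: ge0_ler_powR; rewrite ?nnegrE//; first by lra.
  by move: hx; rewrite patchE mem_set// => hx; apply: le_trans hx (ler_norm _).
rewrite integral_cst// EFinM; apply: lee_wpmul2l; first by rewrite lee_fin powR_ge0.
exact: open_measure_cube3.
Qed.

End Lp_facts.

(** * The maze, and the function jumping across its wall *)

Section step.
Context {R : realType}.
Variable p : R.
Hypothesis p1 : 1 < p.

Notation mu3 := (leb3 R).
Notation zone := (zone p).
Notation gap := (gap p).
Notation width := (width p).
Implicit Types (x : R3 R).

(** Two rooms, separated by the Cantor set placed on the segment where a.2 = 0. Its
    gaps are the mouths of channels from one room to the other: at both ends of a
    gap of generation k stands a barrier of height thick k. *)
Definition maze : set (R * R) :=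
  [set a | [/\ `|a.1| < 2^-1, `|a.2| < 1 &
    a.2 < 0 \/ exists k, (zone k a.1 /\ thick k < a.2) \/ gap k a.1]].

Definition at_gap {T} (F : nat -> T) (c : T) (a : R) : T :=
  if pselect (exists k, gap k a) is left e then F (projT1 (cid e)) else c.

Lemma at_gapE T (F : nat -> T) (c : T) a k : gap k a -> at_gap F c a = F k.
Proof.
move=> ka; rewrite /at_gap; case: pselect => [e|[]]; last by exists k.
by case: cid => j /= ja; rewrite (gap_inj p1 ja ka).
Qed.

Lemma at_gapN T (F : nat -> T) (c : T) a : (forall k, ~ gap k a) -> at_gap F c a = c.
Proof. by move=> na; rewrite /at_gap; case: pselect => [[k ka]|//]; have := na k. Qed.

(** The planar step: 0 below the wall, 1 above it, and a transition across each
    channel. The default value 0 or 1 is used off the gaps only. *)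
Definition u0 (a b : R) : R :=
  at_gap (fun k => stp (b / thick k)) (if 0 < b then 1 else 0) a.
Definition u0y (a b : R) : R :=
  at_gap (fun k => derive1 stp (b / thick k) / thick k) 0 a.
(** Cuts u off below the floor z = 0 of the upper half box, where the two rooms
    communicate freely. *)
Definition upper (z : R) : R := stp (- z).

Definition u x : R := u0 x.1.1 x.1.2 * upper x.2.
Definition uy x : R := u0y x.1.1 x.1.2 * upper x.2.
Definition uz x : R := u0 x.1.1 x.1.2 * derive1 upper x.2.
Definition ugrad (i : 'I_3) : R3 R -> R :=
  if i == 0 :> nat then fun=> 0 else if i == 1%N :> nat then uy else uz.

Definition Omega : set (R3 R) := cellar maze.

Lemma maze_box a : maze a -> `|a.1| < 2^-1 /\ `|a.2| < 1.
Proof. by case. Qed.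

Lemma open_maze : open maze.
Proof.
have c1 : continuous (fun a : R * R => a.1) by move=> a; exact: cvg_fst.
have c2 : continuous (fun a : R * R => a.2) by move=> a; exact: cvg_snd.
have absl (g : R * R -> R) (c : R) : continuous g -> open [set a | `|g a| < c].
  move=> cg; rewrite (_ : mkset _ = g @^-1` [set t | `|0 - t| < c]).
    apply: open_comp; first by move=> x _; exact: cg.
    by have := @ball_open _ R 0 c; rewrite -ball_normE.
  by apply/seteqP; split => x /=; rewrite sub0r normrN.
have ofst (A : set R) : open A -> open ((fun a : R * R => a.1) @^-1` A).
  by move=> oA; apply: open_comp => // a _; exact: c1.
rewrite (_ : maze = [set a | `|a.1| < 2^-1] `&` [set a | `|a.2| < 1] `&`
  ([set a | a.2 < 0] `|` \bigcup_k (((fun a => a.1) @^-1` (zone k) `&` [set a | thick k < a.2]) `|`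
     (fun a => a.1) @^-1` (gap k)))).
  apply: openI; first by apply: openI; exact: absl.
  apply: openU.
    by apply: (open_comp (f := fun a : R * R => a.2) (D := [set t | t < 0])) => [x _|]; [exact: c2|exact: open_lt].
  apply: bigcup_open => k _; apply: openU.
    apply: openI; first by apply: ofst; exact: open_zone.
    by apply: (open_comp (f := fun a : R * R => a.2) (D := [set t | thick k < t])) => [x _|]; [exact: c2|exact: open_gt].
  by apply: ofst; exact: open_gap.
apply/seteqP; split => [a [h1 h2 [h3|[k h3]]]|a [[h1 h2] [h3|[k _ h3]]]].
- by split=> //; left.
- by split=> //; right; exists k.
- by split=> //; left.
- by split=> //; right; exists k.
Qed.

Lemma open_Omega : open Omega.
Proof. exact: open_cellar open_maze. Qed.

Lemma Omega_cube : Omega `<=` cube3 1.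
Proof.
move=> x [h1 h2 h3 _].
have h (t : R) : `|t| < 1 -> `[-1, 1]%classic t.
  by rewrite ltr_norml /= in_itv/= => /andP[? ?]; apply/andP; split; exact: ltW.
by split=> /=; [split=> /=|]; apply: h => //; apply: lt_trans h1 _; lra.
Qed.

Lemma upper_smooth : smooth1 upper.
Proof.
move=> n; have := Cn_affine (-1) 0 (@stp_smooth R n).
by rewrite (_ : (fun x : R => stp (-1 * x + 0)) = upper)//; apply/funext => t; rewrite mulN1r addr0.
Qed.

Lemma derive1_upper z : derive1 upper z = - derive1 stp (- z).
Proof.
have h : is_derive (-1 * z + 0) 1 stp (derive1 stp (-1 * z + 0)).
  exact: smooth1_is_derive stp_smooth _.
have := is_derive_affine h; rewrite mulrN1 mulN1r addr0.
under eq_fun do rewrite mulN1r addr0.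
by move=> -[_ <-]; rewrite derive1E.
Qed.

Lemma stp_scale_smooth (l : R) : smooth1 (fun t : R => stp (t / l)).
Proof.
move=> n; have := Cn_affine l^-1 0 (@stp_smooth R n).
by rewrite (_ : (fun x : R => stp (l^-1 * x + 0)) = fun t => stp (t / l))//; apply/funext => t; rewrite addr0 mulrC.
Qed.

Lemma derive1_stp_scale (l t : R) :
  derive1 (fun t : R => stp (t / l)) t = derive1 stp (t / l) / l.
Proof.
have h : is_derive (l^-1 * t + 0) 1 stp (derive1 stp (l^-1 * t + 0)).
  exact: smooth1_is_derive stp_smooth _.
have := is_derive_affine h; rewrite addr0 [l^-1 * t]mulrC.
under eq_fun do rewrite addr0 mulrC.
by move=> -[_ <-]; rewrite derive1E.
Qed.

Lemma smooth1_cst (c : R) : smooth1 (fun=> c).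
Proof. by move=> n; exact: Cn_cst. Qed.

Lemma derive1_cst0 (c : R) : derive1 (fun=> c : R) = fun=> 0 :> R.
Proof. by apply/funext => t; rewrite derive1E derive_cst. Qed.

Lemma near_fst (A : set R) x : open A -> A x.1.1 -> \forall y \near x, A y.1.1.
Proof.
move=> oA Ax; apply: (@open_nbhs_nbhs _ x ((fun y : R3 R => y.1.1) @^-1` A)).
split => //; apply: open_comp oA => y _.
by apply: (continuous_comp (f := fst) (g := fst)); exact: cvg_fst.
Qed.

Lemma near_snd (A : set R) x : open A -> A x.1.2 -> \forall y \near x, A y.1.2.
Proof.
move=> oA Ax; apply: (@open_nbhs_nbhs _ x ((fun y : R3 R => y.1.2) @^-1` A)).
split => //; apply: open_comp oA => y _.
by apply: (continuous_comp (f := fst) (g := snd)); [exact: cvg_fst|exact: cvg_snd].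
Qed.

Lemma near_last (A : set R) x : open A -> A x.2 -> \forall y \near x, A y.2.
Proof.
move=> oA Ax; apply: (@open_nbhs_nbhs _ x ((fun y : R3 R => y.2) @^-1` A)).
by split => //; apply: open_comp oA => y _; exact: cvg_snd.
Qed.

Lemma u0_below a b : b <= 0 -> u0 a b = 0 /\ u0y a b = 0.
Proof.
move=> b0; rewrite /u0 /u0y; have [[k ka]|na] := pselect (exists k, gap k a).
  rewrite !(at_gapE _ _ ka).
  have h : b / thick k <= 0 by rewrite pmulr_lle0 ?invr_gt0 ?thick_gt0.
  by rewrite stp0 ?derive1_stp0 ?mul0r//; lra.
rewrite !at_gapN ?ltNge ?b0//; by move=> k ka; apply: na; exists k.
Qed.

Lemma u0_above k a b : zone k a -> thick k < b -> u0 a b = 1 /\ u0y a b = 0.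
Proof.
move=> za kb; have b0 : 0 < b := lt_trans (thick_gt0 k) kb.
rewrite /u0 /u0y; have [[j ja]|na] := pselect (exists k, gap k a).
  rewrite !(at_gapE _ _ ja).
  have kj : (k <= j)%N by rewrite leqNgt; apply/negP => jk; exact: (zone_gap_disjoint p1 jk za ja).
  have h : 1 <= b / thick j.
    by rewrite ler_pdivlMr ?thick_gt0// mul1r (le_trans (thick_nincr kj))// ltW.
  by rewrite stp1 ?derive1_stp1 ?mul0r//; lra.
rewrite !at_gapN ?b0//; by move=> j ja; apply: na; exists j.
Qed.

(** Near every point of the domain u depends smoothly on the last two
    coordinates and not at all on the first one. *)
Lemma u_local x : Omega x -> exists2 g : R -> R, smooth1 g &
  \forall y \near x, [/\ u y = tensor (fun=> 1) g upper y,
    uy y = tensor (fun=> 1) (derive1 g) upper y &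
    uz y = tensor (fun=> 1) g (derive1 upper) y].
Proof.
rewrite /u /uy /uz /tensor => -[h1 h2 h3 [h4|[_ _ [h4|[k [[zk tk]|gk]]]]]].
- exists (fun=> 0); first exact: smooth1_cst.
  have := near_last (A := [set t | 0 < t]) (@open_gt R _) h4.
  apply: filterS => y /= y0; rewrite derive1_upper /upper stp0 ?derive1_stp0; [|lra|lra].
  by rewrite derive1_cst0 !(mul0r, mulr0, oppr0).
- exists (fun=> 0); first exact: smooth1_cst.
  have := near_snd (A := [set t | t < 0]) (@open_lt R _) h4.
  apply: filterS => y /= y0; have [-> ->] := u0_below y.1.1 (ltW y0).
  by rewrite derive1_cst0 !(mul0r, mulr0).
- exists (fun=> 1); first exact: smooth1_cst.
  have n1 := near_snd (A := [set t | thick k < t]) (@open_gt R _) tk.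
  have n2 := near_fst (@open_zone R p k) zk.
  near=> y; have [-> ->] : u0 y.1.1 y.1.2 = 1 /\ u0y y.1.1 y.1.2 = 0.
    by apply: (@u0_above k); near: y.
  by rewrite derive1_cst0 !(mul0r, mulr0, mul1r).
- exists (fun t => stp (t / thick k)); first exact: stp_scale_smooth.
  have := near_fst (@open_gap R p k) gk.
  apply: filterS => y yk.
  by rewrite /u0 /u0y !(at_gapE _ _ yk) derive1_stp_scale !mul1r.
Unshelve. all: by end_near. Qed.

Let near_continuous (f g : R3 R -> R) x : {near x, f =1 g} -> {for x, continuous g} ->
  {for x, continuous f}.
Proof.
move=> fg cg; rewrite /prop_for /continuous_at (nbhs_singleton fg).
apply: cvg_trans cg; apply: near_eq_cvg; near=> y; apply/esym; near: y; exact: fg.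
Unshelve. all: by end_near. Qed.

Lemma u_continuous x : Omega x ->
  [/\ {for x, continuous u}, {for x, continuous uy} & {for x, continuous uz}].
Proof.
move=> /u_local [g sg H]; have cg := smooth1_continuous sg.
have cg' := smooth1_continuous (smooth1_derive sg).
have cS := smooth1_continuous upper_smooth.
have cS' := smooth1_continuous (smooth1_derive upper_smooth).
have c1 := smooth1_continuous (smooth1_cst 1).
split.
- apply: (near_continuous (g := tensor (fun=> 1) g upper)); last exact: continuous_tensor.
  by apply: filterS H => y [].
- apply: (near_continuous (g := tensor (fun=> 1) (derive1 g) upper)); last exact: continuous_tensor.
  by apply: filterS H => y [].
- apply: (near_continuous (g := tensor (fun=> 1) g (derive1 upper))); last exact: continuous_tensor.
  by apply: filterS H => y [].
Qed.

Lemma u_weak_partial i : is_weak_partial Omega i u (ugrad i).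
Proof.
apply: weak_partial_classical; first exact: open_Omega.
- by move=> x /u_continuous[].
- move=> x /u_continuous [_ c1 c2]; rewrite /ugrad.
  by case: ifP => _; [exact: cst_continuous|case: ifP].
move=> x Ox; have [g sg H] := u_local Ox.
have := is_derive_tensor i x (smooth1_derivable (smooth1_cst 1)) (smooth1_derivable sg)
  (smooth1_derivable upper_smooth).
have -> : dtensor i (fun=> 1) g upper x = ugrad i x.
  have [_ e2 e3] := nbhs_singleton H.
  rewrite /ugrad /dtensor; case: i => [[|[|[|//]]] ?] /=.
  - by rewrite derive1_cst0 /tensor !mul0r.
  - by rewrite e2.
  - by rewrite e3.
apply: near_eq_is_derive; apply: filterS H => y [-> _ _] //.
Qed.

Lemma u0_ge0 a b : 0 <= u0 a b.
Proof.
rewrite /u0 /at_gap; case: pselect => [e|_]; first exact: stp_ge0.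
by case: ifP.
Qed.

Lemma u0_le1 a b : u0 a b <= 1.
Proof.
rewrite /u0 /at_gap; case: pselect => [e|_]; first exact: stp_le1.
by case: ifP.
Qed.

Lemma normM_le1 (s t K : R) : 0 <= s -> s <= 1 -> `|t| <= K -> `|s * t| <= K.
Proof.
move=> s0 s1 tK; rewrite normrM ger0_norm//; apply: le_trans tK.
by rewrite ler_piMl.
Qed.

Lemma Lp_on_bounded (f : R3 R -> R) (C : R) :
  (forall x, Omega x -> {for x, continuous f}) ->
  (forall x, Omega x -> `|f x| <= C) -> Lp_on Omega p%:E f.
Proof.
move=> cf fC; have p0 : 0 < p := lt_trans ltr01 p1.
apply/(Lp_on_finP _ p0 open_Omega); split.
  exact: open_continuous_measurable_fun3 open_Omega cf.
apply: le_lt_trans (integral_pow_bounded ltr01 open_Omega Omega_cube (ltW p0) fC) _.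
exact: ltry.
Qed.

Definition tube k : set (T3 R) := (gap k `*` `[0, thick k]) `*` `[-1, 1].

Lemma measurable_tube k : measurable (tube k).
Proof.
apply: measurableX; last exact: measurable_itv.
by apply: measurableX; [exact: measurable_gap|exact: measurable_itv].
Qed.

Lemma measure_tube k : (mu3 (tube k) <= (2 * (width k * thick k))%:E)%E.
Proof.
have mgt : measurable (gap k `*` `[0, thick k] : set (measurableTypeR R * measurableTypeR R)).
  by apply: measurableX; [exact: measurable_gap|exact: measurable_itv].
have -> : mu3 (tube k) = ((leb R \x leb R) (gap k `*` `[0%R, thick k]) * leb R `[(-1)%R, 1%R])%E.
  by apply: product_measure1E => //; exact: measurable_itv.
have -> : ((leb R \x leb R) (gap k `*` `[0%R, thick k]) = leb R (gap k) * leb R `[0%R, thick k])%E.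
  by apply: product_measure1E; [exact: measurable_gap|exact: measurable_itv].
have t0 := @thick_gt0 R k.
have -> : leb R `[-1, 1] = 2%:E.
  by rewrite measure_sym_itv// mulr1.
have -> : leb R `[0, thick k] = (thick k)%:E.
  by rewrite lebesgue_measure_itv/= lte_fin t0 -EFinB subr0.
rewrite mulrC [X in (_ <= X)%E]EFinM; apply: lee_wpmul2r; first by rewrite lee_fin.
rewrite [X in (_ <= X)%E]EFinM; apply: lee_wpmul2r.
  by rewrite lee_fin; exact: ltW t0.
by apply: measure_gap.
Qed.

(** The channels of generation k have total volume of order width k * thick k and
    the derivative is of order 1 / thick k there, so the choice of width k bounds
    the energy by a multiple of the sum of the kap k. *)
Lemma uy_Lp : Lp_on Omega p%:E uy.
Proof.
have p0 : 0 < p := lt_trans ltr01 p1.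
apply/(Lp_on_finP _ p0 open_Omega); split.
  by apply: (open_continuous_measurable_fun3 open_Omega) => x /u_continuous[].
have [K K1 HK] := @derive1_stp_bounded R.
have K0 : 0 <= K by lra.
pose c k : R := (K / thick k) `^ p.
have c0 k : 0 <= c k by exact: powR_ge0.
pose h k (x : T3 R) : \bar R := ((c k)%:E * (\1_(tube k) x)%:E)%E.
have h0 k x : (0 <= h k x)%E by rewrite /h mule_ge0// lee_fin.
have mh k : measurable_fun setT (h k).
  apply: measurable_funeM; apply/measurable_EFinP.
  exact: measurable_indic (measurable_tube k).
apply: (@le_lt_trans _ _ (\int[mu3]_x (\sum_(0 <= k <oo) h k x))%E).
  apply: le_integral_ge0 => //.
  - by move=> x _; apply: nneseries_ge0.
  move=> x Ox; have [[k ka]|na] := pselect (exists k, gap k x.1.1); last first.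
    rewrite /uy /u0y at_gapN ?mul0r ?normr0 ?powR0 ?gt_eqF ?nneseries_ge0//.
    by move=> k ka; apply: na; exists k.
  have [xt|xt] := pselect (0 <= x.1.2 <= thick k).
    apply: (@le_trans _ _ (h k x)).
      rewrite /h indicE mem_set ?mule1; last first.
        split; last first.
          by case: Ox => _ _ + _; rewrite ltr_norml /= in_itv/= => /andP[? ?]; rewrite !ltW.
        by split => //=; rewrite in_itv.
      rewrite lee_fin /c; apply: ge0_ler_powR; rewrite ?nnegrE//; first exact: ltW.
        by rewrite divr_ge0// ltW// thick_gt0.
      rewrite /uy mulrC; apply: normM_le1; [exact: stp_ge0|exact: stp_le1|].
      rewrite /u0y (at_gapE _ _ ka) normrM normfV [`|thick k|]gtr0_norm ?thick_gt0//.
      by rewrite ler_pM2r ?invr_gt0 ?thick_gt0.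
    have le_lim : (\sum_(0 <= j < k.+1) h j x <= \sum_(0 <= j <oo) h j x)%E.
      by apply: nneseries_lim_ge.
    apply: le_trans le_lim; rewrite big_nat_recr//= leeDr// sume_ge0//.
  rewrite (_ : uy x = 0); first by rewrite normr0 powR0 ?gt_eqF ?nneseries_ge0.
  rewrite /uy; move/negP: xt; rewrite negb_and -!ltNge => /orP[xt|xt].
    by have [_ ->] := u0_below x.1.1 (ltW xt); rewrite mul0r.
  by have [_ ->] := u0_above (gap_zone p1 ka) xt; rewrite mul0r.
rewrite integral_nneseries//.
have term k : (\int[mu3]_x h k x <= (K `^ p * 4 `^ (p - 1) * kap k)%:E)%E.
  have -> : (\int[mu3]_x h k x = (c k)%:E * mu3 (tube k))%E.
    rewrite /h ge0_integralZl ?integral_indic ?setIT ?lee_fin//.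
    - exact: measurable_tube.
    - by apply/measurable_EFinP; exact: measurable_indic (measurable_tube k).
  apply: (@le_trans _ _ ((c k)%:E * (2 * (width k * thick k))%:E)%E).
    by apply: lee_wpmul2l; [rewrite lee_fin|exact: measure_tube].
  rewrite -EFinM lee_fin /c; have t0 := @thick_gt0 R k.
  have e1 : (K / thick k) `^ p * (thick k * thick k `^ (p - 1)) = K `^ p.
    have -> : thick k * thick k `^ (p - 1) = thick k `^ p.
      rewrite -{1}[thick k]powRr1 ?(ltW t0)// -powRD.
        by congr (_ `^ _); rewrite addrC subrK.
      by apply/implyP => _; exact: lt0r_neq0.
    have t0' := ltW t0; have Kt0 : 0 <= K / thick k by exact: divr_ge0.
    by rewrite -(powRM p Kt0 t0') divfK// gt_eqF.
  have e2 : thick k `^ (p - 1) * 4 `^ (p - 1) = dyad k `^ (p - 1).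
    by rewrite -(powRM (p - 1) (ltW t0) (ler0n R 4)) /thick divfK// pnatr_eq0.
  rewrite /width -e2 -e1.
  by rewrite le_eqVlt; apply/orP; left; apply/eqP; field.
apply: (@le_lt_trans _ _ (K `^ p * (4 `^ (p - 1)))%:E); last exact: ltry.
apply: lime_le; first by apply: is_cvg_nneseries => k _ _; exact: integral_ge0.
apply: nearW => n.
apply: le_trans; first by apply: lee_sum => k _; exact: term.
rewrite sumEFin lee_fin -mulr_sumr big_mkord sum_kap.
by rewrite ler_piMr ?mulr_ge0 ?powR_ge0// gerBl invr_ge0.
Qed.

Lemma u_sobolev : sobolev Omega p%:E u.
Proof.
have [K K1 HK] := @derive1_stp_bounded R.
split.
  apply: (@Lp_on_bounded _ 1) => x Ox; first by have [] := u_continuous Ox.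
  apply: normM_le1; [exact: u0_ge0|exact: u0_le1|].
  by rewrite ger0_norm ?stp_ge0 ?stp_le1.
move=> i; exists (ugrad i); split; first exact: u_weak_partial.
rewrite /ugrad; case: ifP => _.
  by apply: (@Lp_on_bounded _ 0) => x _; [exact: cst_continuous|rewrite normr0].
case: ifP => _; first exact: uy_Lp.
apply: (@Lp_on_bounded _ K) => x Ox; first by have [] := u_continuous Ox.
apply: normM_le1; [exact: u0_ge0|exact: u0_le1|].
by rewrite derive1_upper normrN.
Qed.

End step.

(** * Flux fields through the channels *)

Section fields.
Context {R : realType}.
Variable p : R.
Hypothesis p1 : 1 < p.

Notation mu3 := (leb3 R).
Notation zone := (zone p).
Notation gap := (gap p).
Notation width := (width p).
Notation zone_size := (zone_size p).
Notation gap_size := (gap_size p).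
Notation fold := (fold p).
Notation spread := (spread p).
Notation Omega := (Omega p).
Notation stp' := (derive1 (@stp R)).
Implicit Types (k : nat).

(** Unlike stp, centred at 0; its derivative is the unit mass bump, carried by
    [-s/4, s/4]. *)
Definition ramp (s t : R) : R := stp (t / s + 2^-1).
Definition bump (s t : R) : R := stp' (t / s + 2^-1) / s.

Lemma affine_smooth (f : R -> R) (a b : R) : smooth1 f -> smooth1 (fun t => f (a * t + b)).
Proof. by move=> sf n; exact: Cn_affine. Qed.

Lemma affine_derive1 (f : R -> R) (a b : R) : smooth1 f ->
  derive1 (fun t => f (a * t + b)) = fun t => derive1 f (a * t + b) * a.
Proof.
move=> sf; apply/funext => t; rewrite derive1E.
by have [] := is_derive_affine (smooth1_is_derive sf (a * t + b)).
Qed.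

Lemma smooth1B (f g : R -> R) : smooth1 f -> smooth1 g -> smooth1 (fun t => f t - g t).
Proof.
move=> sf sg n; have := CnD (sf n) (CnZ (-1) (sg n)).
by rewrite (_ : (fun x => _) = fun t => f t - g t)//; apply/funext => t; rewrite mulN1r.
Qed.

Lemma derive1B (f g : R -> R) : smooth1 f -> smooth1 g ->
  derive1 (fun t => f t - g t) = fun t => derive1 f t - derive1 g t.
Proof.
move=> sf sg; apply/funext => t; rewrite derive1E.
by have [] := is_deriveB (smooth1_is_derive sf t) (smooth1_is_derive sg t).
Qed.

Lemma smooth1Z (c : R) (f : R -> R) : smooth1 f -> smooth1 (fun t => c * f t).
Proof. by move=> sf n; exact: CnZ. Qed.

Lemma derive1Z (c : R) (f : R -> R) : smooth1 f ->
  derive1 (fun t => c * f t) = fun t => c * derive1 f t.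
Proof.
move=> sf; apply/funext => t; rewrite derive1E.
by have [] := is_deriveZ c (smooth1_is_derive sf t).
Qed.

Lemma rampE s : ramp s = fun t => stp (s^-1 * t + 2^-1).
Proof. by apply/funext => t; rewrite /ramp mulrC. Qed.

Lemma ramp_smooth s : smooth1 (ramp s).
Proof. by rewrite rampE; apply: affine_smooth; exact: stp_smooth. Qed.

Lemma derive1_ramp s : derive1 (ramp s) = bump s.
Proof.
rewrite rampE affine_derive1; last exact: stp_smooth.
by apply/funext => t; rewrite /bump [t / s]mulrC.
Qed.

Lemma bump_smooth s : smooth1 (bump s).
Proof. by rewrite -derive1_ramp; apply: smooth1_derive; exact: ramp_smooth. Qed.

Lemma ramp_ge0 s t : 0 <= ramp s t. Proof. exact: stp_ge0. Qed.
Lemma ramp_le1 s t : ramp s t <= 1. Proof. exact: stp_le1. Qed.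

Lemma ramp_left s t : 0 < s -> t <= - (s / 4) -> ramp s t = 0.
Proof.
move=> s0 h; apply: stp0.
have : t / s <= - 4^-1 by rewrite ler_pdivrMr//; lra.
lra.
Qed.

Lemma ramp_right s t : 0 < s -> s / 4 <= t -> ramp s t = 1.
Proof.
move=> s0 h; apply: stp1.
have : 4^-1 <= t / s by rewrite ler_pdivlMr//; lra.
lra.
Qed.

Lemma derive1_stp_supp (t : R) : stp' t != 0 -> 4^-1 <= t /\ t <= 3 / 4.
Proof.
by move=> h; split; rewrite leNgt; apply: contra h => ?;
  [rewrite derive1_stp0|rewrite derive1_stp1].
Qed.

Lemma bump_supp s t : 0 < s -> bump s t != 0 -> `|t| <= s / 4.
Proof.
move=> s0; rewrite /bump mulf_eq0 negb_or => /andP[/derive1_stp_supp [h1 h2] _].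
have h3 : - 4^-1 <= t / s by lra.
have h4 : t / s <= 4^-1 by lra.
move: h3 h4; rewrite ler_pdivlMr// ler_pdivrMr// => h3 h4.
by rewrite ler_norml; apply/andP; split; lra.
Qed.

Let above_wall (l y : R) : 0 < l -> l <= 4^-1 -> 5 / 4 * l <= y -> y <= 7 / 4 * l ->
  `|y| <= 7 / 8.
Proof. by move=> ? ? ? ?; rewrite ler_norml; apply/andP; split; lra. Qed.

Let below_wall (l y : R) : 0 < l -> l <= 4^-1 -> - (3 / 4) * l <= y -> y <= - 4^-1 * l ->
  `|y| <= 7 / 8 /\ y <= - (l / 4).
Proof. by move=> ? ? ? ?; split; [rewrite ler_norml; apply/andP; split|]; lra. Qed.

Variable K : R.
Hypothesis K1 : 1 <= K.
Hypothesis HK : forall t : R, `|stp' t| <= K.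

Let K0 : 0 <= K. Proof. exact: le_trans K1. Qed.

Lemma bump_bound s t : 0 < s -> `|bump s t| <= K / s.
Proof. by move=> s0; rewrite normrM normfV (gtr0_norm s0) ler_pM2r// invr_gt0. Qed.

Variable k : nat.

Local Notation l := (@thick R k).
Let l0 : 0 < l. Proof. exact: thick_gt0. Qed.
Let l4 : l <= 4^-1. Proof. exact: thick_le. Qed.
Local Notation zs := (zone_size k).
Local Notation gs := (gap_size k).
Let zs0 : 0 < zs. Proof. exact: zone_size_gt0. Qed.
Let gs0 : 0 < gs. Proof. exact: gap_size_gt0. Qed.
Let gszs : gs <= zs.
Proof. by have := gap_sizeE p k; have := zone_size_gt0 p1 k.+1; move=> ? ->; lra. Qed.

Ltac size_lra := have := zs0; have := gs0; have := gszs; have := l0; have := l4;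
  move=> ? ? ? ? ?; lra.

(** Each zone carries a flux dyad k upwards, hence a total flux 1. In the rooms
    this flux is spread over the zones (Px), in the channels it is concentrated in
    the gaps (px); Qx, with Qx' = Px - px, is the sideways flow redistributing
    it. A zone has size comparable to dyad k, so that Px is bounded uniformly in
    k, whereas px is of order 1 / width k. *)
Definition Px x : R := dyad k * spread k (bump zs) x.
Definition px x : R := dyad k * spread k (bump gs) x.
Definition Qx x : R := dyad k * spread k (fun t => ramp zs t - ramp gs t) x.

(** Ay is 1 across the wall and vanishes at distance about l from it: within that
    distance the flux is redistributed. eta is the profile of the whole flux,
    closed off deep inside the two rooms, and zeta confines it below the floor. *)
Definition Ay y : R := stp (y / l + 1) - stp (y / l - 1).
Definition eta y : R := stp (2 * y + 2) - stp (2 * y - 1).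
Definition zeta z : R := stp' (- z).

Lemma Px_smooth : smooth1 Px.
Proof. by apply: smooth1Z; apply: spread_smooth; exact: bump_smooth. Qed.

Lemma px_smooth : smooth1 px.
Proof. by apply: smooth1Z; apply: spread_smooth; exact: bump_smooth. Qed.

Let ramps_smooth : smooth1 (fun t => ramp zs t - ramp gs t).
Proof. by apply: smooth1B; exact: ramp_smooth. Qed.

Lemma Qx_smooth : smooth1 Qx.
Proof. by apply: smooth1Z; apply: spread_smooth. Qed.

Lemma derive1_Qx : derive1 Qx = fun x => Px x - px x.
Proof.
rewrite derive1Z; last exact: spread_smooth.
rewrite derive1_spread// derive1B ?derive1_ramp; [|exact: ramp_smooth|exact: ramp_smooth].
by rewrite spreadB; apply/funext => t; rewrite mulrBr.
Qed.

Let bump_zone s t : 0 < s -> s <= zs -> bump s t != 0 -> `|t| < zs / 2.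
Proof. by move=> s0 sz /(bump_supp s0) h; apply: le_lt_trans h _; size_lra. Qed.

Lemma Px_supp x : Px x != 0 -> `|fold k x| <= zs / 4.
Proof.
rewrite mulf_eq0 negb_or => /andP[_ /spread_supp].
by case=> // [t /bump_zone -> //|t /(bump_supp zs0) h <-].
Qed.

Lemma px_supp x : px x != 0 -> `|fold k x| <= gs / 4.
Proof.
rewrite mulf_eq0 negb_or => /andP[_ /spread_supp].
by case=> // [t /bump_zone -> //|t /(bump_supp gs0) h <-].
Qed.

Let ramps_supp t : ramp zs t - ramp gs t != 0 -> `|t| <= zs / 4.
Proof.
move=> h; rewrite ler_norml; apply/andP; split; rewrite leNgt; apply: contra h => h.
  by have := gszs => ?; rewrite !ramp_left ?subrr//; size_lra.
by have := gszs => ?; rewrite !ramp_right ?subrr//; size_lra.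
Qed.

Lemma Qx_supp x : Qx x != 0 -> `|fold k x| <= zs / 4.
Proof.
rewrite mulf_eq0 negb_or => /andP[_ /spread_supp].
case=> // [t /ramps_supp h|t /ramps_supp h <- //].
by apply: le_lt_trans h _; size_lra.
Qed.

Let dyadk0 : 0 < dyad k :> R. Proof. exact: dyad_gt0. Qed.

Lemma Px_bound x : `|Px x| <= 2 * K.
Proof.
rewrite normrM gtr0_norm//.
have h : `|spread k (bump zs) x| <= K / zs.
  by apply: (spread_bound p1) => t; [exact: bump_zone|exact: bump_bound].
apply: le_trans (ler_wpM2l (ltW dyadk0) h) _.
rewrite mulrA ler_pdivrMr//.
have h2 := zone_size_ge p1 k.
have : 0 <= K * (2 * zs - dyad k) by rewrite mulr_ge0//; lra.
lra.
Qed.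

Lemma px_bound x : `|px x| <= K / width k.
Proof.
rewrite normrM gtr0_norm//.
have h : `|spread k (bump gs) x| <= K / gs.
  by apply: (spread_bound p1) => t; [exact: bump_zone|exact: bump_bound].
apply: le_trans (ler_wpM2l (ltW dyadk0) h) _.
rewrite gap_sizeM le_eqVlt; apply/orP; left; apply/eqP; field.
by rewrite !gt_eqF ?width_gt0.
Qed.

Lemma Qx_bound x : `|Qx x| <= dyad k.
Proof.
rewrite normrM gtr0_norm// -[leRHS]mulr1 ler_wpM2l ?(ltW dyadk0)//.
apply: (spread_bound p1) => t; first by move/ramps_supp => h; apply: le_lt_trans h _; size_lra.
have := ramp_ge0 zs t; have := ramp_ge0 gs t; have := ramp_le1 zs t; have := ramp_le1 gs t.
by move=> *; rewrite ler_norml; apply/andP; split; size_lra.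
Qed.

Let AyE : Ay = fun y => stp (l^-1 * y + 1) - stp (l^-1 * y + -1).
Proof. by apply/funext => y; rewrite /Ay [y / l]mulrC. Qed.

Lemma Ay_smooth : smooth1 Ay.
Proof.
by rewrite AyE; apply: smooth1B; apply: affine_smooth; exact: stp_smooth.
Qed.

Lemma derive1_Ay y : derive1 Ay y = (stp' (y / l + 1) - stp' (y / l - 1)) / l.
Proof.
rewrite AyE derive1B; [|by apply: affine_smooth; exact: stp_smooth..].
rewrite !affine_derive1; [|exact: stp_smooth..].
by rewrite -mulrBl [y / l]mulrC.
Qed.

Lemma Ay_bound y : `|Ay y| <= 1.
Proof.
rewrite /Ay; have := @stp_ge0 R (y / l + 1); have := @stp_ge0 R (y / l - 1).
have := @stp_le1 R (y / l + 1); have := @stp_le1 R (y / l - 1).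
by move=> *; rewrite ler_norml; apply/andP; split; size_lra.
Qed.

Lemma Ay_supp y : Ay y != 0 -> - l <= y <= 2 * l.
Proof.
move=> h; apply/andP; split; rewrite leNgt; apply: contra h => h; rewrite /Ay.
  have : y / l < -1 by rewrite ltr_pdivrMr//; size_lra.
  by move=> h'; rewrite !stp0 ?subrr//; size_lra.
have : 2 < y / l by rewrite ltr_pdivlMr//; size_lra.
by move=> h'; rewrite !stp1 ?subrr//; size_lra.
Qed.

Lemma derive1_Ay_supp y : derive1 Ay y != 0 ->
  `|y| <= 7 / 8 /\ (y <= - (l / 4) \/ 5 / 4 * l <= y).
Proof.
rewrite derive1_Ay mulf_eq0 negb_or => /andP[h _].
have [h1|h1] := eqVneq (stp' (y / l + 1)) 0.
  have /derive1_stp_supp [h2 h3] : stp' (y / l - 1) != 0.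
    by apply: contra h => /eqP ->; rewrite h1 subrr.
  have h4 : 5 / 4 <= y / l by size_lra.
  have h5 : y / l <= 7 / 4 by size_lra.
  move: h4 h5; rewrite ler_pdivlMr// ler_pdivrMr// => h4 h5.
  by split; [exact: above_wall l0 l4 h4 h5|right].
have [h2 h3] := derive1_stp_supp h1.
have h4 : - (3 / 4) <= y / l by size_lra.
have h5 : y / l <= - 4^-1 by size_lra.
move: h4 h5; rewrite ler_pdivlMr// ler_pdivrMr// => h4 h5.
by have [] := below_wall l0 l4 h4 h5; split; last left.
Qed.

Lemma derive1_Ay_bound y : `|derive1 Ay y| <= 2 * K / l.
Proof.
rewrite derive1_Ay normrM normfV (gtr0_norm l0) ler_pM2r ?invr_gt0//.
by apply: le_trans (ler_normB _ _) _; rewrite mulr_natl mulr2n lerD.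
Qed.

(** Ay varies only where stp (y / l) is constant: its rise lies below the wall,
    where the step is 0, and its fall above the wall, where the step is 1. *)
Lemma derive1_Ay_stp y : derive1 Ay y * stp (y / l) = - stp' (y / l - 1) / l.
Proof.
rewrite derive1_Ay.
have -> : stp' (y / l - 1) = stp' (y / l - 1) * stp (y / l).
  have [->|/derive1_stp_supp [h _]] := eqVneq (stp' (y / l - 1)) 0; first by rewrite mul0r.
  by rewrite stp1 ?mulr1//; size_lra.
have [h|/derive1_stp_supp [_ h]] := eqVneq (stp' (y / l + 1)) 0.
  have [h2|/derive1_stp_supp [h2 _]] := eqVneq (stp' (y / l - 1)) 0.
    by rewrite h h2 !(mul0r, subrr, oppr0).
  by rewrite [stp (y / l)]stp1 ?h ?mulr1 ?sub0r//; size_lra.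
by rewrite [stp (y / l)]stp0 ?mulr0 ?oppr0 ?mul0r//; size_lra.
Qed.

Let etaE : eta = fun y => stp (2 * y + 2) - stp (2 * y + -1).
Proof. by []. Qed.

Lemma eta_smooth : smooth1 eta.
Proof.
by rewrite etaE; apply: smooth1B; apply: affine_smooth; exact: stp_smooth.
Qed.

Lemma derive1_eta_bound y : `|derive1 eta y| <= 4 * K.
Proof.
rewrite etaE derive1B; [|by apply: affine_smooth; exact: stp_smooth..].
rewrite !affine_derive1; [|exact: stp_smooth..].
rewrite -mulrBl normrM [`|2|]gtr0_norm//.
have : `|stp' (2 * y + 2) - stp' (2 * y + -1)| <= 2 * K.
  by apply: le_trans (ler_normB _ _) _; rewrite [2 * K]mulr_natl mulr2n lerD.
by move: `|_| => d h; size_lra.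
Qed.

Lemma eta_Ay_bound y : `|eta y - Ay y| <= 2.
Proof.
apply: le_trans (ler_normB _ _) _; have := Ay_bound y; suff : `|eta y| <= 1 by size_lra.
rewrite /eta; have := @stp_ge0 R (2 * y + 2); have := @stp_ge0 R (2 * y - 1).
have := @stp_le1 R (2 * y + 2); have := @stp_le1 R (2 * y - 1).
by move=> *; rewrite ler_norml; apply/andP; split; size_lra.
Qed.

Lemma eta_Ay_supp y : eta y - Ay y != 0 ->
  `|y| <= 7 / 8 /\ (y <= - (l / 4) \/ 5 / 4 * l <= y).
Proof.
move=> h; split.
  rewrite ler_norml; apply/andP; split; rewrite leNgt; apply: contra h => h.
    have hl : y / l < -1 by rewrite ltr_pdivrMr//; size_lra.
    by rewrite /eta /Ay !stp0 ?subrr//; size_lra.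
  have hl : 2 < y / l by rewrite ltr_pdivlMr//; size_lra.
  by rewrite /eta /Ay !stp1 ?subrr//; size_lra.
have [h1|h1] := leP y (- (l / 4)); first by left.
have [h2|h2] := leP (5 / 4 * l) y; first by right.
have h3 : - 4^-1 < y / l by rewrite ltr_pdivlMr//; size_lra.
have h4 : y / l < 5 / 4 by rewrite ltr_pdivrMr//; size_lra.
move: h; rewrite /eta /Ay [stp (2 * y + 2)]stp1; last by size_lra.
rewrite [stp (2 * y - 1)]stp0; last by size_lra.
rewrite [stp (y / l + 1)]stp1; last by size_lra.
by rewrite [stp (y / l - 1)]stp0 ?subrr ?eqxx//; size_lra.
Qed.

Lemma zetaE z : zeta z = - derive1 (@upper R) z.
Proof. by rewrite derive1_upper opprK. Qed.

Lemma zeta_smooth : smooth1 zeta.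
Proof.
have -> : zeta = fun z => -1 * derive1 (@upper R) z.
  by apply/funext => z; rewrite zetaE mulN1r.
by apply: smooth1Z; apply: smooth1_derive; exact: upper_smooth.
Qed.

Lemma zeta_bound z : `|zeta z| <= K.
Proof. exact: HK. Qed.

Lemma zeta_supp z : zeta z != 0 -> - (3 / 4) <= z <= - 4^-1.
Proof. by move=> /derive1_stp_supp [? ?]; apply/andP; split; size_lra. Qed.

Definition phi1 : R3 R -> R := tensor Qx (derive1 Ay) zeta.
Definition phi2 : R3 R -> R := tensor Px (fun y => eta y - Ay y) zeta.
Definition phi3 : R3 R -> R := tensor px Ay zeta.
Definition rho : R3 R -> R := tensor Px (derive1 eta) zeta.

Let eAy_smooth : smooth1 (fun y => eta y - Ay y).
Proof. by apply: smooth1B; [exact: eta_smooth|exact: Ay_smooth]. Qed.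

Let dAy_smooth : smooth1 (derive1 Ay).
Proof. by apply: smooth1_derive; exact: Ay_smooth. Qed.

(** The field (phi1, phi2 + phi3) is the unit flux through the channels of
    generation k. Sideways and upward flow compensate, and only the sources rho,
    spread over the rooms, remain. *)
Lemma flux_divergence x : rho x =
  'D_(basis3 (inord 0)) phi1 x + 'D_(basis3 (inord 1)) phi2 x +
  'D_(basis3 (inord 1)) phi3 x.
Proof.
rewrite /phi1 /phi2 /phi3 !derive_tensorE//; try exact: Qx_smooth; try exact: Px_smooth;
  try exact: px_smooth; try exact: zeta_smooth; try exact: Ay_smooth.
rewrite /dtensor !inordK//= /tensor /rho derive1_Qx (derive1B eta_smooth Ay_smooth).
rewrite /tensor /=; move: (Px x.1.1) (px x.1.1) (derive1 eta x.1.2) (derive1 Ay x.1.2) (zeta x.2).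
by move=> a b c d e; ring.
Qed.

Let slab (c : R) (Y : set R) : set (R3 R) :=
  [set x | [/\ `|fold k x.1.1| <= c, `|x.1.2| <= 7 / 8, Y x.1.2 & - (3 / 4) <= x.2 <= - 4^-1]].

Let cl_fold (c : R) : closed [set t : R | `|fold k t| <= c].
Proof.
rewrite (_ : mkset _ = (fun t => `|fold k t|) @^-1` [set s | s <= c])//.
apply: closed_comp => // t _; apply: cvg_norm; exact: continuous_fold.
Qed.

Let slab_compact c Y : closed Y -> c <= zs / 4 -> compact (slab c Y).
Proof.
move=> cY cz; apply: subclosed_compact (@compact_cube3 R 1) _; last first.
  move=> x [h1 h2 _ /andP[h3 h4]].
  have hz : zone k x.1.1 by rewrite zoneE; apply: le_lt_trans h1 _; size_lra.
  have := zone_bound p1 hz; rewrite ltr_norml => /andP[a1 a2].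
  move: h2; rewrite ler_norml => /andP[b1 b2].
  by split; rewrite /= ?in_itv/=; [split; rewrite /= in_itv/=|]; apply/andP; split; size_lra.
have c1 : continuous (fun x : R3 R => x.1.1).
  by move=> x; apply: (continuous_comp (f := fst) (g := fst)); exact: cvg_fst.
have c2 : continuous (fun x : R3 R => x.1.2).
  by move=> x; apply: (continuous_comp (f := fst) (g := snd)); [exact: cvg_fst|exact: cvg_snd].
have c3 : continuous (fun x : R3 R => x.2) by move=> x; exact: cvg_snd.
rewrite (_ : slab c Y = (fun x : R3 R => x.1.1) @^-1` [set t | `|fold k t| <= c] `&`
  (fun x : R3 R => x.1.2) @^-1` (`[- (7 / 8), 7 / 8] `&` Y) `&`
  (fun x : R3 R => x.2) @^-1` `[- (3 / 4), - 4^-1]).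
  apply: closedI; first apply: closedI.
  - by apply: closed_comp => [x _|]; [exact: c1|exact: cl_fold].
  - apply: closed_comp => [x _|]; [exact: c2|].
    by apply: closedI => //; exact: itv_closed.
  - by apply: closed_comp => [x _|]; [exact: c3|exact: itv_closed].
apply/seteqP; split => x.
  by move=> [h1 h2 h3 h4]; split; [split=> //; split=> //|]; rewrite /= in_itv/= -?ler_norml.
move=> [[h1 [h2 h3]] h4]; split => //.
by move: h2; rewrite /= in_itv/= ler_norml.
Qed.

Let wallY : set R := [set y | y <= - (l / 4)] `|` [set y | 5 / 4 * l <= y].

Let slab_out : slab (zs / 4) wallY `<=` Omega.
Proof.
move=> x [h1 h2 h3 /andP[h4 h5]].
have hz : zone k x.1.1 by rewrite zoneE; apply: le_lt_trans h1 _; size_lra.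
have h6 := zone_bound p1 hz; have h7 : `|x.1.2| < 1 by size_lra.
split => //; first by rewrite ltr_norml; apply/andP; split; size_lra.
right; split => //; case: h3 => /= h3; [left; size_lra|right; exists k; left].
split => //; size_lra.
Qed.

Let slab_gap : slab (gs / 4) setT `<=` Omega.
Proof.
move=> x [h1 h2 _ /andP[h4 h5]].
have hg : gap k x.1.1 by rewrite gapE; apply: le_lt_trans h1 _; size_lra.
have h6 := zone_bound p1 (gap_zone p1 hg); have h7 : `|x.1.2| < 1 by size_lra.
split => //; first by rewrite ltr_norml; apply/andP; split; size_lra.
by right; split => //; right; exists k; right.
Qed.

Let wallY_closed : closed wallY.
Proof. by apply: closedU; [exact: closed_le|exact: closed_ge]. Qed.

Let tensor_neq0 f g h (x : R3 R) : tensor f g h x != 0 ->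
  [/\ f x.1.1 != 0, g x.1.2 != 0 & h x.2 != 0].
Proof. by rewrite !mulf_eq0 !negb_or => /andP[/andP[-> ->] ->]. Qed.

Lemma phi1_test : test_function Omega phi1.
Proof.
apply: test_functionP.
  by apply: smooth_tensor => //; [exact: Qx_smooth|exact: zeta_smooth].
exists (slab (zs / 4) wallY); split; [exact: slab_compact|exact: slab_out|].
move=> x; apply: contra_notP => /eqP /tensor_neq0 [/Qx_supp h1 /derive1_Ay_supp [h2 h3] /zeta_supp h4].
by split.
Qed.

Lemma phi2_test : test_function Omega phi2.
Proof.
apply: test_functionP.
  by apply: smooth_tensor => //; [exact: Px_smooth|exact: zeta_smooth].
exists (slab (zs / 4) wallY); split; [exact: slab_compact|exact: slab_out|].
move=> x; apply: contra_notP => /eqP /tensor_neq0 [/Px_supp h1 /eta_Ay_supp [h2 h3] /zeta_supp h4].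
by split.
Qed.

Lemma phi3_test : test_function Omega phi3.
Proof.
apply: test_functionP.
  by apply: smooth_tensor => //; [exact: px_smooth|exact: Ay_smooth|exact: zeta_smooth].
exists (slab (gs / 4) setT); split; [|exact: slab_gap|].
  by apply: slab_compact; [exact: closedT|size_lra].
move=> x; apply: contra_notP => /eqP /tensor_neq0 [/px_supp h1 /Ay_supp /andP[h2 h3] /zeta_supp h4].
by split => //; rewrite ler_norml; apply/andP; split; size_lra.
Qed.

Let tensor_bound f g h (x : R3 R) (a b c : R) : `|f x.1.1| <= a -> `|g x.1.2| <= b ->
  `|h x.2| <= c -> `|tensor f g h x| <= a * b * c.
Proof.
move=> fa gb hc; rewrite !normrM; apply: ler_pM => //; exact: ler_pM.
Qed.

(** The sideways flow is of order dyad k and is turned on and off over a height l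
    of the same order. *)
Lemma phi1_bound x : `|phi1 x| <= 8 * K ^+ 3.
Proof.
apply: le_trans (tensor_bound (Qx_bound _) (derive1_Ay_bound _) (zeta_bound _)) _.
have -> : dyad k = 4 * l by rewrite /thick mulrC divfK// pnatr_eq0.
have -> : 4 * l * (2 * K / l) * K = 8 * K ^+ 2 by field; rewrite gt_eqF.
have h : 0 <= K ^+ 2 * (K - 1) by rewrite mulr_ge0 ?sqr_ge0 ?subr_ge0.
have h2 := sqr_ge0 K; lra.
Qed.

Lemma phi2_bound x : `|phi2 x| <= 8 * K ^+ 3.
Proof.
apply: le_trans (tensor_bound (Px_bound _) (eta_Ay_bound _) (zeta_bound _)) _.
have -> : 2 * K * 2 * K = 4 * K ^+ 2 by ring.
have h : 0 <= K ^+ 2 * (K - 1) by rewrite mulr_ge0 ?sqr_ge0 ?subr_ge0.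
have h2 := sqr_ge0 K; lra.
Qed.

Lemma rho_bound x : `|rho x| <= 8 * K ^+ 3.
Proof.
apply: le_trans (tensor_bound (Px_bound _) (derive1_eta_bound _) (zeta_bound _)) _.
by rewrite le_eqVlt; apply/orP; left; apply/eqP; ring.
Qed.

Lemma phi3_bound x : `|phi3 x| <= K ^+ 2 / width k.
Proof.
apply: le_trans (tensor_bound (px_bound _) (Ay_bound _) (zeta_bound _)) _.
by rewrite mulr1 expr2 mulrAC.
Qed.

Definition tube3 : set (T3 R) := (gap k `*` `[- l, 2 * l]) `*` `[-1, 1].

Lemma measurable_tube3 : measurable tube3.
Proof.
apply: measurableX; last exact: measurable_itv.
by apply: measurableX; [exact: measurable_gap|exact: measurable_itv].
Qed.

Lemma phi3_supp x : ~ tube3 x -> phi3 x = 0.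
Proof.
apply: contra_notP => /eqP /tensor_neq0 [/px_supp h1 /Ay_supp h2 /zeta_supp /andP[h3 h4]].
split => /=; last by rewrite in_itv/=; apply/andP; split; size_lra.
split => /=; last by rewrite in_itv.
by rewrite gapE; apply: le_lt_trans h1 _; size_lra.
Qed.

Lemma measure_tube3 : (mu3 tube3 <= (6 * (width k * l))%:E)%E.
Proof.
pose I : set (measurableTypeR R) := `[- l, 2 * l]%classic.
have mI : measurable I by exact: measurable_itv.
have mgt : measurable (gap k `*` I : set (measurableTypeR R * measurableTypeR R)).
  by apply: measurableX => //; exact: measurable_gap.
have -> : mu3 tube3 = ((leb R \x leb R) (gap k `*` I) * leb R `[(-1)%R, 1%R])%E.
  by apply: product_measure1E => //; exact: measurable_itv.
have -> : ((leb R \x leb R) (gap k `*` I) = leb R (gap k) * leb R I)%E.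
  by apply: product_measure1E => //; exact: measurable_gap.
have -> : leb R `[-1, 1] = 2%:E.
  by rewrite measure_sym_itv// mulr1.
have -> : leb R I = (3 * l)%:E.
  have h : - l < 2 * l by size_lra.
  by rewrite /I lebesgue_measure_itv/= lte_fin h -EFinB; congr EFin; ring.
have -> : 6 * (width k * l) = width k * (3 * l) * 2 by ring.
rewrite [X in (_ <= X)%E]EFinM; apply: lee_wpmul2r; first by rewrite lee_fin.
rewrite [X in (_ <= X)%E]EFinM; apply: lee_wpmul2r; first by rewrite lee_fin mulr_ge0// ltW.
exact: measure_gap.
Qed.

Let u_phi3 : (fun x => u p x * 'D_(basis3 (inord 1)) phi3 x) \_ Omega =
  tensor px (fun y => - stp' (y / l - 1) / l) (fun z => zeta z * upper z).
Proof.
apply/funext => x; rewrite patchE /phi3 derive_tensorE; last 3 first.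
- exact: px_smooth.
- exact: Ay_smooth.
- exact: zeta_smooth.
rewrite /dtensor inordK//= /tensor -derive1_Ay_stp.
have [h|h] := eqVneq (px x.1.1) 0; first by rewrite h !(mul0r, mulr0); case: ifP.
have hg : gap k x.1.1.
  by have := px_supp h; rewrite gapE => h1; apply: le_lt_trans h1 _; size_lra.
rewrite /u /u0 (at_gapE p1 _ _ hg).
case: ifPn => xO; first by ring.
have [->|hA] := eqVneq (derive1 Ay x.1.2) 0; first by rewrite !(mul0r, mulr0).
have [->|hz] := eqVneq (zeta x.2) 0; first by rewrite !(mul0r, mulr0).
suff : Omega x by move=> Ox; rewrite mem_set in xO.
have [h1 _] := derive1_Ay_supp hA.
by apply: slab_gap; split => //; [exact: px_supp|exact: zeta_supp].
Qed.

Let stp_affine_derive (a b t : R) :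
  is_derive t 1 (fun y => stp (a * y + b)) (stp' (a * t + b) * a).
Proof. exact: is_derive_affine (smooth1_is_derive (@stp_smooth R) _). Qed.

(** Up to sign, the flux crossing the jump of u: a product of three increments, of
    which only the one in z, the integral of stp' stp, differs from 1 in size. *)
Lemma pair_u_phi3 : pair Omega (u p) ('D_(basis3 (inord 1)) phi3) = - 2^-1.
Proof.
rewrite /pair Rintegral_mkcond u_phi3 /Rintegral.
pose G y : R := - stp (y / l - 1).
pose F x : R := dyad k * spread k (ramp gs) x.
pose H z : R := - (upper z * upper z / 2).
have dF (t : R) : is_derive t 1 F (px t).
  have sF : smooth1 F by apply: smooth1Z; apply: spread_smooth; exact: ramp_smooth.
  have := smooth1_is_derive sF t.
  rewrite derive1Z; last by apply: spread_smooth; exact: ramp_smooth.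
  by rewrite derive1_spread ?derive1_ramp//; exact: ramp_smooth.
have GE : G = fun y => - stp (l^-1 * y + -1) by apply/funext => y; rewrite /G [y / l]mulrC.
have dG (t : R) : is_derive t 1 G (- stp' (t / l - 1) / l).
  rewrite GE mulNr [t / l]mulrC; apply: is_deriveN; exact: stp_affine_derive.
have dH (t : R) : is_derive t 1 H (zeta t * upper t).
  have d1 := smooth1_is_derive (@upper_smooth R) t.
  have d2 := is_deriveZ (- 2^-1) (is_deriveM d1 d1).
  have -> : H = fun z => - 2^-1 * (upper z * upper z).
    by apply/funext => z; rewrite /H mulrC mulNr.
  have -> : zeta t * upper t = - 2^-1 *: (upper t *: derive1 (@upper R) t + upper t *: derive1 (@upper R) t).
    by rewrite zetaE /GRing.scale/=; field.
  exact: d2.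
have cpx := smooth1_continuous px_smooth.
have cg : continuous (fun y : R => - stp' (y / l - 1) / l).
  have -> : (fun y : R => - stp' (y / l - 1) / l) = derive1 G.
    by apply/funext => y; rewrite [RHS]derive1E; have [_ ->] := dG y.
  apply: smooth1_continuous; apply: smooth1_derive.
  have -> : G = fun y => -1 * stp (l^-1 * y + -1).
    by rewrite GE; apply/funext => y; rewrite mulN1r.
  by apply: smooth1Z; apply: affine_smooth; exact: stp_smooth.
have ch : continuous (fun z : R => zeta z * upper z).
  move=> z; apply: cvgM; [exact: (smooth1_continuous zeta_smooth)|].
  exact: (smooth1_continuous (@upper_smooth R)).
have M2 : 0 < 2 :> R by [].
have s1 : zs <= 1 by apply: le_trans (zone_size_le p k) (dyad_le1 _).
rewrite (integral_tensor M2 cpx cg ch dF dG dH) /=.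
- have -> : F 2 = 1.
    have hr (t : R) : 1 <= t -> ramp gs t = 1.
      by move=> t1; apply: ramp_right; size_lra.
    rewrite /F (spread_right p1 (k := k) hr) ?mulr1; last by size_lra.
    by rewrite /dyad -exprMn mulVf ?expr1n.
  have -> : F (-2) = 0.
    have hr (t : R) : t <= -1 -> ramp gs t = 0.
      by move=> t1; apply: ramp_left; size_lra.
    by rewrite /F (spread_left p1 (k := k) hr) ?mulr0//; size_lra.
  have -> : G 2 = -1.
    have : 4 <= 2 / l by rewrite ler_pdivlMr//; size_lra.
    by move=> h; rewrite /G stp1//; lra.
  have -> : G (-2) = 0.
    have : (-2) / l <= 0 by rewrite ler_pdivrMr//; size_lra.
    by move=> h; rewrite /G stp0 ?oppr0//; lra.
  have -> : H 2 = 0 by rewrite /H /upper stp0 ?mul0r ?oppr0//; lra.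
  have -> : H (-2) = - 2^-1 by rewrite /H /upper opprK stp1 ?mulr1 ?mul1r//; lra.
  by field.
- move=> t t2; apply/eqP; apply: contraT => /px_supp h1.
  have hg : gap k t by rewrite gapE; apply: le_lt_trans h1 _; size_lra.
  by have := zone_bound p1 (gap_zone p1 hg); lra.
- move=> t t2; apply/eqP; apply: contraT.
  rewrite mulf_eq0 oppr_eq0 negb_or => /andP[/derive1_stp_supp [h1 h2] _].
  have h3 : 0 <= t / l by lra.
  have h4 : t / l <= 2 by lra.
  move: h3 h4; rewrite ler_pdivlMr// ler_pdivrMr// mul0r => h3 h4.
  by move: t2; rewrite ger0_norm//; size_lra.
- move=> t t2; apply/eqP; apply: contraT.
  rewrite mulf_eq0 negb_or => /andP[/zeta_supp /andP[h1 h2] _].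
  by move: t2; rewrite ltr0_norm; lra.
Qed.

End fields.

(** * Failure of density *)

Section nondensity.
Context {R : realType}.
Variable p : R.
Hypothesis p1 : 1 < p.

Notation mu3 := (leb3 R).
Notation Omega := (Omega p).

(** An exponential beats the quadratic decay of kap; with s = r - p this is where
    an exponent above the critical one enters. *)
Lemma dyad_pow_small (s e : R) : 0 < s -> 0 < e ->
  exists k, dyad k `^ s < e * kap k.
Proof.
move=> s0 e0; have [C hC] := @pow_expRN_bounded R 3.
pose c : R := - (s * ln 2^-1).
have c0 : 0 < c by rewrite /c oppr_gt0 pmulr_rlt0// ln_lt0//; apply/andP; split; lra.
have C0 : 0 <= C by apply: le_trans (hC 0 _); rewrite // mulr_ge0 ?exprn_ge0 ?expR_ge0.
pose N := Num.Def.truncn (6 * C / (c ^+ 3 * e)).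
have hN : 6 * C / (c ^+ 3 * e) < N.+1%:R by exact: truncnS_gt.
exists N.+1.
have n0 : 0 < N.+1%:R :> R by [].
have n1 : 1 <= N.+1%:R :> R by rewrite ler1n.
have -> : dyad N.+1 `^ s = expR (- (c * N.+1%:R)).
  rewrite /powR gt_eqF ?dyad_gt0//; congr expR.
  have -> : ln (dyad N.+1) = N.+1%:R * ln 2^-1 :> R.
    by rewrite /dyad lnXn ?invr_gt0// mulr_natl.
  by rewrite /c mulNr opprK mulrAC -mulrA.
have cn : 0 < c * N.+1%:R by rewrite mulr_gt0.
have h := hC _ (ltW cn).
have E2 : N.+2%:R = N.+1%:R + 1 :> R by rewrite -natr1.
have E3 : N.+3%:R = N.+1%:R + 2 :> R by rewrite -natr1 E2 -addrA.
have -> : kap N.+1 = ((N.+1%:R + 1) * (N.+1%:R + 2))^-1 :> R.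
  rewrite /kap E2 E3; move: N.+1%:R n0 => n n0.
  by field; rewrite !gt_eqF//; lra.
clear E2 E3; move: N.+1%:R hN n0 n1 cn h => n hN n0 n1 cn h.
rewrite ltr_pdivlMr; last by rewrite mulr_gt0//; lra.
set E := expR _ in h *.
have E0 : 0 < E by exact: expR_gt0.
have c3 : 0 < c ^+ 3 by rewrite exprn_gt0.
move: hN; rewrite ltr_pdivrMr ?mulr_gt0// => hN.
have h2 : n ^+ 2 * 6 * (c ^+ 3 * n) * E <= 6 * C.
  have -> : n ^+ 2 * 6 * (c ^+ 3 * n) * E = 6 * ((c * n) ^+ 3 * E) by ring.
  by rewrite ler_pM2l.
have h3 : (n + 1) * (n + 2) <= 6 * n ^+ 2 by nra.
have h4 : E * ((n + 1) * (n + 2)) <= E * (6 * n ^+ 2) by rewrite ler_pM2l.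
apply: le_lt_trans h4 _.
have cn3 : 0 < c ^+ 3 * n by rewrite mulr_gt0.
rewrite -(ltr_pM2r cn3); lra.
Qed.

Lemma norm_coord_le_enorm (x : R3 R) :
  [/\ `|x.1.1| <= enorm x, `|x.1.2| <= enorm x & `|x.2| <= enorm x].
Proof.
have [h1 h2 h3] := norm_coord3 x; have h := sup_le_enorm x.
by split; apply: le_trans h.
Qed.

(** The integrand of the Sobolev norm is a common majorant of the powers of the
    function and of its derivatives, and it alone will be integrated. *)
Lemma sobolev_norm_lt (w : R3 R -> R) (eps : R) : 0 < eps ->
  (sobolev_norm Omega p w < eps%:E)%E ->
  exists F : R3 R -> R, [/\ (\int[mu3]_(x in Omega) (F x)%:E <= (eps `^ p)%:E)%E,
    forall x, `|w x| `^ p <= F x,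
    forall x, `|weak_partial Omega (inord 0) w x| `^ p <= F x &
    forall x, `|weak_partial Omega (inord 1) w x| `^ p <= F x].
Proof.
move=> e0; rewrite /sobolev_norm.
pose F x := `|w x| `^ p + enorm (weak_grad Omega w x) `^ p.
have p0 : 0 < p by exact: lt_trans p1.
have F0 x : 0 <= F x by rewrite addr_ge0// powR_ge0.
have I0 : (0 <= \int[mu3]_(x in Omega) (F x)%:E)%E.
  by apply: integral_ge0 => x _; rewrite lee_fin.
move=> h; exists F; split.
- have := h; rewrite -/F.
  case: (\int[mu3]_(x in Omega) (F x)%:E)%E I0 => [r| |//].
    rewrite lee_fin => r0; rewrite poweR_EFin lte_fin lee_fin => h'.
    have -> : r = (r `^ p^-1) `^ p by rewrite -powRrM mulVf ?powRr1 ?gt_eqF.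
    by apply: ge0_ler_powR; rewrite ?nnegrE ?powR_ge0// ltW.
  by move=> _; rewrite poweRyr ?invr_eq0 ?gt_eqF// ltNge leey.
- by move=> x; rewrite /F lerDl powR_ge0.
- move=> x; apply: le_trans (_ : enorm (weak_grad Omega w x) `^ p <= _); last by rewrite /F lerDr powR_ge0.
  have [h1 _ _] := norm_coord_le_enorm (weak_grad Omega w x).
  by apply: ge0_ler_powR; rewrite ?nnegrE ?enorm_ge0// ltW.
- move=> x; apply: le_trans (_ : enorm (weak_grad Omega w x) `^ p <= _); last by rewrite /F lerDr powR_ge0.
  have [_ h1 _] := norm_coord_le_enorm (weak_grad Omega w x).
  by apply: ge0_ler_powR; rewrite ?nnegrE ?enorm_ge0// ltW.
Qed.

Lemma three_small (x y z : R) : `|x| <= 12^-1 -> `|y| <= 12^-1 ->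
  `|- x - y - 2^-1 + z| <= 12^-1 -> 4^-1 <= `|z|.
Proof.
rewrite !ler_norml => /andP[? ?] /andP[? ?] /andP[? ?].
by rewrite ler_normr; apply/orP; left; lra.
Qed.

(** If w were close to u then, tested against the flux fields, the jump of u would
    have to be matched by the flux of w through the channels of generation k, for
    every k; but this flux tends to 0, since the derivative of w is in L^r with
    r > p. *)
Lemma not_dense (q : \bar R) : (p%:E < q)%E -> ~ sobolev_dense Omega q p.
Proof.
move=> pq dense.
have oO : open Omega by exact: open_Omega.
have OC := @Omega_cube R p.
have [K K1 HK] := @derive1_stp_bounded R.
have K0 : 0 < K by lra.
have p0 : 0 < p by exact: lt_trans p1.
(* With B below, a uniform bound on phi1, phi2 and rho, and a domain of volume at
   most 8, each of them pairs to at most B * (1 + 8) * eps = 1 / 20. *)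
pose eps : R := (12 * 120 * K ^+ 3)^-1.
have K3 : 0 < K ^+ 3 by rewrite exprn_gt0.
have e0 : 0 < eps by rewrite invr_gt0 !mulr_gt0 ?ltr0n.
have [w sw hw] := dense (u p) (u_sobolev p1) eps e0.
have [F [FI Fa Fv0 Fv1]] := sobolev_norm_lt e0 hw.
set a := (u p \- w)%R in Fa Fv0 Fv1.
have [Lw wg] := sw.
have wu i := u_weak_partial p1 i.
have wp i : is_weak_partial Omega i a (weak_partial Omega i a).
  have [g [hg _]] := wg i.
  exact: is_weak_partial_weak_partial (is_weak_partialB oO (wu i) hg).
have [g [hg Lg]] := wg (inord 1).
have [r [N [pr N0 gN]]] := Lp_on_downgrade ltr01 oO OC p1 pq Lg.
have r1 : 1 < r by exact: lt_trans pr.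
set v0 := weak_partial Omega (inord 0) a in Fv0.
set v1 := weak_partial Omega (inord 1) a in Fv1.
have [la lv0 P0] := (is_weak_partialP _ _ _ oO).1 (wp (inord 0)).
have [_ lv1 P1] := (is_weak_partialP _ _ _ oO).1 (wp (inord 1)).
have [lw lg Pg] := (is_weak_partialP _ _ _ oO).1 hg.
have [lu _ _] := (is_weak_partialP _ _ _ oO).1 (wu (inord 1)).
have mO := open_measurable3 oO.
have mu8 : (mu3 Omega <= 8%:E)%E.
  have := open_measure_cube3 ltr01 oO OC; rewrite mulr1.
  by rewrite (_ : 2 ^+ 3 = 8)//; ring.
pose B : R := 8 * K ^+ 3.
have B0 : 0 <= B by rewrite /B mulr_ge0// ltW.
have small (c phi : R3 R -> R) : locally_integrable_on Omega c -> continuous phi ->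
    supp_in Omega phi -> (forall x, `|phi x| <= B) -> (forall x, `|c x| `^ p <= F x) ->
    `|pair Omega c phi| <= 12^-1.
  move=> lc cphi sphi phiB cF.
  have out x : ~ Omega x -> phi x = 0.
    by case: sphi => C [_ CO h] Ox; apply: h => /CO.
  have := pair_bound oO lc cphi sphi p1 e0 B0 mO mu8 out phiB (fun x _ => cF x) FI.
  have -> : eps `^ (1 - p) * eps `^ p = eps.
    by rewrite -powRD ?subrK ?powRr1 ?(ltW e0)//; apply/implyP => _; rewrite gt_eqF.
  have Beps : B * eps = (12 * 15)^-1 by rewrite /B /eps; field; rewrite gt_eqF.
  rewrite (_ : B * (eps + eps * 8) = 9 * (B * eps)); last by ring.
  by rewrite Beps; lra.
(* Test the divergence identity against a = u - w; the jump of u contributes 1/2. *)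
have key k : 4^-1 <= `|pair Omega g (phi3 p k)|.
  have t1 := phi1_test p1 k; have t2 := phi2_test p1 k; have t3 := phi3_test p1 k.
  have s1 := test_function_supp_in t1; have s2 := test_function_supp_in t2.
  have s3 := test_function_supp_in t3.
  have d1 := test_function_derive_supp_in (inord 0) t1.
  have d2 := test_function_derive_supp_in (inord 1) t2.
  have d3 := test_function_derive_supp_in (inord 1) t3.
  have [sm1 _ _] := t1; have [sm2 _ _] := t2; have [sm3 _ _] := t3.
  have c1 := smooth_continuous sm1; have c2 := smooth_continuous sm2.
  have cd1 := smooth_derive_continuous (i := inord 0) sm1.
  have cd2 := smooth_derive_continuous (i := inord 1) sm2.
  have cd3 := smooth_derive_continuous (i := inord 1) sm3.
  have e1 := small v0 (phi1 p k) lv0 c1 s1 (phi1_bound p1 K1 HK k) Fv0.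
  have e2 := small v1 (phi2 p k) lv1 c2 s2 (phi2_bound p1 K1 HK k) Fv1.
  pose d12 x := 'D_(basis3 (inord 0)) (phi1 p k) x + 'D_(basis3 (inord 1)) (phi2 p k) x.
  have supp_add (f h : R3 R -> R) : supp_in Omega f -> supp_in Omega h ->
      supp_in Omega (fun x => f x + h x).
    move=> [K2 [cK2 KO2 h2]] [K4 [cK4 KO4 h4]]; exists (K2 `|` K4); split.
    - exact: compactU.
    - by move=> x [/KO2|/KO4].
    - by move=> x Kx; rewrite h2 ?h4 ?addr0// => Kx'; apply: Kx; [right|left].
  have cont_add (f h : R3 R -> R) : continuous f -> continuous h ->
      continuous (fun x => f x + h x).
    by move=> cf ch x; apply: cvgD; [exact: cf|exact: ch].
  have sd12 : supp_in Omega d12 by exact: supp_add.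
  have cd12 : continuous d12 by exact: cont_add.
  have rhoE : rho p k = fun x => d12 x + 'D_(basis3 (inord 1)) (phi3 p k) x.
    by apply/funext => x; exact: flux_divergence.
  have srho : supp_in Omega (rho p k) by rewrite rhoE; exact: supp_add.
  have crho : continuous (rho p k) by rewrite rhoE; exact: cont_add.
  have e3 := small a (rho p k) la crho srho (rho_bound p1 K1 HK k) Fa.
  have E : pair Omega a (rho p k) =
      - pair Omega v0 (phi1 p k) - pair Omega v1 (phi2 p k) - 2^-1 + pair Omega g (phi3 p k).
    rewrite rhoE pairDr// pairDr// P0// P1//.
    have -> : pair Omega a ('D_(basis3 (inord 1)) (phi3 p k)) = - 2^-1 + pair Omega g (phi3 p k).
      by rewrite pairBl// Pg// opprK pair_u_phi3.
    by rewrite addrA.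
  by move: e3; rewrite E; exact: three_small.
(* Scaling the Young weight like 1 / thick k makes the volume of the channels
   contribute a fixed amount, 6 / 100 for this tau. *)
pose tau : R := (100 * K ^+ 2)^-1.
have K2 : 0 < K ^+ 2 by rewrite exprn_gt0.
have tau0 : 0 < tau by rewrite invr_gt0 mulr_gt0 ?ltr0n.
pose Q : R := K ^+ 2 * (tau `^ (1 - r) * N) * (2 * 4^-1 `^ (r - 1)).
have Q0 : 0 <= Q by rewrite /Q !mulr_ge0 ?powR_ge0// ltW.
have rp : 0 < r - p by lra.
have e8 : 0 < (8 * (Q + 1))^-1 by rewrite invr_gt0 mulr_gt0//; lra.
have [k hk] := dyad_pow_small rp e8.
have := key k; apply/negP; rewrite -ltNge.
have t3 := phi3_test p1 k; have s3 := test_function_supp_in t3.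
have [sm3 _ _] := t3; have c3 := smooth_continuous sm3.
have w0 := width_gt0 p k; have l0 := @thick_gt0 R k; have k0 := @kap_gt0 R k.
have dk0 := @dyad_gt0 R k.
have delta0 : 0 < tau / thick k by rewrite divr_gt0.
have C0 : 0 <= K ^+ 2 / width p k by rewrite divr_ge0// ltW.
have := pair_bound oO lg c3 s3 r1 delta0 C0 (measurable_tube3 p k) (measure_tube3 p1 k)
  (@phi3_supp R p p1 k) (phi3_bound p1 HK k) (fun x _ => lexx _) gN.
move=> h; apply: le_lt_trans h _.
have T1 : K ^+ 2 / width p k * (tau / thick k * (6 * (width p k * thick k))) = 6 / 100.
  by rewrite /tau; field; rewrite !gt_eqF.
have T2 : K ^+ 2 / width p k * ((tau / thick k) `^ (1 - r) * N) = Q * (dyad k `^ (r - p) / kap k).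
  have -> : (tau / thick k) `^ (1 - r) = tau `^ (1 - r) * (thick k) `^ (r - 1).
    have il0 : 0 <= (thick k)^-1 :> R by rewrite invr_ge0 ltW.
    rewrite (powRM (1 - r) (ltW tau0) il0); congr (_ * _).
    by rewrite -powR_inv1 ?(ltW l0)// -powRrM mulN1r opprB.
  have -> : thick k `^ (r - 1) = dyad k `^ (r - p) * dyad k `^ (p - 1) * 4^-1 `^ (r - 1).
    have h4 : 0 <= 4^-1 :> R by lra.
    rewrite /thick (powRM (r - 1) (ltW dk0) h4); congr (_ * _).
    by rewrite -powRD ?addrA ?subrK//; apply/implyP => _; exact: lt0r_neq0.
  have dp0 : 0 < dyad k `^ (p - 1) by rewrite powR_gt0.
  rewrite /Q /width; field; rewrite !gt_eqF//.
rewrite mulrDr T1 T2.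
have : Q * (dyad k `^ (r - p) / kap k) <= 8^-1.
  move: hk; rewrite -ltr_pdivrMr// => /ltW hk.
  apply: le_trans (ler_wpM2l Q0 hk) _.
  rewrite ler_pdivrMr ?mulr_gt0//; lra.
lra.
Qed.

End nondensity.

Theorem theorem1p1 (R : realType) (p : R) (hp : 1 < p) :
  exists Omega : set (R3 R),
    [/\ domain Omega,
        bounded_set Omega,
        (exists f : R3 R -> R3 R,
           homeomorphism_between Omega unit_ball f /\
           locally_bilipschitz Omega f) &
        forall q : \bar R, (p%:E < q)%E -> ~ sobolev_dense Omega q p].
Proof.
have oM := @open_maze R p; have Mbox := @maze_box R p.
exists (Omega p); split.
- exact: cellar_domain.
- exact: bounded_cellar.
- exists (cellar_to_ball (maze p)); split.
    exact: cellar_homeomorphism.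
  exact: cellar_locally_bilipschitz.
- by move=> q pq; exact: not_dense.
Qed.
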